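(* There are universal constants $c_1,c_2,c_3>0$ such that the following holds. Consider a discounted Markov decision process, a target policy $\pi$, a data distribution $\mu$, and a class $\mathcal F$ of functions $\mathcal S\times\mathcal A\to[-1,1]$ with $f^\star\in\mathcal F$ (realizability) and incompleteness factor $\beta<1$. Put $K=1$ if $\mathcal F$ is convex and $K=\frac1{1-\beta}$ if $\mathcal F$ is non-convex. Let $\delta\in(0,1)$ and let $r_c>0$ be such that every $r\ge r_c$ satisfies the three inequalities $$\mathcal R_n\Big\{\ell(f,f)-\ell(g_f,f)\;:\; f\in\mathcal F,\ \mathbb E[\ell(f,f)-\ell(g_f,f)]\le 2r^2\Big\}\le c_1r^2,$$ $$\mathcal R_n\big[(\mathcal F-f^\star)(K r)\big]\le c_2r^2,$$ $$(K+1)\,\frac{\ln(1/(\delta r))}{n}\le c_3r^2 .$$ Let $\hat f\in\arg\min_{f\in\mathcal F}\widehat{\mathcal M}(f)$ be an empirical minimizer computed from $n$ i.i.d. tuples. Then with probability at least $1-\delta$, $$|\mathcal E(\hat f)|\;\le\;\frac{r_c}{1-\gamma}\sqrt{\frac{C}{1-\beta}},$$ where $C$ is the concentrability coefficient.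
   Context: Setting. $\mathcal S$, $\mathcal A$ are the state and action spaces, $\gamma\in[0,1)$ the discount factor; for each $(s,a)$ there is a reward distribution $R(s,a)$ supported on $[0,1]$ with mean $r(s,a)$ and a transition kernel $P(\cdot\mid s,a)$ on $\mathcal S$. A stationary target policy $\pi$ is fixed, and $f(s,\pi)=\mathbb E_{a\sim\pi(\cdot\mid s)}f(s,a)$. The function $f^\star$ is the action-value function of $\pi$: $f^\star(s,a)=r(s,a)+\sum_{h\ge1}\gamma^h\,\mathbb E[r(S_h,A_h)\mid (S_0,A_0)=(s,a)]$, with actions $A_h\sim\pi(\cdot\mid S_h)$ for $h\ge 1$ and transitions $S_{h+1}\sim P(\cdot\mid S_h,A_h)$. The Bellman evaluation operator is $(\mathcal T f)(s,a)=r(s,a)+\gamma\,\mathbb E_{s^+\sim P(\cdot\mid s,a)}f(s^+,\pi)$. The prediction error from a fixed initial state $s_0$ is $\mathcal E(f)=f^\star(s_0,\pi)-f(s_0,\pi)$. The discounted occupancy measure is $d_\pi(s,a)=(1-\gamma)\sum_{h\ge0}\gamma^h\,\mathbb P[(S_h,A_h)=(s,a)]$ when following $\pi$ from $s_0$. Data and norms. $\mu$ is a distribution over $\mathcal S\times\mathcal A$. The dataset $\mathcal D$ has $n$ i.i.d. tuples $(s,a,r,s^+)$ with $(s,a)\sim\mu$ and, given $(s,a)$, $r\sim R(s,a)$, $s^+\sim P(\cdot\mid s,a)$; $\mathbb E$ of a function of a tuple is expectation under this law. Norms: $\|f\|_\mu^2=\mathbb E_{(s,a)\sim\mu}[f(s,a)^2]$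 and $\|f\|_\pi^2=\mathbb E_{(s,a)\sim d_\pi}[f(s,a)^2]$. Cost and empirical minimax program. For $g,f\in\mathcal F$ let $\ell(g,f)=(g(s,a)-r-\gamma f(s^+,\pi))^2$, a function of the tuple $(s,a,r,s^+)$, and $\widehat{\mathcal L}(g,f)=\frac1n\sum_{(s,a,r,s^+)\in\mathcal D}\ell(g,f)$; set $\widehat{\mathcal M}(f)=\widehat{\mathcal L}(f,f)-\min_{g\in\mathcal F}\widehat{\mathcal L}(g,f)$. The projected backup is $g_f\in\arg\min_{g\in\mathcal F}\|g-\mathcal T f\|_\mu^2$. All minimizers are assumed to exist, and it is assumed that there are no measurability issues (the suprema of empirical processes over the classes involved are measurable and Talagrand's concentration inequality is applicable). Rademacher complexity. For a class $\mathcal H$ of functions of a data tuple (or of $(s,a)$ only), $\mathcal R_n[\mathcal H]=\mathbb E\sup_{h\in\mathcal H}\big|\frac1n\sum_{i=1}^n\varepsilon_ih(Z_i)\big|$, where $Z_1,\dots,Z_n$ are i.i.d. tuples from the data law and $\varepsilon_i$ are independent uniform $\pm1$ signs. For $\rho\ge0$, $(\mathcal F-f^\star)(\rho)=\{f-f^\star: f\in\mathcal F,\ \|f-f^\star\|_\mu\le\rho\}$. Incompleteness factor and concentrability coefficient: $\beta=\sup_{f\in\mathcal F}\inf_{g\in\mathcal F}\frac{\|g-\mathcal T f\|_\mu}{\|f-\mathcal T f\|_\mu}$ and $C=\sup_{f\in\mathcal F}\frac{\|f-\mathcal T f\|_\pi^2}{\|f-\mathcal T f\|_\mu^2}$, with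 $0/0:=0$ and $a/0:=+\infty$ for $a>0$. (Always $\beta\in[0,1]$.) *)

(* Defs.v *)
From HB Require Import structures.
From mathcomp Require Import all_boot all_order all_algebra.
From mathcomp Require Import all_classical all_reals all_analysis.
From mathcomp Require Import measurable_realfun.

Set Implicit Arguments.
Unset Strict Implicit.
Unset Printing Implicit Defensive.

Import Order.TTheory GRing.Theory Num.Theory.
Import numFieldNormedType.Exports.

Local Open Scope classical_set_scope.
Local Open Scope ring_scope.

Section precomposition.
Context d1 d2 d3 (X : measurableType d1) (Y : measurableType d2)
  (Z : measurableType d3) (R : realType).
Variables (f : X -> Y) (mf : measurable_fun [set: X] f) (k : R.-pker Y ~> Z).

(* The proof argument lets the kernel structure of k \o f be inferred. *)
Definition kprecomp of measurable_fun [set: X] f :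
  X -> {measure set Z -> \bar R} := k \o f.

Let measurable_kprecomp U :
  measurable U -> measurable_fun [set: X] (kprecomp mf ^~ U).
Proof.
by move=> mU; exact: (measurableT_comp (measurable_kernel k U mU) mf).
Qed.

HB.instance Definition _ :=
  isKernel.Build _ _ _ _ R (kprecomp mf) measurable_kprecomp.

Let kprecomp_prob x : kprecomp mf x [set: Z] = 1%E.
Proof. exact: prob_kernel. Qed.

HB.instance Definition _ :=
  Kernel_isProbability.Build _ _ _ _ R (kprecomp mf) kprecomp_prob.

End precomposition.
Arguments kprecomp {d1 d2 d3 X Y Z R f} k mf _.

Section probability_mkproduct.
Context d0 d1 d2 (T0 : measurableType d0) (T1 : measurableType d1)
  (T2 : measurableType d2) (R : realType).
Variables (k1 : R.-pker T0 ~> T1) (k2 : R.-pker (T0 * T1) ~> T2).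

Let mkproduct_prob x : mkproduct k1 k2 x [set: T1 * T2] = 1%E.
Proof.
rewrite /mkproduct /= /kproduct -[RHS](prob_kernel (s := k1) x).
rewrite -[RHS]mul1e -integral_cst//; apply: eq_integral => y _.
rewrite -[RHS](prob_kernel (s := k2) (x, y)) /kernel.intker_indic.
by rewrite -[RHS]mul1e -integral_cst//; apply: eq_integral => z _; rewrite indicT.
Qed.

HB.instance Definition _ :=
  Kernel_isProbability.Build _ _ _ _ R (mkproduct k1 k2) mkproduct_prob.

End probability_mkproduct.

Section probability_mkcomp_noparam.
Context d0 d1 d2 (T0 : measurableType d0) (T1 : measurableType d1)
  (T2 : measurableType d2) (R : realType).
Variables (k1 : R.-pker T0 ~> T1) (k2 : R.-pker T1 ~> T2).

Let mkcomp_noparam_prob x : mkcomp_noparam k1 k2 x [set: T2] = 1%E.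
Proof.
rewrite /mkcomp_noparam /= /kcomp_noparam -[RHS](prob_kernel (s := k1) x).
by rewrite -[RHS]mul1e -integral_cst//; apply: eq_integral => y _; exact: prob_kernel.
Qed.

HB.instance Definition _ :=
  isProbabilityKernel.Build _ _ _ _ R (mkcomp_noparam k1 k2)
    mkcomp_noparam_prob.

End probability_mkcomp_noparam.

Record mdp (R : realType) d d' (S : measurableType d) (A : measurableType d') :=
  Mdp {
    discount : R ;
    discount_ge0 : 0 <= discount ;
    discount_lt1 : discount < 1 ;
    reward : R.-pker (S * A) ~> R ;
    reward01 : forall x, reward x `[0, 1]%classic = 1%E ;
    transition : R.-pker (S * A) ~> S }.

Section mdp_theory.
Context (R : realType) d d' (S : measurableType d) (A : measurableType d').
Local Notation SA := (S * A)%type.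
Variables (M : mdp R S A) (pi : R.-pker S ~> A).
Local Notation gamma := (discount M).

Definition mean_reward (x : SA) : R := \int[reward M x]_t t.

Definition policy_mean (f : SA -> R) (s : S) : R := \int[pi s]_a f (s, a).

Definition sa_step : R.-pker SA ~> SA :=
  mkproduct (transition M) (kprecomp pi measurable_snd).

(* Law of (S_h, A_h) given (S_0, A_0). *)
Fixpoint sa_law (h : nat) : R.-pker SA ~> SA :=
  if h is h'.+1 then mkcomp_noparam (sa_law h') sa_step
  else kdirac (@measurable_id _ SA setT).

Definition qvalue (x : SA) : R :=
  mean_reward x +
  limn (fun N => \sum_(1 <= h < N)
    gamma ^+ h * \int[sa_law h x]_y mean_reward y).

Definition bellman (f : SA -> R) (x : SA) : R :=
  mean_reward x + gamma * \int[transition M x]_s policy_mean f s.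

Definition prediction_error (s0 : S) (f : SA -> R) : R :=
  policy_mean qvalue s0 - policy_mean f s0.

Lemma occupancy_weight_ge0 h : 0 <= (1 - gamma) * gamma ^+ h.
Proof.
by rewrite mulr_ge0 ?exprn_ge0 ?discount_ge0// subr_ge0 ltW// discount_lt1.
Qed.

(* [(pi \; sa_law h) s0] averages [sa_law h (s0, a)] over a drawn from
   [pi s0]: it is the law of (S_h, A_h) under the policy from s0. *)
Definition occupancy (s0 : S) : {measure set SA -> \bar R} :=
  mseries (fun h => mscale (NngNum (occupancy_weight_ge0 h))
                           ((pi \; sa_law h)%E s0)) 0.

End mdp_theory.

Section norms.
Context (R : realType) d (T : measurableType d).

Definition sqnorm (m : {measure set T -> \bar R}) (f : T -> R) : R :=
  \int[m]_x (f x) ^+ 2.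

Definition norm2 (m : {measure set T -> \bar R}) (f : T -> R) : R :=
  Num.sqrt (sqnorm m f).

(* Quotient of nonnegative reals with 0 / 0 = 0 and a / 0 = +oo for a > 0. *)
Definition eratio (a b : R) : \bar R :=
  if b == 0 then (if a == 0 then 0%E else +oo%E) else (a / b)%:E.

Definition argmin {I : Type} (F : set I) (J : I -> R) : set I :=
  [set g | F g /\ forall h, F h -> J g <= J h].

End norms.

Section coefficients.
Context (R : realType) d d' (S : measurableType d) (A : measurableType d').
Local Notation SA := (S * A)%type.
Variables (M : mdp R S A) (pi : R.-pker S ~> A) (s0 : S).
Variables (mu : probability SA R) (F : set (SA -> R)).
Local Notation T := (bellman M pi).

Definition incompleteness : \bar R :=
  ereal_sup [set ereal_inf [set eratio (norm2 mu (g \- T f))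
                                       (norm2 mu (f \- T f)) | g in F] | f in F].

Definition concentrability : \bar R :=
  ereal_sup [set eratio (sqnorm (occupancy M pi s0) (f \- T f))
                        (sqnorm mu (f \- T f)) | f in F].

Definition radius_factor : R :=
  if `[< convex_set (F : set (convex_lmodType (SA -> R^o))) >] then 1
  else (1 - fine incompleteness)^-1.

End coefficients.

Section data.
Context (R : realType) d d' (S : measurableType d) (A : measurableType d').
Local Notation SA := (S * A)%type.
Variables (M : mdp R S A) (pi : R.-pker S ~> A).
Variable mu : probability SA R.

(* A tuple (s, a, r, s+) is encoded as ((s, a), (r, s+)). *)
Local Notation obs := (SA * (R * S))%type.

(* r and s+ are drawn independently given (s, a). *)
Definition outcome : R.-pker SA ~> (R * S)%type :=
  mkproduct (reward M) (kprecomp (transition M) measurable_fst).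

(* The kernel product is taken from the one-point space, so that [mu] is its
   first factor. *)
Definition data_kernel : R.-pker unit ~> obs :=
  mkproduct (kprobability (measurable_cst (mu : pprobability SA R)))
    (kprecomp outcome measurable_snd).

Definition data_law : set obs -> \bar R := data_kernel tt.

HB.instance Definition _ := Measure.on data_law.

HB.instance Definition _ :=
  Measure_isProbability.Build _ _ _ data_law (prob_kernel tt).

Definition loss (g f : SA -> R) (z : obs) : R :=
  (g z.1 - z.2.1 - discount M * policy_mean pi f z.2.2) ^+ 2.

Definition emp_loss n (D : 'I_n -> obs) (g f : SA -> R) : R :=
  n%:R^-1 * \sum_(i < n) loss g f (D i).

(* [inf] is the minimum whenever the latter is attained. *)
Definition emp_minimax (F : set (SA -> R)) n (D : 'I_n -> obs)
    (f : SA -> R) : R :=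
  emp_loss D f f - inf [set emp_loss D g f | g in F].

Definition loss_gap (g f : SA -> R) (z : obs) : R := loss f f z - loss g f z.

(* Functions l(f, f) - l(proj f, f) with expectation at most t. *)
Definition gap_class (F : set (SA -> R))
    (proj : (SA -> R) -> SA -> R) (t : R) : set (obs -> R) :=
  [set loss_gap (proj f) f |
    f in [set f | F f /\ \int[data_law]_z loss_gap (proj f) f z <= t]].

(* (F - f* )(rho), as functions of a tuple. *)
Definition centered_class (F : set (SA -> R)) (rho : R) : set (obs -> R) :=
  [set (fun z : obs => f z.1 - qvalue M pi z.1) |
    f in [set f | F f /\ norm2 mu (f \- qvalue M pi) <= rho]].

(* Functions l(f*, f* ) - l(f, f* ), for f in F with |f - f*|_mu <= rho. *)
Definition regression_class (F : set (SA -> R)) (rho : R) :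
    set (obs -> R) :=
  [set loss_gap f (qvalue M pi) |
    f in [set f | F f /\ norm2 mu (f \- qvalue M pi) <= rho]].

End data.

Section empirical_processes.
Context (R : realType) d d' (Omega : measurableType d) (T : measurableType d').
Variables (P : probability Omega R) (n : nat).

Definition iid_sample (Q : set T -> \bar R) (Z : 'I_n -> {RV P >-> T}) : Prop :=
  (forall i B, measurable B -> distribution P (Z i) B = Q B) /\
  (forall B : 'I_n -> set T, (forall i, measurable (B i)) ->
     P (\bigcap_(i in [set: 'I_n]) (Z i @^-1` B i)) =
     (\prod_(i < n) P (Z i @^-1` B i))%E).

(* The signs are averaged out explicitly, [e i] standing for the sign
   (-1) ^ (e i). *)
Definition rademacher (Z : 'I_n -> {RV P >-> T}) (H : set (T -> R)) : \bar R :=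
  (((2 ^+ n)^-1)%:E * \sum_(e : {ffun 'I_n -> bool})
     \int[P]_w ereal_sup
       [set (`| n%:R^-1 * \sum_(i < n) (-1) ^+ e i * h (Z i w) |)%:E
       | h in H])%E.

(* Regularity under which suprema over H are random variables (up to a null
   set) and Talagrand's inequality applies to H: the process indexed by h in H
   with values (h (Z_1), ..., h (Z_n), E h) is separable, so that almost surely
   suprema over H are suprema over a countable subclass. *)
Definition separable_process (Q : {measure set T -> \bar R})
    (Z : 'I_n -> {RV P >-> T}) (H : set (T -> R)) : Prop :=
  exists H0 : set (T -> R), [/\ countable H0, H0 `<=` H &
    {ae P, forall w, forall h, H h -> forall e : R, 0 < e ->
      exists2 h0, H0 h0 &
        (forall i, `| h (Z i w) - h0 (Z i w) | < e) /\
        `| \int[Q]_z h z - \int[Q]_z h0 z | < e}].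

End empirical_processes.

(* Main.v *)
Require Import Defs.
From HB Require Import structures.
From mathcomp Require Import all_boot all_order all_algebra.
From mathcomp Require Import all_classical all_reals all_analysis.
From mathcomp Require Import measurable_realfun ring lra.

(* Write g_f for the projected backup of f and
     excess f = |f - T f|_mu^2 - |g_f - T f|_mu^2 = E [l(f, f) - l(g_f, f)].
   As |g_f - T f|_mu <= beta |f - T f|_mu, the excess dominates
   (1 - beta) |f - T f|_mu^2; as the prediction error of f is the discounted sum of
   T f - f along the policy, it is at most |f - T f|_pi / (1 - gamma). It thus
   suffices that excess fhat <= rc^2 with probability 1 - delta.

   Since fhat minimizes M, P_n [l(fhat, fhat) - l(g_fhat, fhat)] <= M(fhat) <=
   M(f* ), and M(f* ) is the maximum over f of P_n [l(f*, f* ) - l(f, f* )], whose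
   mean is - |f - f*|_mu^2 because T f* = f*. So two uniform deviation bounds,
   each on all the shells excess f ~ 2^k rc^2 and |f - f*|_mu^2 ~ 2^k rc^2, suffice:
   the first one yields P_n [l(f, f) - l(g_f, f)] >= rc^2 / 2 as soon as
   excess f > rc^2, the second one M(f* ) <= rc^2 / 4.

   On each shell the variance is of order K r^2 and the Rademacher complexity a
   small multiple of r^2 (by contraction for the second class), so a Talagrand-type
   inequality applies. It is obtained by the entropy method: for the supremum X of
   a centered process bounded by 1, with leave-one-out suprema X_i, the
   tensorized entropy of e^(l X) is bounded through sum_i (X - X_i) <= X, and
   Herbst's argument gives ln E e^(l X) <= 2 l (E X + l n sigma^2). Rounding the
   values of a finite class reduces this to finite probability spaces; separability
   extends it to the whole class. *)

Set Implicit Arguments.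
Unset Strict Implicit.
Unset Printing Implicit Defensive.

Import Order.TTheory GRing.Theory Num.Theory.
Import numFieldNormedType.Exports.

Local Open Scope classical_set_scope.
Local Open Scope ring_scope.

(** * Concentration in finite product spaces *)

(** Three obstacles shape the proof. Suprema over F need not be measurable, and rewards lie in
    [0, 1] only almost surely, so losses are unbounded on a null set: classes are truncated to an
    event of full measure, and deviations are bounded for finite subclasses, uniformly in their
    size. Next, the constants must not depend on K although the variance of l(f, f) - l(g_f, f) is
    of order K r^2: the Laplace parameter is taken of order 1 / K, which leaves n r^2 / K in the
    exponent, the quantity controlled by the third condition. The factor 2 before E X in Herbst's
    bound is harmless, as E X / n is a small multiple of r^2. Finally, the third condition involves
    ln (1 / (delta r)) and says nothing once delta r >= 1. As no excess is above 9, three cases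
    remain: rc >= 3, where nothing is to prove; delta rc >= 1/2, where Markov's inequality suffices;
    and delta rc < 1/2, where the fifth power of delta rc pays for the union over shells. *)

Section finite_product.
Context {R : realType} (T : finType) (n : nat) (p : T -> R).
Hypothesis p_ge0 : forall t, 0 <= p t.
Hypothesis p_sum : \sum_t p t = 1.
Local Notation pts := {ffun 'I_n -> T}.

Definition upd (z : pts) (i : 'I_n) (t : T) : pts :=
  [ffun k => if k == i then t else z k].

Definition weight (z : pts) : R := \prod_(i < n) p (z i).

Definition expect (Y : pts -> R) : R := \sum_z weight z * Y z.

Definition expect_at (i : 'I_n) (Y : pts -> R) (z : pts) : R :=
  \sum_t p t * Y (upd z i t).

Lemma weight_ge0 z : 0 <= weight z. Proof. exact: prodr_ge0. Qed.

Lemma weight_sum : \sum_z weight z = 1.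
Proof.
rewrite /weight -(bigA_distr_bigA (fun (i : 'I_n) t => p t)) /=.
by rewrite big1.
Qed.

Lemma eq_expect Y Y' : Y =1 Y' -> expect Y = expect Y'.
Proof. by move=> e; apply: eq_bigr => z _; rewrite e. Qed.

Lemma expectD Y Y' : expect (fun z => Y z + Y' z) = expect Y + expect Y'.
Proof. by rewrite -big_split; apply: eq_bigr => z _; rewrite mulrDr. Qed.

Lemma expectZ c Y : expect (fun z => c * Y z) = c * expect Y.
Proof. by rewrite mulr_sumr; apply: eq_bigr => z _; rewrite mulrCA. Qed.

Lemma expectB Y Y' : expect (fun z => Y z - Y' z) = expect Y - expect Y'.
Proof.
rewrite -[- expect Y']mulN1r -expectZ -expectD; apply: eq_expect => z; by rewrite mulN1r.
Qed.

Lemma expect_sum (I : finType) (Y : I -> pts -> R) :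
  expect (fun z => \sum_i Y i z) = \sum_i expect (Y i).
Proof.
by rewrite exchange_big; apply: eq_bigr => z _; rewrite mulr_sumr.
Qed.

Lemma expect_cst c : expect (fun=> c) = c.
Proof. by rewrite /expect -mulr_suml weight_sum mul1r. Qed.

Lemma le_expect Y Y' : (forall z, Y z <= Y' z) -> expect Y <= expect Y'.
Proof. by move=> le; apply: ler_sum => z _; rewrite ler_wpM2l ?weight_ge0. Qed.

Lemma expect_ge0 Y : (forall z, 0 <= Y z) -> 0 <= expect Y.
Proof. by move=> le; rewrite -(expect_cst 0); exact: le_expect. Qed.

Lemma expect_gt0 Y : (forall z, 0 < Y z) -> 0 < expect Y.
Proof.
move=> Y0; rewrite lt_neqAle expect_ge0 ?andbT; last by move=> z; exact: ltW.
apply/eqP => /esym/eqP; rewrite psumr_eq0; last first.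
  by move=> z _; rewrite mulr_ge0 ?weight_ge0 ?ltW.
move/allP => H; have := weight_sum; rewrite big1.
  by move/eqP; rewrite eq_sym oner_eq0.
move=> z _; have := H z (mem_index_enum z).
by rewrite /= mulf_eq0 (gt_eqF (Y0 z)) orbF => /eqP.
Qed.

Lemma updK z i : upd z i (z i) = z.
Proof. by apply/ffunP => k; rewrite ffunE; case: eqP => [->|]. Qed.

Lemma upd_upd z i t t' : upd (upd z i t) i t' = upd z i t'.
Proof. by apply/ffunP => k; rewrite !ffunE; case: eqP. Qed.

Lemma upd_eq z i t : upd z i t i = t.
Proof. by rewrite ffunE eqxx. Qed.

Lemma upd_neq z i t k : k != i -> upd z i t k = z k.
Proof. by rewrite ffunE => /negbTE ->. Qed.

Lemma weight_upd z i t : weight (upd z i t) * p (z i) = weight z * p t.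
Proof.
rewrite /weight (bigD1 i) //= [in RHS](bigD1 i) //= upd_eq.
rewrite (eq_bigr (fun k => p (z k))); last first.
  by move=> k ki; rewrite upd_neq.
rewrite mulrAC [RHS]mulrAC; congr (_ * _); exact: mulrC.
Qed.

(** Exchanging the i-th coordinate with an independent copy t is an involution of the pairs (z, t)
    that preserves their joint weight. *)
Lemma resample i (G : pts -> T -> R) :
  \sum_z \sum_t weight z * p t * G z t =
  \sum_z \sum_t weight z * p t * G (upd z i t) (z i).
Proof.
rewrite !pair_big /=.
pose s (x : pts * T) := (upd x.1 i x.2, x.1 i).
have sK : involutive s by move=> [z t]; rewrite /s /= upd_eq upd_upd updK.
rewrite (reindex_inj (inv_inj sK)) /=; apply: eq_bigr => -[z t] _ /=.
by rewrite weight_upd.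
Qed.

Lemma expect_atE i Y : expect (expect_at i Y) = expect Y.
Proof.
transitivity (\sum_z \sum_t weight z * p t * Y z).
  rewrite (resample i); apply: eq_bigr => z _; rewrite mulr_sumr.
  by apply: eq_bigr => t _; rewrite mulrA.
by apply: eq_bigr => z _; rewrite -mulr_suml -mulr_sumr p_sum mulr1.
Qed.

Definition mix (k : nat) (z' z : pts) : pts :=
  [ffun i : 'I_n => if (i < k)%N then z' i else z i].

Lemma mix_upd (k : 'I_n) z' z t :
  mix k z' (upd z k t) = mix k.+1 (upd z' k t) z.
Proof.
apply/ffunP => i; rewrite !ffunE ltnS.
have [->|ik] := eqVneq i k; first by rewrite ltnn leqnn.
by rewrite [(i <= k)%N]leq_eqVlt (_ : (i == k :> nat) = false) //; exact: negbTE.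
Qed.

Lemma mix_updr (k : 'I_n) z' z t : mix k.+1 z' (upd z k t) = mix k.+1 z' z.
Proof.
apply/ffunP => i; rewrite !ffunE ltnS.
by have [->|//] := eqVneq i k; rewrite leqnn.
Qed.

(** The conditional expectation of Y given the coordinates from k on: a martingale read backwards,
    from Y at k = 0 to its mean at k = n. *)
Definition avg_prefix (Y : pts -> R) (k : nat) (z : pts) : R :=
  expect (fun z' => Y (mix k z' z)).

Lemma avg_prefix0 Y z : avg_prefix Y 0 z = Y z.
Proof.
rewrite -[RHS]expect_cst; apply: eq_expect => z'; congr Y.
by apply/ffunP => i; rewrite ffunE.
Qed.

Lemma avg_prefixn Y z : avg_prefix Y n z = expect Y.
Proof.
by apply: eq_expect => z'; congr Y; apply/ffunP => i; rewrite ffunE ltn_ord.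
Qed.

Lemma avg_prefixS Y (k : 'I_n) z : expect_at k (avg_prefix Y k) z = avg_prefix Y k.+1 z.
Proof.
rewrite /expect_at /avg_prefix -[RHS](expect_atE k) /expect_at expect_sum; apply: eq_bigr => t _.
by rewrite expectZ; congr (_ * _); apply: eq_expect => z'; rewrite mix_upd.
Qed.

(* With U = A_k / A_(k+1), where A_k averages out the first k coordinates,
   U has mean 1 in coordinate k, and Y ln U <= Y ln (Y / u) - Y + u U. *)
Lemma entropy_tensor (Y : pts -> R) (u : 'I_n -> pts -> R) :
  (forall z, 0 < Y z) -> (forall i z, 0 < u i z) ->
  (forall i z t, u i (upd z i t) = u i z) ->
  expect (fun z => Y z * ln (Y z)) - expect Y * ln (expect Y) <=
  \sum_i expect (fun z => Y z * (ln (Y z) - ln (u i z)) - Y z + u i z).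
Proof.
move=> Y0 u0 ui; pose A := avg_prefix Y.
have A0 k z : 0 < A k z by apply: expect_gt0.
have tele z : Y z * ln (Y z) - Y z * ln (expect Y) =
    \sum_(i < n) Y z * (ln (A i z) - ln (A i.+1 z)).
  rewrite -mulrBr -mulr_sumr; congr (_ * _).
  rewrite -(big_mkord xpredT (fun i => ln (A i z) - ln (A i.+1 z))).
  rewrite (eq_bigr (fun i => - ln (A i.+1 z) - - ln (A i z))); last first.
    by move=> i _; rewrite opprK addrC.
  rewrite (telescope_sumr (fun i => - ln (A i z))) //.
  by rewrite /A avg_prefixn avg_prefix0 opprK addrC.
have -> : expect (fun z => Y z * ln (Y z)) - expect Y * ln (expect Y) =
    \sum_(i < n) expect (fun z => Y z * (ln (A i z) - ln (A i.+1 z))).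
  rewrite [X in _ - X]mulrC -expectZ -expectB -expect_sum; apply: eq_expect => z.
  by rewrite -tele [ln _ * _]mulrC.
apply: ler_sum => k _.
have step : expect (fun z => u k z * (A k z / A k.+1 z)) = expect (u k).
  rewrite -(expect_atE k); apply: eq_expect => z; rewrite /expect_at.
  have Aupd t : A k.+1 (upd z k t) = A k.+1 z.
    by apply: eq_expect => z'; rewrite mix_updr.
  under eq_bigr => t _ do rewrite ui Aupd mulrCA mulrA mulrA.
  rewrite -mulr_suml.
  under eq_bigr => t _ do rewrite -mulrA.
  rewrite -mulr_sumr -[X in _ * X / _]/(expect_at k (A k) z) avg_prefixS.
  by rewrite mulfK // gt_eqF.
rewrite expectD -step -expectD; apply: le_expect => z.
(* The pointwise bound is ln W <= W - 1 for W = u U / Y, multiplied by Y. *)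
have W0 : 0 < u k z * (A k z / A k.+1 z) / Y z.
  by rewrite !(mulr_gt0, invr_gt0) //.
have := le_ln1Dx (x := u k z * (A k z / A k.+1 z) / Y z - 1).
rewrite ltrBrDl subrr => /(_ W0).
rewrite addrC subrK !(lnM, lnV) ?posrE ?(mulr_gt0, invr_gt0) //.
have YW : Y z * (u k z * (A k z / A k.+1 z) / Y z) = u k z * (A k z / A k.+1 z).
  by rewrite mulrC divfK // gt_eqF.
rewrite -(ler_pM2l (Y0 z)) [leRHS]mulrBr YW mulr1.
set a := ln _; set b := ln _; set c := ln _; set d := ln _.
nra.
Qed.

End finite_product.

(** * Entropy of the exponential of a supremum *)

Section sup_process.
Context {R : realType} (T : finType) (n : nat) (p : T -> R).
Hypothesis p_ge0 : forall t, 0 <= p t.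
Hypothesis p_sum : \sum_t p t = 1.
Variables (J : finType) (j0 : J) (g : J -> T -> R) (s2 : R).
Hypothesis g_le1 : forall j t, g j t <= 1.
Hypothesis g_mean : forall j, \sum_t p t * g j t = 0.
Hypothesis g_var : forall j, \sum_t p t * g j t ^+ 2 <= s2.
Local Notation pts := {ffun 'I_n -> T}.

Definition psum (j : J) (z : pts) : R := \sum_(i < n) g j (z i).
Definition psum' (i : 'I_n) (j : J) (z : pts) : R :=
  \sum_(k < n | k != i) g j (z k).
(** The maximizing index is kept, not only the maximum: the maximizer of the leave-one-out sums does
    not depend on the omitted coordinate, so its increment there is conditionally centered. *)
Definition jmax (f : J -> R) : J := [arg max_(j > j0) f j]%O.
Definition supsum (z : pts) : R := psum (jmax (psum^~ z)) z.
Definition supsum' (i : 'I_n) (z : pts) : R :=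
  psum' i (jmax (psum' i ^~ z)) z.
Local Notation X := supsum.
Local Notation X' := supsum'.

Lemma le_jmax f j : f j <= f (jmax f).
Proof. by rewrite /jmax; case: arg_maxP => //= j' _ /(_ j isT). Qed.

Lemma psumE i j z : psum j z = g j (z i) + psum' i j z.
Proof. by rewrite /psum (bigD1 i). Qed.

Lemma psum'_upd i j z t : psum' i j (upd z i t) = psum' i j z.
Proof. by apply: eq_bigr => k ki; rewrite upd_neq. Qed.

Lemma psum'_upd_fun i z t : psum' i ^~ (upd z i t) = psum' i ^~ z.
Proof. by apply/funext => j; exact: psum'_upd. Qed.

Lemma supsum'_upd i z t : X' i (upd z i t) = X' i z.
Proof. by rewrite /supsum' psum'_upd_fun psum'_upd. Qed.

Let y i z := g (jmax (psum' i ^~ z)) (z i).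
Let x i z := X z - X' i z.

Let y_le_x i z : y i z <= x i z.
Proof.
by rewrite /x /y lerBrDr -psumE; exact: (le_jmax (psum^~ z)).
Qed.

Let x_le_g i z : x i z <= g (jmax (psum^~ z)) (z i).
Proof.
rewrite /x /supsum (psumE i) lerBlDr lerD2l; exact: (le_jmax (psum' i ^~ z)).
Qed.

Let x_le1 i z : x i z <= 1.
Proof. exact: le_trans (x_le_g i z) (g_le1 _ _). Qed.

(** Each x is at most the increment at the maximizer of the full sum, and these increments add up to
    X. *)
Let sum_x z : \sum_i x i z <= X z.
Proof. by apply: ler_sum => i _; exact: x_le_g. Qed.

(** Integrating out the i-th coordinate first, neither u nor the leave-one-out maximizer moves, so a
    bound valid for each fixed j passes to the random maximizer. *)
Let expect_indep (i : 'I_n) (u : pts -> R) (h : T -> J -> R) (c : R) :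
  (forall z t, u (upd z i t) = u z) -> (forall z, 0 <= u z) ->
  (forall j, \sum_t p t * h t j <= c) ->
  expect p (fun z => u z * h (z i) (jmax (psum' i ^~ z))) <= c * expect p u.
Proof.
move=> ui u0 hc; rewrite -(expect_atE p_sum i) -expectZ; apply: le_expect => // z.
rewrite /expect_at; under eq_bigr => t _ do rewrite ui psum'_upd_fun upd_eq mulrCA.
by rewrite -mulr_sumr mulrC ler_wpM2r.
Qed.

(** Jensen's inequality in the i-th coordinate: X >= X' + y, and e^(l y) >= 1 + l y has conditional
    mean at least 1. *)
Let expect_supsum' i l : 0 <= l ->
  expect p (fun z => expR (l * X' i z)) <= expect p (fun z => expR (l * X z)).
Proof.
move=> l0; rewrite -[leRHS](expect_atE p_sum i); apply: le_expect => // z.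
rewrite /expect_at.
apply: (@le_trans _ _ (\sum_t p t * (expR (l * X' i z) *
    (1 + l * g (jmax (psum' i ^~ z)) t)))); last first.
  apply: ler_sum => t _; rewrite ler_wpM2l //.
  have -> : X (upd z i t) = X' i z + x i (upd z i t).
    by rewrite /x supsum'_upd addrC subrK.
  rewrite [l * (_ + _)]mulrDr expRD ler_wpM2l ?expR_ge0 //.
  apply: le_trans (expR_ge1Dx _); rewrite lerD2l ler_wpM2l //.
  by apply: le_trans (y_le_x _ _); rewrite /y psum'_upd_fun upd_eq.
under eq_bigr => t _ do rewrite mulrCA mulrDr mulr1 mulrCA.
rewrite -mulr_sumr big_split /= p_sum -mulr_sumr g_mean mulr0 addr0 mulr1.
by [].
Qed.

(** Multiply e^a >= 1 + a by a - 1 <= 0. *)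
Let psi_le (a : R) : a <= 1 -> expR a * a - expR a + 1 <= a ^+ 2.
Proof. by move=> a1; have := expR_ge1Dx a; nra. Qed.

(* The entropy of e^(lX) is controlled by the leave-one-out suprema X' i: with
   x = X - X' i and y the i-th increment of a maximizer for X' i, one has
   y <= x <= 1, hence x^2 <= 2 (x - y) + y^2; the x sum up to at most X, and y
   has conditional mean 0 and variance at most s2. *)
Lemma entropy_supsum l : 0 <= l <= 1 ->
  l * expect p (fun z => X z * expR (l * X z)) -
    expect p (fun z => expR (l * X z)) * ln (expect p (fun z => expR (l * X z))) <=
  l ^+ 2 * (2 * expect p (fun z => X z * expR (l * X z)) +
            n%:R * s2 * expect p (fun z => expR (l * X z))).
Proof.
case/andP => l0 l1.
set m := expect p (fun z => expR (l * X z)); set m' := expect p _.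
have m0 : 0 <= m by apply: expect_ge0 => // z; exact: expR_ge0.
have := @entropy_tensor _ T n p p_ge0 p_sum (fun z => expR (l * X z))
  (fun i z => expR (l * X' i z)) (fun=> expR_gt0 _) (fun _ _ => expR_gt0 _)
  (fun i z t => congr1 (fun a => expR (l * a)) (supsum'_upd i z t)).
have -> : expect p (fun z => expR (l * X z) * ln (expR (l * X z))) = l * m'.
  by rewrite /m' -expectZ; apply: eq_expect => z; rewrite expRK; ring.
move/le_trans; apply.
have s20 : 0 <= s2.
  apply: le_trans (g_var j0); apply: sumr_ge0 => t _.
  by rewrite mulr_ge0 ?sqr_ge0.
have term i : expect p (fun z => expR (l * X z) * (ln (expR (l * X z)) -
      ln (expR (l * X' i z))) - expR (l * X z) + expR (l * X' i z)) <=
    2 * l ^+ 2 * expect p (fun z => expR (l * X z) * x i z) + l ^+ 2 * (s2 * m).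
  (* Terms in y carry the weight e^(l X') instead of e^(l X): it does not involve the i-th
     coordinate, so [expect_indep] applies. *)
  pose e' z := expR (l * X' i z).
  have e'u z t : e' (upd z i t) = e' z by rewrite /e' supsum'_upd.
  have e'0 z : 0 <= e' z by exact: expR_ge0.
  have yvar : expect p (fun z => e' z * y i z ^+ 2) <= s2 * m.
    apply: le_trans (ler_wpM2l s20 (expect_supsum' i l0)).
    by apply: (expect_indep (h := fun t j => g j t ^+ 2)).
  have ymean : - expect p (fun z => e' z * y i z) <= 0.
    rewrite -mulN1r -expectZ -[leRHS](mul0r (expect p e')).
    rewrite (eq_expect _ (Y' := fun z => e' z * - y i z)); last by move=> z; ring.
    apply: (expect_indep (h := fun t j => - g j t)) => // j.
    by under eq_bigr => t _ do rewrite mulrN; rewrite sumrN g_mean oppr0.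
  apply: (@le_trans _ _ (expect p (fun z => 2 * l ^+ 2 * (expR (l * X z) * x i z) +
      2 * l ^+ 2 * - (e' z * y i z) + l ^+ 2 * (e' z * y i z ^+ 2)))).
    apply: le_expect => // z; rewrite !expRK.
    have XE : l * X z = l * X' i z + l * x i z by rewrite /x; ring.
    have lx1 : l * x i z <= 1 by have := x_le1 i z; nra.
    have := psi_le lx1; have := y_le_x i z; have := x_le1 i z.
    have := e'0 z; rewrite /e' XE expRD.
    set e := expR (l * X' i z); set c := expR (l * x i z); set a := x i z.
    set b := y i z => e0 a1 ba ca.
    have b1 : b <= 1 by exact: le_trans ba a1.
    (* a <= e^(l a) a for either sign of a; this puts the weight e^(l X) back on x, under which the
       sum of the x is controlled. *)
    have cx : e * a <= e * c * a.
      rewrite -mulrA ler_wpM2l //.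
      have [a0|a0] := leP 0 a.
        rewrite ler_peMl // /c; have := expR_ge1Dx (l * x i z).
        by rewrite -/a; nra.
      have : c <= 1 by rewrite /c -expR0 ler_expR -/a; nra.
      by nra.
    (* a^2 - b^2 = (a - b) (a + b) with a - b >= 0 and a + b <= 2. *)
    have ab : a ^+ 2 <= 2 * (a - b) + b ^+ 2 by nra.
    have l2 : 0 <= l ^+ 2 by exact: sqr_ge0.
    apply: (@le_trans _ _ (e * (c * (l * a) - c + 1))); first by lra.
    apply: (@le_trans _ _ (e * (l ^+ 2 * a ^+ 2))).
      by rewrite ler_wpM2l // -exprMn.
    apply: (@le_trans _ _ (l ^+ 2 * (e * (2 * (a - b) + b ^+ 2)))).
      by rewrite mulrCA ler_wpM2l // ler_wpM2l.
    by have := ler_wpM2l l2 cx; lra.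
  rewrite expectD expectD !expectZ.
  rewrite -[X in _ + 2 * l ^+ 2 * X + _]mul1r.
  have -> : expect p (fun z => - (e' z * y i z)) = - expect p (fun z => e' z * y i z).
    by rewrite -mulN1r -expectZ; apply: eq_expect => z; ring.
  have := sqr_ge0 l; move: yvar ymean; set A := expect p _; set B := expect p _.
  set C := expect p _; move=> yv ym l2; rewrite mul1r.
  by have := ler_wpM2l l2 yv; have := ler_wpM2l l2 ym; lra.
apply: (le_trans (ler_sum _ (fun i _ => term i))).
rewrite big_split /= sumr_const card_ord -mulr_sumr -expect_sum.
have : expect p (fun z => \sum_i expR (l * X z) * x i z) <= m'.
  apply: le_expect => // z; rewrite -mulr_sumr [leRHS]mulrC.
  by rewrite ler_wpM2l ?expR_ge0.
move=> H; have := ler_wpM2l (sqr_ge0 l) H; rewrite -mulr_natl.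
set A := expect p _; lra.
Qed.

End sup_process.

(** * From entropy to the moment generating function *)

Section herbst.
Context {R : realType} (Z : finType) (w X : Z -> R).
Hypothesis w_ge0 : forall z, 0 <= w z.
Hypothesis w_sum : \sum_z w z = 1.
Local Notation m := (fun l => \sum_z w z * expR (l * X z)).
Local Notation m' := (fun l => \sum_z w z * (X z * expR (l * X z))).

Let mgf_gt0 l : 0 < m l.
Proof.
have [z wz] : exists z, 0 < w z.
  apply/not_existsP => H; have : \sum_z w z <= 0.
    by apply: sumr_le0 => z _; rewrite leNgt; exact/negP/H.
  by rewrite w_sum ler10.
rewrite (bigD1 z) //= ltr_pwDl ?mulr_gt0 ?expR_gt0 //.
by apply: sumr_ge0 => ? _; rewrite mulr_ge0 ?expR_ge0.
Qed.

Lemma is_derive_mgf (l : R) : is_derive l (1 : R) (m : R -> R) (m' l).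
Proof.
rewrite (_ : m = \sum_z (fun t => w z * expR (t * X z))); last first.
  by apply/funext => t; rewrite fct_sumE.
elim/big_ind2 : _ => [|a b c d ? ?|z _].
- exact: is_derive_cst.
- exact: is_deriveD.
have h0 : is_derive l (1 : R) ( *%R^~ (X z) : R -> R) (X z).
  have := is_deriveM (is_derive_id l (1 : R)) (is_derive_cst (X z) l (1 : R)).
  by move/is_derive_eq; apply; rewrite scaler0 add0r /cst [_ *: _]mulr1.
have h1 := is_derive1_comp (is_derive_expR _) h0.
have := is_deriveZ (w z) h1.
by move/is_derive_eq; apply; rewrite [_ *: _]/(_ * _) [X in _ * X]mulrC.
Qed.

(* The hypothesis makes [ln (m l) / l - 2 * ln (m l) - v * l] nonincreasing, and
   its limit at 0 is the mean of X. *)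
Lemma herbst (v : R) : 0 <= v -> 0 <= \sum_z w z * X z ->
  (forall l : R, 0 <= l <= 1 ->
     l * m' l - m l * ln (m l) <= l ^+ 2 * (2 * m' l + v * m l)) ->
  forall l : R, 0 < l -> l <= 4^-1 ->
    m l <= expR (2 * l * (\sum_z w z * X z + v * l)).
Proof.
move=> v0 EX0 H l l0 l4; set EX := \sum_z _ in EX0 *.
pose D t := ln (m t) * (t^-1 - 2) - v * t.
pose D' t := m' t / m t * (t^-1 - 2) - ln (m t) * (t ^- 2) - v.
have dD (t : R) : 0 < t -> is_derive t (1 : R) D (D' t).
  move=> t0.
  have h1 := is_derive1_comp (is_derive1_ln (mgf_gt0 t)) (is_derive_mgf t).
  have h2 := is_deriveV (lt0r_neq0 t0) (is_derive_id t (1 : R)).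
  have h3 := is_deriveB h2 (is_derive_cst (2 : R) t (1 : R)).
  have h4 := is_deriveZ v (is_derive_id t (1 : R)).
  have := is_deriveB (is_deriveM h1 h3) h4.
  move/is_derive_eq; apply; rewrite /D' -![_ *: _]/(_ * _) /=.
  rewrite !fctE /cst /=; field.
  by rewrite (gt_eqF t0) gt_eqF.
have D'0 (t : R) : 0 < t -> t <= l -> D' t <= 0.
  move=> t0 tl; have t01 : 0 <= t <= 1 by rewrite (ltW t0) /=; lra.
  have := H _ t01; rewrite -subr_le0.
  have m0 := mgf_gt0 t.
  have -> : t * m' t - m t * ln (m t) - t ^+ 2 * (2 * m' t + v * m t) =
    (t ^+ 2 * m t) * D' t.
    by rewrite /D'; field; rewrite (gt_eqF t0) gt_eqF.
  by rewrite pmulr_rle0 // mulr_gt0 // exprn_gt0.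
have Dmono (e : R) : 0 < e -> e < l -> D l <= D e.
  move=> e0 el; have [||c cel E] := @MVT R D D' e l el.
  - by move=> c; rewrite in_itv /= => /andP[ec _]; apply: dD; exact: lt_trans ec.
  - apply: derivable_within_continuous => c; rewrite in_itv /= => /andP[ec _].
    by have [] := dD c (lt_le_trans e0 ec).
  rewrite -subr_le0 E.
  move: cel; rewrite in_itv /= => /andP[ec cl].
  by rewrite pmulr_lle0 ?subr_gt0 // D'0 ?(ltW cl) // (lt_trans e0).
pose V := \sum_z w z * X z ^+ 2.
have V0 : 0 <= V by apply: sumr_ge0 => z _; rewrite mulr_ge0 ?sqr_ge0.
pose B := \sum_z `|X z|.
have XB z : X z <= B.
  rewrite /B (bigD1 z) //= -[leLHS]addr0 lerD ?ler_norm //.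
  exact: sumr_ge0.
have B0 : 0 <= B by exact: sumr_ge0.
(* Instead of a limit of D at 0, an explicit bound near 0. The restriction on e ensures e X <= 1/2,
   as needed for the second-order bound on e^(e X). *)
have small (e : R) : 0 < e -> e <= (2 * (B + 1))^-1 -> e < l ->
    D l <= EX + e * (2 * V).
  move=> e0 eB el; apply: le_trans (Dmono _ e0 el) _.
  have eX z : e * X z <= 2^-1.
    have B1 : 0 < 2 * (B + 1) by lra.
    have : e * (2 * (B + 1)) <= 1 by rewrite -ler_pdivlMr // mul1r.
    by have := ler_wpM2l (ltW e0) (XB z); lra.
  have mE : m e <= 1 + e * EX + e ^+ 2 * (2 * V).
    rewrite -[X in X + _ + _]w_sum /EX /V !mulr_sumr -!big_split /=; apply: ler_sum => z _.
    apply: (@le_trans _ _ (w z * (1 + e * X z + 2 * (e * X z) ^+ 2))); last by lra.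
    rewrite ler_wpM2l //; move: (eX z); set a := e * X z => a1.
    have a0 : 0 < 1 - a by lra.
    (* e^a (1 - a) <= 1 because e^(-a) >= 1 - a, and (1 + a + 2 a^2) (1 - a) = 1 + a^2 (1 - 2 a) >=
       1 for a <= 1/2. *)
    rewrite -(ler_pM2r a0); apply: (@le_trans _ _ 1); last by nra.
    rewrite -[leRHS]expR0 -[in leRHS](subrr a) expRD ler_pM2l ?expR_gt0 //.
    exact: expR_ge1Dx.
  have lnm : ln (m e) <= e * EX + e ^+ 2 * (2 * V).
    have := le_ln1Dx (x := m e - 1).
    rewrite ltrBrDl subrr => /(_ (mgf_gt0 e)).
    by rewrite addrC subrK; lra.
  have e2 : 2 <= e^-1 by rewrite -(invrK 2) lef_pV2 ?posrE //; lra.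
  rewrite /D.
  have eK : e * e^-1 = 1 by rewrite mulfV ?gt_eqF.
  have := ler_wpM2r (_ : 0 <= e^-1 - 2) lnm; rewrite subr_ge0 => /(_ e2).
  have -> : (e * EX + e ^+ 2 * (2 * V)) * (e^-1 - 2) =
     (e * e^-1) * (EX + e * (2 * V)) - 2 * (e * EX + e ^+ 2 * (2 * V)) by ring.
  rewrite eK mul1r.
  have : 0 <= v * e by rewrite mulr_ge0 // ltW.
  have : 0 <= e * EX by rewrite mulr_ge0 // ltW.
  have : 0 <= e ^+ 2 * (2 * V) by rewrite !mulr_ge0 // ltW.
  lra.
have Dl : D l <= EX.
  apply/ler_addgt0Pr => eps eps0.
  pose e := Num.min (Num.min (2 * (B + 1))^-1 (l / 2)) (eps / (2 * V + 1)).
  have e1 : e <= (2 * (B + 1))^-1 by rewrite /e !ge_min lexx.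
  have e2 : e <= l / 2 by rewrite /e !ge_min lexx orbT.
  have e3 : e <= eps / (2 * V + 1) by rewrite /e !ge_min lexx orbT.
  have V1 : 0 < 2 * V + 1 by lra.
  have e0 : 0 < e by rewrite /e !lt_min invr_gt0 !divr_gt0 // andbT mulr_gt0 //; lra.
  apply: le_trans (small e e0 e1 _) _; first by lra.
  rewrite lerD2l; move: e3; rewrite ler_pdivlMr //; lra.
rewrite -[leLHS]lnK ?posrE // ler_expR.
have [ln0|ln0] := leP (ln (m l)) 0.
  by apply: le_trans ln0 _; rewrite !mulr_ge0 ?addr_ge0 // ?mulr_ge0 // ltW.
move: Dl; rewrite /D lerBlDr => Dl.
have lK : l * l^-1 = 1 by rewrite mulfV ?gt_eqF.
have l20 : 0 <= 2 * l by lra.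
apply: le_trans (ler_wpM2l l20 Dl).
(* The left side is (2 - 4 l) ln (m l), and 2 - 4 l >= 1: this is where l <= 1/4 comes from. *)
have -> : 2 * l * (ln (m l) * (l^-1 - 2)) =
  2 * (l * l^-1) * ln (m l) - 4 * l * ln (m l) by ring.
rewrite lK; nra.
Qed.

End herbst.

(** * Symmetrization and tail bound on a finite space *)

Section finite_deviation.
Context {R : realType} (T : finType) (n : nat) (p : T -> R).
Hypothesis p_ge0 : forall t, 0 <= p t.
Hypothesis p_sum : \sum_t p t = 1.
Variables (J : finType) (h : J -> T -> R).
Local Notation pts := {ffun 'I_n -> T}.
Local Notation signs := {ffun 'I_n -> bool}.

Definition pmean (j : J) : R := \sum_t p t * h j t.

Definition devsum (z : pts) : R :=
  \big[Num.max/0]_(j : J) `|\sum_(i < n) (h j (z i) - pmean j)|.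

Definition radsum (e : signs) (z : pts) : R :=
  \big[Num.max/0]_(j : J) `|\sum_(i < n) (-1) ^+ e i * h j (z i)|.

Lemma expect_marginal (i : 'I_n) (f : T -> R) :
  expect p (fun z => f (z i)) = \sum_t p t * f t.
Proof.
rewrite -(expect_atE p_sum i) -[RHS](expect_cst n p_sum); apply: eq_expect => z.
by apply: eq_bigr => t _; rewrite upd_eq.
Qed.

Let swap (e : signs) (x : pts * pts) : pts * pts :=
  ([ffun i => if e i then x.2 i else x.1 i],
   [ffun i => if e i then x.1 i else x.2 i]).

Let swapK e : involutive (swap e).
Proof.
by case=> a b; congr pair; apply/ffunP => i; rewrite !ffunE /=; case: (e i).
Qed.

Let weight_swap e a b : weight p (swap e (a, b)).1 * weight p (swap e (a, b)).2 =
  weight p a * weight p b.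
Proof.
rewrite /weight -!big_split; apply: eq_bigr => i _ /=; rewrite !ffunE.
by case: (e i); rewrite // mulrC.
Qed.

(** The signs stay fixed: exchanging sample and ghost sample at the coordinates where [e] is true
    preserves the product law and inserts exactly these signs. Averaging over [e] is postponed to
    the comparison with [rademacher]. *)
Lemma symmetrization (e : signs) : expect p devsum <= 2 * expect p (radsum e).
Proof.
pose D (z z' : pts) (e : signs) : R := \big[Num.max/0]_(j : J)
  `|\sum_(i < n) (-1) ^+ e i * (h j (z i) - h j (z' i))|.
have devD z : devsum z <= expect p (fun z' => D z z' [ffun=> false]).
  apply: bigmax_le; first by apply: expect_ge0 => // z'; exact: bigmax_ge_id.
  move=> j _.
  have -> : \sum_(i < n) (h j (z i) - pmean j) =
      expect p (fun z' : pts => \sum_(i < n) (h j (z i) - h j (z' i))).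
    rewrite expect_sum; apply: eq_bigr => i _.
    by rewrite expectB (expect_cst _ p_sum) expect_marginal.
  apply: (@le_trans _ _ (expect p (fun z' : pts =>
      `|\sum_(i < n) (h j (z i) - h j (z' i))|))).
    apply: le_trans (ler_norm_sum _ _ _) _; apply: ler_sum => z' _.
    by rewrite normrM ger0_norm // weight_ge0.
  apply: le_expect => // z'; apply: le_trans (le_bigmax _ _ j).
  by under [in leRHS]eq_bigr => i _ do rewrite ffunE expr0 mul1r.
have swapE : expect p (fun z => expect p (fun z' => D z z' [ffun=> false])) =
    expect p (fun z => expect p (fun z' => D z z' e)).
  have flat (G : pts -> pts -> R) : expect p (fun z => expect p (G z)) =
      \sum_(x : pts * pts) weight p x.1 * weight p x.2 * G x.1 x.2.
    rewrite /expect -(pair_bigA _ (fun z z' => weight p z * weight p z' * G z z')) /=.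
    apply: eq_bigr => z _.
    by rewrite mulr_sumr; apply: eq_bigr => z' _; rewrite mulrA.
  rewrite !flat (reindex_inj (inv_inj (swapK e))); apply: eq_bigr => -[a b] _.
  rewrite weight_swap; congr (_ * _); apply: eq_bigr => j _; congr `|_|.
  apply: eq_bigr => i _; rewrite !ffunE /=; case: (e i) => /=.
    by rewrite expr1 expr0; ring.
  by rewrite expr0.
have Dle z z' : D z z' e <= radsum e z + radsum e z'.
  apply: bigmax_le; first by rewrite addr_ge0 // bigmax_ge_id.
  move=> j _; under eq_bigr => i _ do rewrite mulrBr.
  rewrite sumrB; apply: le_trans (ler_normB _ _) _.
  apply: lerD.
    exact: (le_bigmax 0 (fun j => `|\sum_(i < n) (-1) ^+ e i * h j (z i)|) j).
  exact: (le_bigmax 0 (fun j => `|\sum_(i < n) (-1) ^+ e i * h j (z' i)|) j).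
apply: (le_trans (le_expect p_ge0 devD)); rewrite swapE.
apply: (@le_trans _ _ (expect p (fun z => radsum e z + expect p (radsum e)))).
  apply: le_expect => // z; rewrite -[X in X + _](expect_cst n p_sum) -expectD.
  exact: le_expect.
by rewrite expectD (expect_cst _ p_sum) mulr2n mulrDl !mul1r.
Qed.

Variables (b s2 : R).
Hypothesis b_gt0 : 0 < b.
Hypothesis h_le : forall j t, `|h j t| <= b.
Hypothesis h_var : forall j, \sum_t p t * h j t ^+ 2 <= s2.

Lemma deviation_tail (rho l t : R) :
  0 < l -> l <= 4^-1 -> 0 < t -> expect p devsum <= rho ->
  expect p (fun z => (t < devsum z)%R%:R) <=
  expR (l / b * (rho - t / 2) + l ^+ 2 / (2 * b ^+ 2) * (n%:R * s2)).
Proof.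
move=> l0 l4 t0 Edev.
(* For an empty class the maximum is its default value 0 < t, so the event is empty. *)
have [j0 _|J0] := pickP (fun _ : J => true); last first.
  rewrite (_ : (fun z => _) = fun=> 0); first by rewrite (expect_cst n p_sum) expR_ge0.
  apply/funext => z; rewrite /devsum big_pred0 //.
  by rewrite ltNge (ltW t0).
(* The entropy bound concerns one-sided suprema of centered functions at most 1: both signs of each
   function enter, to recover absolute values, and centering may double the bound b. *)
pose g (js : J * bool) (u : T) : R := (-1) ^+ js.2 * (h js.1 u - pmean js.1) / (2 * b).
have mean_le j : `|pmean j| <= b.
  apply: le_trans (ler_norm_sum _ _ _) _.
  rewrite -[leRHS]mul1r -p_sum mulr_suml; apply: ler_sum => u _.
  by rewrite normrM ger0_norm // ler_wpM2l.
have b2 : 0 < 2 * b by rewrite mulr_gt0.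
have g_le1 js u : g js u <= 1.
  rewrite /g ler_pdivrMr // mul1r; apply: le_trans (ler_norm _) _.
  rewrite normrM normrX normrN1 expr1n mul1r; apply: le_trans (ler_normB _ _) _.
  by have := h_le js.1 u; have := mean_le js.1; lra.
have g_mean js : \sum_u p u * g js u = 0.
  rewrite (eq_bigr (fun u => (-1) ^+ js.2 / (2 * b) * (p u * h js.1 u) -
      (-1) ^+ js.2 / (2 * b) * pmean js.1 * p u)).
    by rewrite sumrB -!mulr_sumr p_sum mulr1 subrr.
  by move=> u _; rewrite /g; ring.
have g_var js : \sum_u p u * g js u ^+ 2 <= s2 / (4 * b ^+ 2).
  rewrite (eq_bigr (fun u => (4 * b ^+ 2)^-1 * (p u * h js.1 u ^+ 2) -
      (4 * b ^+ 2)^-1 * (2 * pmean js.1) * (p u * h js.1 u) +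
      (4 * b ^+ 2)^-1 * pmean js.1 ^+ 2 * p u)).
    rewrite big_split /= sumrB -!mulr_sumr p_sum -/(pmean js.1).
    have := h_var js.1; set A := \sum_u _ => hA.
    have i0 : 0 <= (4 * b ^+ 2)^-1 by rewrite invr_ge0 mulr_ge0 ?sqr_ge0.
    have := ler_wpM2l i0 hA; have := mulr_ge0 i0 (sqr_ge0 (pmean js.1)).
    set q := pmean js.1; set c := (_)^-1 in i0 *; lra.
  move=> u _; rewrite /g !exprMn sqrr_sign mul1r exprVn exprMn; field.
  by rewrite gt_eqF.
pose X := supsum (n := n) (j0, true) g.
have psE js z : psum g js z =
    (-1) ^+ js.2 * (\sum_(i < n) (h js.1 (z i) - pmean js.1)) / (2 * b).
  by rewrite mulr_sumr mulr_suml.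
have XE z : X z = devsum z / (2 * b).
  apply/eqP; rewrite eq_le; apply/andP; split.
    rewrite /X /supsum psE ler_wpM2r ?invr_ge0 ?(ltW b2) //.
    set js := jmax _ _.
    apply: le_trans (le_bigmax _ _ js.1); apply: le_trans (ler_norm _) _.
    by rewrite normrM normrX normrN1 expr1n mul1r.
  rewrite ler_pdivrMr //; apply: bigmax_le => [|j _].
    rewrite mulr_ge0 ?(ltW b2) //.
    have := le_jmax (j0, true) (psum g ^~ z) (j0, true).
    have := le_jmax (j0, true) (psum g ^~ z) (j0, false).
    rewrite [leLHS]psE [X in _ -> X <= _ -> _]psE /= expr0 expr1 mul1r mulN1r mulNr.
    rewrite /X /supsum; set a := _ / _ => a1 a2.
    have [a0|a0] := leP 0 a; first exact: le_trans a0 a1.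
    by apply: le_trans a2; rewrite oppr_ge0 ltW.
  rewrite -ler_pdivrMr //; set a := \sum_(i < n) _.
  have [a0|a0] := leP 0 a.
    have : psum g (j, false) z <= X z := le_jmax (j0, true) (psum g ^~ z) _.
    by rewrite psE /= expr0 mul1r (ger0_norm a0).
  have : psum g (j, true) z <= X z := le_jmax (j0, true) (psum g ^~ z) _.
  by rewrite psE /= expr1 mulN1r (ltr0_norm a0).
have dev0 z : 0 <= devsum z by exact: bigmax_ge_id.
have EX0 : 0 <= expect p X.
  by apply: expect_ge0 => // z; rewrite XE divr_ge0 // ltW.
have s20 : 0 <= s2.
  by apply: le_trans (h_var j0); apply: sumr_ge0 => u _; rewrite mulr_ge0 ?sqr_ge0.
have H : expect p (fun z => expR (l * X z)) <=
    expR (2 * l * (expect p X + n%:R * (s2 / (4 * b ^+ 2)) * l)).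
  apply: (herbst (weight_ge0 p_ge0) (weight_sum n p_sum)) => //.
    apply: mulr_ge0 => //; apply: divr_ge0 => //; apply: mulr_ge0 => //.
    exact: sqr_ge0.
  by move=> l' l'01; exact: entropy_supsum.
(* Chernoff's bound for X at the rescaled threshold t / (2 b). *)
apply: (@le_trans _ _ (expect p (fun z => expR (- (l * (t / (2 * b)))) * expR (l * X z)))).
  apply: le_expect => // z; rewrite -expRD; case: ltP => tz; last exact: expR_ge0.
  rewrite -[leLHS]expR0 ler_expR addrC subr_ge0 ler_pM2l // XE.
  by rewrite ler_pM2r ?invr_gt0 // ltW.
rewrite expectZ; apply: (le_trans (ler_wpM2l (expR_ge0 _) H)).
rewrite -expRD ler_expR.
have EXr : expect p X <= rho / (2 * b).
  rewrite (eq_expect p (Y' := fun z => (2 * b)^-1 * devsum z)).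
    by rewrite expectZ mulrC ler_pM2r ?invr_gt0.
  by move=> z; rewrite XE mulrC.
have l20 : 0 <= 2 * l by rewrite mulr_ge0 // ltW.
have K := ler_wpM2l l20 EXr.
apply: (@le_trans _ _ (- (l * (t / (2 * b))) + (2 * l * (rho / (2 * b)) +
   2 * l * (n%:R * (s2 / (4 * b ^+ 2)) * l)))).
  by rewrite lerD2l mulrDr lerD2r.
by rewrite le_eqVlt; apply/orP; left; apply/eqP; field; rewrite gt_eqF.
Qed.

End finite_deviation.

(** * Contraction of Rademacher averages *)

Section contraction.
Context {R : realType} (n : nat) (J : finType) (j0 : J).
Local Notation signs := {ffun 'I_n -> bool}.
Implicit Types v : 'I_n -> J -> R.

Definition signed_sum v (e : signs) (j : J) : R :=
  \sum_(i < n) (-1) ^+ e i * v i j.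

Definition sup_signed v (e : signs) : R :=
  signed_sum v e (jmax j0 (signed_sum v e)).

Let le_sup v e j : signed_sum v e j <= sup_signed v e.
Proof. exact: (le_jmax j0 (signed_sum v e)). Qed.

(** Sign vectors are paired with those differing at k only. For maximizers j and j' of the two
    suprema, the k-th terms combine to a difference of [v k], at most the absolute difference of
    [v' k]; exchanging j and j' realizes either sign of the latter. *)
Lemma contraction_step (k : 'I_n) v v' :
  (forall i, i != k -> v i =1 v' i) ->
  (forall j j', `|v k j - v k j'| <= `|v' k j - v' k j'|) ->
  \sum_e sup_signed v e <= \sum_e sup_signed v' e.
Proof.
move=> vE vk; pose flip (e : signs) : signs := upd e k (~~ e k).
have flipK : involutive flip.
  by move=> e; rewrite /flip upd_upd upd_eq negbK updK.
have half w : \sum_e sup_signed w e =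
    2^-1 * \sum_e (sup_signed w e + sup_signed w (flip e)).
  rewrite big_split /= [X in _ + X](_ : _ = \sum_e sup_signed w e); last first.
    by rewrite [RHS](reindex_inj (inv_inj flipK)).
  by set s := \sum_e _; lra.
rewrite !half ler_wpM2l ?invr_ge0 //; apply: ler_sum => e _.
pose r (w : 'I_n -> J -> R) (e : signs) (j : J) : R :=
  \sum_(i < n | i != k) (-1) ^+ e i * w i j.
have sE (w : 'I_n -> J -> R) (e' : signs) j : signed_sum w e' j = (-1) ^+ e' k * w k j + r w e' j.
  by rewrite /signed_sum (bigD1 k).
have rflip (w : 'I_n -> J -> R) j : r w (flip e) j = r w e j.
  by apply: eq_bigr => i ik; rewrite upd_neq.
have rv j : r v e j = r v' e j.
  by apply: eq_bigr => i ik; rewrite vE.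
suff gen j j' : signed_sum v e j + signed_sum v (flip e) j' <=
    sup_signed v' e + sup_signed v' (flip e) by exact: gen.
have := le_sup v' e j; have := le_sup v' e j'.
have := le_sup v' (flip e) j; have := le_sup v' (flip e) j'.
set a := sup_signed _ _; set b := sup_signed _ _.
rewrite !sE !rflip !rv /flip upd_eq.
have := vk j j'; rewrite ler_norml => /andP[].
have := ler_norm (v' k j - v' k j'); have := ler_norm (- (v' k j - v' k j')).
rewrite normrN; case: (e k); rewrite /= ?expr0 ?expr1;
  case: (ler0P (v' k j - v' k j')) => _; lra.
Qed.

(** The coordinates of v are replaced by those of v' one at a time. *)
Lemma contraction_sup v v' :
  (forall i j j', `|v i j - v i j'| <= `|v' i j - v' i j'|) ->
  \sum_e sup_signed v e <= \sum_e sup_signed v' e.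
Proof.
move=> vv'; pose w (k : nat) (i : 'I_n) := if (i < k)%N then v' i else v i.
have -> : v = w 0 by apply/funext => i.
have -> : v' = w n by apply/funext => i; rewrite /w ltn_ord.
suff H k : (k <= n)%N -> \sum_e sup_signed (w 0) e <= \sum_e sup_signed (w k) e.
  exact: H.
elim: k => // k IH kn; apply: le_trans (IH (ltnW kn)) _.
apply: (contraction_step (k := Ordinal kn)) => [i ik j|j j'].
  by rewrite /w ltnS [in RHS]leq_eqVlt (_ : (i == k :> nat) = false) //; exact: negbTE.
by rewrite /w /= ltnn ltnSn.
Qed.

(** The factor 2 is the price of absolute values: with a zero element among the indices both
    one-sided suprema are nonnegative, their sum dominates the two-sided one, and negating all signs
    exchanges them. *)
Lemma contraction_abs v u (L : R) : 0 <= L ->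
  (forall i, v i j0 = 0) -> (forall i, u i j0 = 0) ->
  (forall i j j', `|v i j - v i j'| <= L * `|u i j - u i j'|) ->
  \sum_(e : signs) \big[Num.max/0]_j `|signed_sum v e j| <=
  2 * L * \sum_(e : signs) \big[Num.max/0]_j `|signed_sum u e j|.
Proof.
move=> L0 v0 u0 vu; pose neg (e : signs) : signs := [ffun i => ~~ e i].
have negK : involutive neg by move=> e; apply/ffunP => i; rewrite !ffunE negbK.
have sneg e j : signed_sum v (neg e) j = - signed_sum v e j.
  rewrite -sumrN; apply: eq_bigr => i _; rewrite ffunE.
  by case: (e i); rewrite /= ?expr0 ?expr1; ring.
have s0 e : 0 <= sup_signed v e.
  apply: le_trans (le_sup v e j0); rewrite /signed_sum big1 // => i _.
  by rewrite v0 mulr0.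
apply: (@le_trans _ _ (\sum_e (sup_signed v e + sup_signed v (neg e)))).
  apply: ler_sum => e _; apply: bigmax_le => [|j _]; first by rewrite addr_ge0.
  rewrite ler_norml; apply/andP; split.
    by rewrite lerNl -sneg; apply: le_trans (le_sup _ _ _) _; rewrite lerDr.
  by apply: le_trans (le_sup _ _ _) _; rewrite lerDl.
rewrite big_split /= [X in _ + X](_ : _ = \sum_e sup_signed v e); last first.
  by rewrite [RHS](reindex_inj (inv_inj negK)).
rewrite [leLHS](_ : _ = 2 * \sum_e sup_signed v e); last by ring.
rewrite -mulrA ler_wpM2l //.
apply: (@le_trans _ _ (\sum_e sup_signed (fun i j => L * u i j) e)).
  apply: contraction_sup => i j j'.
  by rewrite -mulrBr normrM (ger0_norm L0).
rewrite mulr_sumr; apply: ler_sum => e _; rewrite /sup_signed; set j := jmax _ _.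
rewrite (_ : signed_sum _ _ _ = L * signed_sum u e j).
  rewrite ler_wpM2l //; apply: le_trans (ler_norm _) _.
  exact: (le_bigmax 0 (fun j => `|signed_sum u e j|) j).
by rewrite mulr_sumr; apply: eq_bigr => i _; ring.
Qed.

End contraction.

(** * Uniform deviations of a class on a sample *)

(** Closed under the operations below and integrable for every probability measure, so this one
    predicate settles the integrability side conditions. *)
Definition bmeas {R : realType} d (T : measurableType d) (f : T -> R) : Prop :=
  measurable_fun setT f /\ exists B : R, forall x, `|f x| <= B.

Section bounded_measurable.
Context {R : realType} d (T : measurableType d).
Implicit Types f g : T -> R.

Lemma bmeas_bound (B : R) f : measurable_fun setT f ->
  (forall x, `|f x| <= B) -> bmeas f.
Proof. by move=> mf fB; split=> //; exists B. Qed.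

Lemma bmeas_cst (c : R) : bmeas (fun _ : T => c).
Proof. by split; [exact: measurable_cst|exists `|c|]. Qed.

Lemma bmeasD f g : bmeas f -> bmeas g -> bmeas (fun x => f x + g x).
Proof.
move=> [mf [B fB]] [mg [C gC]]; split; first exact: measurable_funD.
by exists (B + C) => x; apply: le_trans (ler_normD _ _) _; rewrite lerD.
Qed.

Lemma bmeasM f g : bmeas f -> bmeas g -> bmeas (fun x => f x * g x).
Proof.
move=> [mf [B fB]] [mg [C gC]]; split; first exact: measurable_funM.
by exists (B * C) => x; rewrite normrM ler_pM.
Qed.

Lemma bmeasZ c f : bmeas f -> bmeas (fun x => c * f x).
Proof. by apply: bmeasM; exact: bmeas_cst. Qed.

Lemma bmeasN f : bmeas f -> bmeas (fun x => - f x).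
Proof.
by move=> bf; under eq_fun do rewrite -mulN1r; exact: bmeasZ.
Qed.

Lemma bmeasB f g : bmeas f -> bmeas g -> bmeas (fun x => f x - g x).
Proof. by move=> bf bg; apply: bmeasD => //; exact: bmeasN. Qed.

Lemma bmeasX f k : bmeas f -> bmeas (fun x => f x ^+ k).
Proof.
move=> bf; elim: k => [|k IH]; first exact: bmeas_cst.
by under eq_fun do rewrite exprS; exact: bmeasM.
Qed.

Lemma bmeas_norm f : bmeas f -> bmeas (fun x => `|f x|).
Proof.
move=> [mf [B fB]]; split; first exact: measurableT_comp.
by exists B => x; rewrite normr_id.
Qed.

Lemma bmeas_sum (I : Type) (s : seq I) (P : pred I) (F : I -> T -> R) :
  (forall i, bmeas (F i)) -> bmeas (fun x => \sum_(i <- s | P i) F i x).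
Proof.
move=> bF; elim: s => [|i s IH].
  by under eq_fun do rewrite big_nil; exact: bmeas_cst.
under eq_fun do rewrite big_cons.
by case: (P i) => //; exact: bmeasD.
Qed.

Lemma bmeas_bigmax (I : Type) (s : seq I) (F : I -> T -> R) :
  (forall i, bmeas (F i)) -> bmeas (fun x => \big[Num.max/0]_(i <- s) F i x).
Proof.
move=> bF; elim: s => [|i s IH].
  by under eq_fun do rewrite big_nil; exact: bmeas_cst.
under eq_fun do rewrite big_cons.
have [mf [B fB]] := bF i; case: IH => [mg [C gC]]; split.
  exact: (measurable_maxr mf mg).
exists (Num.max B C) => x; case: (leP (F i x)) => _; rewrite le_max.
  by rewrite gC orbT.
by rewrite fB.
Qed.

Lemma bmeas_indic A : measurable A -> bmeas (\1_A : T -> R).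
Proof.
move=> mA; split; first exact: measurable_indic.
by exists 1 => x; rewrite indicE; case: (_ \in _); rewrite ?normr1 ?normr0.
Qed.

Lemma bmeas_comp d' (T' : measurableType d') (f : T -> R) (phi : T' -> T) :
  measurable_fun setT phi -> bmeas f -> bmeas (fun x => f (phi x)).
Proof.
move=> mphi [mf [B fB]]; split; first exact: measurableT_comp.
by exists B.
Qed.

Variable m : {measure set T -> \bar R}.
Hypothesis m1 : m setT = 1%E.

Lemma bmeas_integrable f : bmeas f -> m.-integrable setT (EFin \o f).
Proof.
move=> [mf [B fB]]; apply: measurable_bounded_integrable => //.
  by rewrite m1 ltry.
by exists B; split; [exact: num_real|move=> M BM x _; exact: le_trans (ltW BM)].
Qed.

Lemma RintD f g : bmeas f -> bmeas g ->
  \int[m]_x (f x + g x) = \int[m]_x f x + \int[m]_x g x.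
Proof. by move=> bf bg; apply: RintegralD => //; exact: bmeas_integrable. Qed.

Lemma RintB f g : bmeas f -> bmeas g ->
  \int[m]_x (f x - g x) = \int[m]_x f x - \int[m]_x g x.
Proof. by move=> bf bg; apply: RintegralB => //; exact: bmeas_integrable. Qed.

Lemma RintZ c f : bmeas f -> \int[m]_x (c * f x) = c * \int[m]_x f x.
Proof. by move=> bf; apply: RintegralZl => //; exact: bmeas_integrable. Qed.

Lemma Rint_cst c : \int[m]_x c = c.
Proof. by rewrite Rintegral_cst // m1 mulr1. Qed.

Lemma le_Rint f g : bmeas f -> bmeas g -> (forall x, f x <= g x) ->
  \int[m]_x f x <= \int[m]_x g x.
Proof.
by move=> bf bg fg; apply: le_Rintegral => //; exact: bmeas_integrable.
Qed.

Lemma le_norm_Rint f (B : R) : measurable_fun setT f ->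
  (forall x, `|f x| <= B) -> `|\int[m]_x f x| <= B.
Proof.
move=> mf fB; have bf : bmeas f by exact: bmeas_bound fB.
apply: le_trans (le_normr_Rintegral _ (bmeas_integrable bf)) _ => //.
rewrite -[leRHS]Rint_cst; apply: le_Rint fB; first exact: bmeas_norm.
exact: bmeas_cst.
Qed.

Lemma Rint_sum (I : Type) (s : seq I) (P : pred I) (F : I -> T -> R) :
  (forall i, bmeas (F i)) ->
  \int[m]_x (\sum_(i <- s | P i) F i x) = \sum_(i <- s | P i) \int[m]_x F i x.
Proof.
move=> bF; elim: s => [|i s IH].
  under eq_Rintegral do rewrite big_nil.
  by rewrite Rint_cst big_nil.
under eq_Rintegral do rewrite big_cons.
rewrite big_cons; case: (P i) => //.
by rewrite RintD ?IH //; exact: bmeas_sum.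
Qed.

Lemma Rint_indic A : measurable A -> \int[m]_x \1_A x = fine (m A).
Proof. by move=> mA; rewrite /Rintegral integral_indic // setIT. Qed.

Lemma EFin_Rint f : bmeas f -> (\int[m]_x f x)%:E = (\int[m]_x (f x)%:E)%E.
Proof.
move=> bf; rewrite fineK //; apply: integrable_fin_num => //.
exact: bmeas_integrable.
Qed.

Lemma ae_eq_Rint f g G : measurable_fun setT f -> measurable_fun setT g ->
  measurable G -> m (~` G) = 0%E -> {in G, f =1 g} ->
  \int[m]_x f x = \int[m]_x g x.
Proof.
move=> mf mg mG mG0 fg; congr fine; apply: ae_eq_integral => //.
- exact/measurable_EFinP.
- exact/measurable_EFinP.
exists (~` G); split => //; first exact: measurableC.
by move=> x /= nfg Gx; apply: nfg => _; rewrite fg // inE.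
Qed.

(** Measurability of psi is expressed through its fibers, as the finite type C carries no
    sigma-algebra. *)
Lemma Rint_finite (C : finType) (psi : T -> C) (f : C -> R) :
  (forall c, measurable (psi @^-1` [set c])) ->
  bmeas (fun x => f (psi x)) /\
  \int[m]_x f (psi x) = \sum_c fine (m (psi @^-1` [set c])) * f c.
Proof.
move=> mpsi.
have fE x : f (psi x) = \sum_c f c * \1_(psi @^-1` [set c]) x.
  rewrite (bigD1 (psi x)) //= indicE mem_set // mulr1 big1 ?addr0 // => c cx.
  by rewrite indicE memNset ?mulr0 //= => /esym/eqP; rewrite (negbTE cx).
have bF c : bmeas (fun x => f c * \1_(psi @^-1` [set c]) x).
  by apply: bmeasZ; exact: bmeas_indic.
split; first by under eq_fun do rewrite fE; exact: bmeas_sum.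
under eq_Rintegral do rewrite fE.
rewrite Rint_sum //; apply: eq_bigr => c _.
by rewrite RintZ ?Rint_indic 1?mulrC //; exact: bmeas_indic.
Qed.

End bounded_measurable.

(** * Reduction to finite sample spaces *)

Section rounding.
Context {R : realType}.

(** Rounding down by counting grid points: c depends on x through finitely many comparisons only,
    which makes the cells of [rounding] measurable. The second alternative is that the grid of m
    points is exhausted. *)
Lemma count_grid (del x : R) (m : nat) : 0 <= del -> 0 <= x ->
  let c := \sum_(k < m) (del * k.+1%:R <= x)%R%:R in
  del * c <= x /\ (x <= del * c + del \/ c = m%:R).
Proof.
move=> del0 x0; elim: m => [|m]; rewrite /=.
  by rewrite big_ord0 mulr0; split => //; right.
rewrite big_ord_recr /=; set c0 := \sum_(k < m) _.
move=> [c0x IH].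
have c0m : c0 <= m%:R.
  have -> : m%:R = \sum_(k < m) 1 :> R by rewrite sumr_const card_ord.
  by apply: ler_sum => k _; rewrite (ler_nat _ _ 1) leq_b1.
have [mx|xm] := leP (del * m.+1%:R) x; last first.
  rewrite addr0; split => //; left; case: IH => // c0E.
  by apply: le_trans (ltW xm) _; rewrite c0E -natr1 mulrDr mulr1.
have c0m1 : c0 = m%:R.
  rewrite /c0 (eq_bigr (fun=> 1)); first by rewrite sumr_const card_ord.
  move=> k _; rewrite (le_trans _ mx) // ler_wpM2l // ler_nat ltnS.
  exact: ltnW.
by rewrite c0m1 natr1; split => //; right.
Qed.

End rounding.

Lemma bigmax_leD {R : realType} (J : finType) (f g : J -> R) (eps : R) :
  0 <= eps -> (forall j, f j <= g j + eps) ->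
  \big[Num.max/0]_j f j <= \big[Num.max/0]_j g j + eps.
Proof.
move=> e0 fg; apply: bigmax_le => [|j _].
  by rewrite addr_ge0 // bigmax_ge_id.
by apply: le_trans (fg j) _; rewrite lerD2r le_bigmax.
Qed.

Section iid_cells.
Context {R : realType} d dO (T : measurableType d) (Omega : measurableType dO).
Variables (Q : probability T R) (P : probability Omega R) (n : nat).
Variable (Z : 'I_n -> {RV P >-> T}).
Hypothesis iid : iid_sample Q Z.
Variables (C : finType) (phi : T -> C).
Hypothesis mphi : forall c, measurable (phi @^-1` [set c]).

Definition cell_law (c : C) : R := fine (Q (phi @^-1` [set c])).
Definition cells (w : Omega) : {ffun 'I_n -> C} := [ffun i => phi (Z i w)].

Lemma cell_law_ge0 c : 0 <= cell_law c.
Proof. exact: fine_ge0. Qed.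

Lemma Rint_cell_law (f : C -> R) :
  \int[Q]_z f (phi z) = \sum_c cell_law c * f c.
Proof. exact: (Rint_finite (probability_setT Q) f mphi).2. Qed.

Lemma cell_law_sum : \sum_c cell_law c = 1.
Proof.
rewrite -[RHS](Rint_cst (probability_setT Q) 1) (Rint_cell_law (fun=> 1)).
by apply: eq_bigr => c _; rewrite mulr1.
Qed.

Let cellsE tau : cells @^-1` [set tau] =
  \bigcap_(i in [set: 'I_n]) (Z i @^-1` (phi @^-1` [set tau i])).
Proof.
apply/seteqP; split=> [w /= <- i _ /=|w /= H]; first by rewrite ffunE.
by apply/ffunP => i; rewrite ffunE H.
Qed.

Lemma measurable_cells tau : measurable (cells @^-1` [set tau]).
Proof.
rewrite cellsE; apply: fin_bigcap_measurable => // i _.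
rewrite -[X in measurable X]setTI.
exact: (measurable_funPT (Z i)).
Qed.

(** Independence turns the law of the vector of cells into a product weight, so integrals over Omega
    become expectations in the finite model. *)
Lemma Rint_cells (Y : {ffun 'I_n -> C} -> R) :
  bmeas (fun w => Y (cells w)) /\
  \int[P]_w Y (cells w) = expect cell_law Y.
Proof.
have [bY ->] := Rint_finite (probability_setT P) Y measurable_cells; split=> //.
apply: eq_bigr => tau _; congr (_ * _); rewrite cellsE; case: iid => Zd Zprod.
transitivity (fine (\prod_(i < n) P (Z i @^-1` (phi @^-1` [set tau i])))%E).
  congr fine; exact: (Zprod (fun i => phi @^-1` [set tau i])).
have -> : (\prod_(i < n) P (Z i @^-1` (phi @^-1` [set tau i])) =
    \prod_(i < n) (cell_law (tau i))%:E)%E.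
  apply: eq_bigr => i _; rewrite /cell_law fineK ?fin_num_measure //.
  exact: Zd.
by rewrite prodEFin.
Qed.

End iid_cells.

(* A finite class sees only finitely many cells, up to an arbitrarily small error;
   this reduces the concentration inequality to finite probability spaces. *)
Lemma rounding {R : realType} d (T : measurableType d) (J : finType)
    (H : J -> T -> R) (b del : R) :
  0 < b -> 0 < del -> (forall j, measurable_fun setT (H j)) ->
  (forall j z, `|H j z| <= b) ->
  exists (C : finType) (phi : T -> C) (hq : J -> C -> R),
    [/\ forall c, measurable (phi @^-1` [set c]),
        forall j c, `|hq j c| <= b &
        forall j z, `|H j z - hq j (phi z)| <= del].
Proof.
move=> b0 del0 mH Hb.
pose m := (Num.truncn (2 * b / del)).+1.
have mgt : 2 * b / del < m%:R by exact: truncnS_gt.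
pose eta := 2 * b / m%:R.
have m0 : 0 < m%:R :> R by rewrite ltr0n.
have eta0 : 0 <= eta by rewrite divr_ge0 ?mulr_ge0 ?(ltW b0) ?(ltW m0).
have eta_del : eta <= del.
  by rewrite /eta ler_pdivrMr // [leRHS]mulrC -ler_pdivrMr // ltW.
pose phi z : {ffun J * 'I_m -> bool} :=
  [ffun x : J * 'I_m => eta * x.2.+1%:R <= H x.1 z + b].
pose hq j (c : {ffun J * 'I_m -> bool}) : R := - b + eta * \sum_(k < m) (c (j, k))%:R.
have etam : eta * m%:R = 2 * b by rewrite /eta divfK // gt_eqF.
exists {ffun J * 'I_m -> bool}, phi, hq; split.
- move=> c; rewrite [X in measurable X](_ : _ = \bigcap_(x in [set: J * 'I_m])
    ((fun z => eta * (x.2 : 'I_m).+1%:R <= H x.1 z + b) @^-1` [set c x])); last first.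
    apply/seteqP; split=> [z /= <- x _ /=|z /= Hz]; first by rewrite ffunE.
    by apply/ffunP => x; rewrite ffunE; exact: (Hz x Logic.I).
  apply: fin_bigcap_measurable => // x _; rewrite -[X in measurable X]setTI.
  have mf : measurable_fun setT (fun z => eta * x.2.+1%:R <= H x.1 z + b).
    apply: measurable_fun_ler; first exact: measurable_cst.
    by apply: measurable_funD => //; exact: measurable_cst.
  exact: mf.
- move=> j c; rewrite /hq; set s := \sum_(k < m) _.
  have s0 : 0 <= s by apply: sumr_ge0.
  have sm : s <= m%:R.
    have -> : m%:R = \sum_(k < m) 1 :> R by rewrite sumr_const card_ord.
    by apply: ler_sum => k _; rewrite (ler_nat _ _ 1) leq_b1.
  have := ler_wpM2l eta0 sm; rewrite etam => h1.
  have h2 := mulr_ge0 eta0 s0.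
  by rewrite ler_norml; apply/andP; split; lra.
- move=> j z; have Hbz := Hb j z.
  have x0 : 0 <= H j z + b by move: Hbz; rewrite ler_norml => /andP[? ?]; lra.
  have xb : H j z + b <= 2 * b by move: Hbz; rewrite ler_norml => /andP[? ?]; lra.
  have [/= c1 c2] := count_grid m eta0 x0.
  rewrite /hq (eq_bigr (fun k : 'I_m => (eta * k.+1%:R <= H j z + b)%R%:R)); last first.
    by move=> k _; rewrite ffunE.
  move: c1 c2; set c := \sum_(k < m) _ => c1 c2.
  rewrite ler_norml; apply/andP; split; first by lra.
  (* If the grid is exhausted, H + b still does not exceed its last point eta * m = 2 * b. *)
  case: c2 => [c2|cE]; first by lra.
  by move: xb; rewrite -etam -cE => xb; lra.
Qed.

Section finite_class.
Context {R : realType} d dO (T : measurableType d) (Omega : measurableType dO).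
Variables (Q : probability T R) (P : probability Omega R) (n : nat).
Variable (Z : 'I_n -> {RV P >-> T}).
Hypothesis iid : iid_sample Q Z.
Variables (J : finType) (H : J -> T -> R) (b s2 : R).
Hypothesis b_gt0 : 0 < b.
Hypothesis mH : forall j, measurable_fun setT (H j).
Hypothesis Hb : forall j z, `|H j z| <= b.
Hypothesis H_var : forall j, \int[Q]_z (H j z) ^+ 2 <= s2.

Definition devn (w : Omega) : R :=
  \big[Num.max/0]_(j : J) `|\sum_(i < n) (H j (Z i w) - \int[Q]_z H j z)|.

Definition radn (e : {ffun 'I_n -> bool}) (w : Omega) : R :=
  \big[Num.max/0]_(j : J) `|\sum_(i < n) (-1) ^+ e i * H j (Z i w)|.

Let bH j : bmeas (H j). Proof. exact: bmeas_bound (Hb j). Qed.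

Let bHZ j i : bmeas (fun w => H j (Z i w)).
Proof. by apply: bmeas_comp => //; exact: measurable_funPT. Qed.

Lemma bmeas_devn : bmeas devn.
Proof.
apply: bmeas_bigmax => j; apply: bmeas_norm; apply: bmeas_sum => i.
by apply: bmeasB => //; exact: bmeas_cst.
Qed.

Lemma bmeas_radn e : bmeas (radn e).
Proof.
apply: bmeas_bigmax => j; apply: bmeas_norm; apply: bmeas_sum => i.
exact: bmeasZ.
Qed.

Let Q1 := probability_setT Q.
Let P1 := probability_setT P.

(** A finite model with error del per function value: second moments move by at most 2 b del, signed
    sums by n del, and centered sums by twice that because the means move as well. *)
Let rounded (del : R) : 0 < del ->
  exists (C : finType) (p : C -> R) (hq : J -> C -> R)
      (xi : Omega -> {ffun 'I_n -> C}),
  [/\ (forall c, 0 <= p c) /\ \sum_c p c = 1,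
      forall Y : {ffun 'I_n -> C} -> R, bmeas (fun w => Y (xi w)) /\
        \int[P]_w Y (xi w) = expect p Y,
      (forall j c, `|hq j c| <= b) /\
        (forall j, \sum_c p c * hq j c ^+ 2 <= s2 + 2 * b * del),
      forall e w, `|radn e w - radsum hq e (xi w)| <= n%:R * del &
      forall w, `|devn w - devsum p hq (xi w)| <= n%:R * (2 * del)].
Proof.
move=> del0; have [C [phi [hq [mphi hqb Hhq]]]] := rounding b_gt0 del0 mH Hb.
exists C, (cell_law Q phi), hq, (cells Z phi).
have bphi (f : C -> R) : bmeas (fun z => f (phi z)).
  by have [] := Rint_finite Q1 f mphi.
split.
- by split; [exact: cell_law_ge0|exact: cell_law_sum].
- by move=> Y; exact: Rint_cells.
- split => // j; rewrite -(Rint_cell_law _ mphi (fun c => hq j c ^+ 2)).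
  apply: (@le_trans _ _ (\int[Q]_z (H j z ^+ 2 + 2 * b * del))).
    apply: le_Rint => //; first exact: (bphi (fun c => hq j c ^+ 2)).
      by apply: bmeasD; [exact: bmeasX|exact: bmeas_cst].
    move=> z; have := Hhq j z; have := Hb j z; have := hqb j (phi z).
    rewrite !ler_norml => /andP[? ?] /andP[? ?] /andP[? ?]; nra.
  rewrite RintD ?(Rint_cst Q1) //; last exact: bmeas_cst.
    by rewrite lerD2r.
  exact: bmeasX.
- move=> e w.
  have close j : `|\sum_(i < n) (-1) ^+ e i * H j (Z i w) -
      \sum_(i < n) (-1) ^+ e i * hq j (cells Z phi w i)| <= n%:R * del.
    rewrite -sumrB; apply: le_trans (ler_norm_sum _ _ _) _.
    rewrite -[X in X%:R * _](card_ord n) mulr_natl -sumr_const.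
    apply: ler_sum => i _; rewrite -mulrBr normrM normrX normrN1 expr1n mul1r.
    by rewrite ffunE.
  have nd0 : 0 <= n%:R * del by rewrite mulr_ge0 // ltW.
  rewrite ler_norml; apply/andP; split.
    rewrite lerNl opprB lerBlDr addrC; apply: bigmax_leD => // j.
    have := close j; rewrite distrC => cj.
    by rewrite -lerBlDl; apply: le_trans (lerB_dist _ _) cj.
  rewrite lerBlDr addrC; apply: bigmax_leD => // j.
  by rewrite -lerBlDl; apply: le_trans (lerB_dist _ _) (close j).
- move=> w.
  have mean_close j : `|\int[Q]_z H j z - pmean (cell_law Q phi) hq j| <= del.
    rewrite /pmean -(Rint_cell_law _ mphi (hq j)) -(RintB Q1 (bH j) (bphi (hq j))).
    by apply: le_norm_Rint => //; exact: (bmeasB (bH j) (bphi (hq j))).1.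
  have close j : `|\sum_(i < n) (H j (Z i w) - \int[Q]_z H j z) -
      \sum_(i < n) (hq j (cells Z phi w i) - pmean (cell_law Q phi) hq j)|
      <= n%:R * (2 * del).
    rewrite -sumrB; apply: le_trans (ler_norm_sum _ _ _) _.
    rewrite -[X in X%:R * _](card_ord n) mulr_natl -sumr_const.
    apply: ler_sum => i _; rewrite ffunE.
    have -> (x y u v : R) : x - y - (u - v) = (x - u) - (y - v) by ring.
    apply: le_trans (ler_normB _ _) _.
    by have := Hhq j (Z i w); have := mean_close j; lra.
  have nd0 : 0 <= n%:R * (2 * del) by rewrite !mulr_ge0 // ltW.
  rewrite ler_norml; apply/andP; split.
    rewrite lerNl opprB lerBlDr addrC; apply: bigmax_leD => // j.
    have := close j; rewrite distrC => cj.
    by rewrite -lerBlDl; apply: le_trans (lerB_dist _ _) cj.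
  rewrite lerBlDr addrC; apply: bigmax_leD => // j.
  by rewrite -lerBlDl; apply: le_trans (lerB_dist _ _) (close j).
Qed.

Lemma symmetrization_RV e : \int[P]_w devn w <= 2 * \int[P]_w radn e w.
Proof.
apply/ler_addgt0Pr => eps eps0.
(* The errors 2 n del for the deviation and twice n del for the signed sum add up to 4 n del; [n.+1]
   allows n = 0. *)
pose del := eps / (4 * n.+1%:R).
have n0 : 0 < n.+1%:R :> R by rewrite ltr0n.
have del0 : 0 < del by rewrite divr_gt0 // mulr_gt0.
have [C [p [hq [xi [[p0 p1] xiE [hqb _] radc devc]]]]] := rounded del0.
have [bdev devE] := xiE (devsum p hq).
have [brad radE] := xiE (radsum hq e).
have h1 : \int[P]_w devn w <= expect p (devsum (n := n) p hq) + n%:R * (2 * del).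
  rewrite -devE -[X in _ + X](Rint_cst P1) -RintD //; last exact: bmeas_cst.
  apply: le_Rint => //; first exact: bmeas_devn.
    by apply: bmeasD => //; exact: bmeas_cst.
  by move=> w; have := devc w; rewrite ler_norml => /andP[? ?]; lra.
have h2 : expect p (radsum (n := n) hq e) <= \int[P]_w radn e w + n%:R * del.
  rewrite -radE -[X in _ + X](Rint_cst P1) -RintD //; last 2 first.
  - exact: bmeas_radn.
  - exact: bmeas_cst.
  apply: le_Rint => //.
    by apply: bmeasD; [exact: bmeas_radn|exact: bmeas_cst].
  by move=> w; have := radc e w; rewrite ler_norml => /andP[? ?]; lra.
have h3 := symmetrization p0 p1 hq e.
have h4 : n%:R * (4 * del) <= eps.
  have -> : n%:R * (4 * del) = n%:R / n.+1%:R * eps.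
    by rewrite /del; field; rewrite gt_eqF.
  rewrite ler_piMl ?(ltW eps0) // ler_pdivrMr // mul1r ler_nat.
  exact: leqnSn.
by move: h1 h2 h3 h4; lra.
Qed.

Lemma deviation_tail_RV (rho l t : R) :
  0 < l -> l <= 4^-1 -> 0 < t -> \int[P]_w devn w <= rho ->
  (P [set w | (t < devn w)%R] <=
    (expR (l / b * (rho - t / 2) + l ^+ 2 / (2 * b ^+ 2) * (n%:R * s2)))%:E)%E.
Proof.
move=> l0 l4 t0 Edev.
have mdev : measurable [set w | t < devn w].
  rewrite -[X in measurable X]setTI.
  have mf : measurable_fun setT (fun w => t < devn w).
    apply: measurable_fun_ltr; first exact: measurable_cst.
    by have [] := bmeas_devn.
  exact: (mf measurableT [set true]).
rewrite -[leLHS]fineK ?fin_num_measure // lee_fin.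
set a := l / b * _ + _.
(* For a positive probability one may take logarithms, which makes the rounding error in the
   exponent additive. *)
have [P0|P0] := leP (fine (P [set w | t < devn w])) 0.
  by apply: le_trans P0 _; exact: expR_ge0.
rewrite -[leLHS]lnK ?posrE // ler_expR.
apply/ler_addgt0Pr => eps eps0.
rewrite -ler_expR lnK ?posrE //.
pose N : R := n%:R.
have N0 : 0 <= N by exact: ler0n.
(* K - 1 is the coefficient of del in the exponent, collected from the shifted mean, threshold and
   variance. The second bound on del below keeps the shifted threshold positive. *)
pose K := 3 * N * l / b + N * l ^+ 2 / b + 1.
have K1 : 1 <= K.
  have h1 : 0 <= 3 * N * l / b by rewrite divr_ge0 ?mulr_ge0 // ltW.
  have h2 : 0 <= N * l ^+ 2 / b by rewrite divr_ge0 ?mulr_ge0 ?sqr_ge0 // ltW.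
  by rewrite /K; lra.
have K0 : 0 < K by lra.
pose del := Num.min (eps / K) (t / (4 * (N + 1))).
have N1 : 0 < 4 * (N + 1) by rewrite mulr_gt0 // ltr_wpDl.
have del0 : 0 < del by rewrite lt_min !divr_gt0.
have delK : K * del <= eps.
  by rewrite mulrC -ler_pdivlMr // /del ge_min lexx.
have delt : del * (4 * (N + 1)) <= t.
  by rewrite -ler_pdivlMr // /del ge_min lexx orbT.
have [C [p [hq [xi [[p0 p1] xiE [hqb hqv] radc devc]]]]] := rounded del0.
have [bdev devE] := xiE (devsum p hq).
have Edev' : expect p (devsum (n := n) p hq) <= rho + N * (2 * del).
  apply: le_trans (_ : \int[P]_w devn w + N * (2 * del) <= _); last by rewrite lerD2r.
  rewrite -devE -[X in _ + X](Rint_cst P1) -RintD //; last 2 first.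
  - exact: bmeas_devn.
  - exact: bmeas_cst.
  apply: le_Rint => //.
    by apply: bmeasD; [exact: bmeas_devn|exact: bmeas_cst].
  by move=> w; have := devc w; rewrite ler_norml => /andP[? ?]; rewrite /N; lra.
have t'0 : 0 < t - N * (2 * del) by nra.
have := deviation_tail (n := n) p0 p1 b_gt0 hqb hqv l0 l4 t'0 Edev'.
have [bind <-] := xiE (fun z => (t - N * (2 * del) < devsum p hq z)%R%:R).
rewrite -Rint_indic // => tail.
apply: (@le_trans _ _ (\int[P]_w (t - N * (2 * del) < devsum p hq (xi w))%R%:R)).
  apply: le_Rint => //; first exact: bmeas_indic.
  move=> w; rewrite indicE; have [/= tw|] := boolP (w \in [set w | t < devn w]) => //.
  rewrite (_ : _ < _) // ltrBlDr; move: tw; rewrite inE /= => /lt_le_trans; apply.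
  by have := devc w; rewrite ler_norml => /andP[? ?]; rewrite /N; lra.
apply: (le_trans tail); rewrite ler_expR /a.
have -> : l / b * (rho + N * (2 * del) - (t - N * (2 * del)) / 2) +
    l ^+ 2 / (2 * b ^+ 2) * (n%:R * (s2 + 2 * b * del)) =
    l / b * (rho - t / 2) + l ^+ 2 / (2 * b ^+ 2) * (n%:R * s2) + (K - 1) * del.
  by rewrite /K /N; field; rewrite gt_eqF.
by rewrite lerD2l; apply: le_trans delK; rewrite ler_pM2r //; lra.
Qed.

End finite_class.

(** The integral of a nonnegative function is a supremum over simple minorants, hence monotone
    without any measurability. *)
Lemma ge0_le_integral_nonmeasurable {R : realType} d (T : measurableType d)
    (m : {measure set T -> \bar R}) (f g : T -> \bar R) :
  (forall x, (0 <= f x)%E) -> (forall x, (f x <= g x)%E) ->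
  (\int[m]_x f x <= \int[m]_x g x)%E.
Proof.
move=> f0 fg; have g0 x : (0 <= g x)%E by exact: le_trans (fg x).
rewrite !ge0_integralTE //; apply: ereal_sup_le => _ [h /= hf <-].
by exists h => //= x; exact: le_trans (fg x).
Qed.

Lemma bmeas_gt {R : realType} d (T : measurableType d) (f : T -> R) (t : R) :
  bmeas f -> measurable [set x | t < f x].
Proof.
move=> [mf _]; rewrite -[X in measurable X]setTI.
have mt : measurable_fun setT (fun x => t < f x).
  by apply: measurable_fun_ltr; first exact: measurable_cst.
exact: (mt measurableT [set true]).
Qed.

(** * From finite subclasses to separable classes *)

Section sample.
Context {R : realType} d dO (T : measurableType d) (Omega : measurableType dO).
Variables (Q : probability T R) (P : probability Omega R) (n : nat).
Variable (Z : 'I_n -> {RV P >-> T}).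
Hypothesis iid : iid_sample Q Z.

Lemma sample_in (G : set T) : measurable G -> Q G = 1%E ->
  exists2 GO : set Omega, measurable GO /\ P (~` GO) = 0%E &
    forall w i, GO w -> G (Z i w).
Proof.
move=> mG QG; exists (\bigcap_(i in [set: 'I_n]) (Z i @^-1` G)); last first.
  by move=> w i; exact.
have mGO : measurable (\bigcap_(i in [set: 'I_n]) (Z i @^-1` G)).
  apply: fin_bigcap_measurable => // i _; rewrite -[X in measurable X]setTI.
  exact: (measurable_funPT (Z i)).
split => //; rewrite probability_setC // (_ : P _ = 1%E) ?subee //.
case: iid => Zd Zprod.
transitivity (\prod_(i < n) P (Z i @^-1` G))%E.
  exact: (Zprod (fun=> G)).
by rewrite big1 // => i _; rewrite -QG; exact: Zd.
Qed.

(* The suprema defining [rademacher] need not be measurable, so they are only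
   compared with bounded measurable minorants. *)
Lemma le_rademacher (V : set (T -> R)) (rho : R)
    (Y : {ffun 'I_n -> bool} -> Omega -> R) : (0 < n)%N ->
  (rademacher Z V <= rho%:E)%E ->
  (forall e, bmeas (Y e)) -> (forall e w, 0 <= Y e w) ->
  (forall e w, exists2 h, V h & Y e w <= `|\sum_(i < n) (-1) ^+ e i * h (Z i w)|) ->
  \sum_e \int[P]_w Y e w <= 2 ^+ n * (n%:R * rho).
Proof.
move=> n0 Vrho bY Y0 YV.
have nR0 : 0 < n%:R :> R by rewrite ltr0n.
have key : ((2 ^+ n)^-1%:E * \sum_e (n%:R^-1 * \int[P]_w Y e w)%:E <= rho%:E)%E.
  apply: le_trans Vrho; rewrite /rademacher lee_pmul2l ?lte_fin ?invr_gt0 ?exprn_gt0 //.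
  apply: lee_sum => e _.
  rewrite -(RintZ (probability_setT P)) // (EFin_Rint (probability_setT P)); last first.
    exact: bmeasZ.
  apply: ge0_le_integral_nonmeasurable => w.
    by rewrite lee_fin mulr_ge0 ?invr_ge0 // ltW.
  have [h Vh Yh] := YV e w; apply: le_ereal_sup_tmp.
  exists (`| n%:R^-1 * \sum_(i < n) (-1) ^+ e i * h (Z i w) |)%:E.
    by exists h.
  by rewrite lee_fin normrM gtr0_norm ?invr_gt0 // ler_pM2l ?invr_gt0.
move: key; rewrite sumEFin -EFinM lee_fin -mulr_sumr.
set s := \sum_e _; rewrite [leLHS]mulrC ler_pdivrMr ?exprn_gt0 //.
rewrite [leLHS]mulrC ler_pdivrMr // => h.
by apply: le_trans h _; rewrite le_eqVlt; apply/orP; left; apply/eqP; ring.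
Qed.

(** Separability leaves a countable subclass, and continuity from below leaves its initial segments,
    for which the bound B does not depend on their length. Multiplication by the indicator of G
    bounds the functions everywhere without changing means or, almost surely, sample values. *)
Lemma class_deviation (Hs : set (T -> R)) (G : set T) (b t B : R) :
  separable_process Q Z Hs -> measurable G -> Q G = 1%E ->
  0 <= b -> 0 <= t -> 0 <= B ->
  (forall h, Hs h ->
     measurable_fun setT h /\ forall z, G z -> `|h z| <= b) ->
  (forall k (H : 'I_k.+1 -> T -> R), (forall j, Hs (H j)) ->
     (P [set w | (t < devn Q Z (fun j z => H j z * \1_G z) w)%R] <= B%:E)%E) ->
  exists2 E : set Omega, measurable E /\ ((1 - B)%:E <= P E)%E &
    forall w, E w -> forall h, Hs h ->
      `|\sum_(i < n) (h (Z i w) - \int[Q]_z h z)| <= t.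
Proof.
move=> [H0 [cH0 H0s [A [mA A0 Asub]]]] mG QG b0 t0 B0 mHs fin.
have [GO [mGO GO0] GOin] := sample_in mG QG.
have QG0 : Q (~` G) = 0%E by rewrite probability_setC // QG subee.
have near w : (~` A) w -> forall h, Hs h -> forall e : R, 0 < e ->
      exists2 h0, H0 h0 &
        (forall i, `| h (Z i w) - h0 (Z i w) | < e) /\
        `| \int[Q]_z h z - \int[Q]_z h0 z | < e.
  by move=> Aw; apply: contrapT => nw; exact/Aw/Asub.
suff [U [mU UB UH]] : exists U : set Omega, [/\ measurable U, (P U <= B%:E)%E &
    forall w h0, (~` U) w -> GO w -> H0 h0 ->
      `|\sum_(i < n) (h0 (Z i w) - \int[Q]_z h0 z)| <= t].
  exists (~` (A `|` ~` GO `|` U)).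
    have mAGU : measurable (A `|` ~` GO `|` U).
      by apply: measurableU => //; apply: measurableU => //; exact: measurableC.
    split; first exact: measurableC.
    rewrite probability_setC // EFinB leeB //.
    apply: le_trans (measureU2 _ _ _) _ => //.
      by apply: measurableU => //; exact: measurableC.
    rewrite -[leRHS]add0e leeD // -(adde0 0%E).
    apply: le_trans (measureU2 _ _ _) _ => //; first exact: measurableC.
    by apply: leeD; rewrite le_eqVlt; apply/orP; left; apply/eqP.
  move=> w; rewrite !setCU setCK => -[[Aw Gw] Uw] h Hh.
  apply/ler_addgt0Pr => eps eps0.
  pose e := eps / (2 * n.+1%:R).
  have n1 : 0 < n.+1%:R :> R by rewrite ltr0n.
  have e0 : 0 < e by rewrite divr_gt0 // mulr_gt0.
  have [h0 H0h0 [hi hint]] := near w Aw h Hh e e0.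
  apply: (@le_trans _ _ (`|\sum_(i < n) (h0 (Z i w) - \int[Q]_z h0 z)| +
      n%:R * (2 * e))); last first.
    apply: lerD; first exact: UH.
    have -> : n%:R * (2 * e) = n%:R / n.+1%:R * eps.
      by rewrite /e; field; rewrite gt_eqF.
    rewrite ler_piMl ?(ltW eps0) // ler_pdivrMr // mul1r ler_nat.
    exact: leqnSn.
  rewrite -lerBlDl; apply: le_trans (lerB_dist _ _) _.
  rewrite -sumrB; apply: le_trans (ler_norm_sum _ _ _) _.
  rewrite -[X in X%:R * _](card_ord n) mulr_natl -sumr_const.
  apply: ler_sum => i _.
  have -> (x y u v : R) : x - y - (u - v) = (x - u) - (y - v) by ring.
  apply: le_trans (ler_normB _ _) _.
  by rewrite mulr2n mulrDl mul1r ltW // ltrD.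
have [[h1 H0h1]|nH0] := pselect (exists h, H0 h); last first.
  exists set0; split => //; first by rewrite measure0 lee_fin.
  by move=> w h0 _ _ H0h0; case: nH0; exists h0.
have [f finj] := countable_injP _ cH0.
(* An enumeration of H0 inverting the injection f; the default h1 keeps every [en k] in H0. *)
pose en k := xget h1 [set h | H0 h /\ f h = k].
have H0en k : H0 (en k) by rewrite /en; case: xgetP => [h _ []|].
have enf h : H0 h -> en (f h) = h.
  move=> H0h; rewrite /en; case: xgetP => [h' _ [H0h' fh']|/(_ h)].
    by apply: finj => //; rewrite inE.
  by case; split.
pose H' (k : nat) (z : T) : R := en k z * \1_G z.
have mH' k : measurable_fun setT (H' k).
  apply: measurable_funM; first by have [] := mHs _ (H0s _ (H0en k)).
  exact: measurable_indic.
have H'b k z : `|H' k z| <= b.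
  rewrite /H' indicE; case: (boolP (z \in G)) => [|_].
    by rewrite inE mulr1 => Gz; have [_] := mHs _ (H0s _ (H0en k)); apply.
  by rewrite mulr0 normr0.
pose V k := [set w | t < devn Q Z (fun (j : 'I_k.+1) => H' j) w].
have mV k : measurable (V k).
  by apply: bmeas_gt; apply: bmeas_devn => // j; exact: H'b.
have ndV : nondecreasing_seq V.
  move=> k k' kk'; apply/subsetPset => w; rewrite /V /= => /lt_le_trans; apply.
  apply: bigmax_le => [|j _]; first exact: bigmax_ge_id.
  have jk' : (j < k'.+1)%N by exact: leq_trans (ltn_ord j) _.
  exact: (le_bigmax 0 (fun j : 'I_k'.+1 =>
    `|\sum_(i < n) (H' j (Z i w) - \int[Q]_z H' j z)|) (Ordinal jk')).
have mUV : measurable (\bigcup_k V k) by exact: bigcup_measurable.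
exists (\bigcup_k V k); split => //.
  have cvV := nondecreasing_cvg_mu (mu := P) mV mUV ndV.
  rewrite -(cvg_lim _ cvV) //; apply: lime_le; first by apply/cvg_ex; exists (P (\bigcup_k V k)).
  by apply: nearW => k; apply: fin => j; exact/H0s.
move=> w h0 Uw Gw H0h0.
have Vw : ~ V (f h0) w by move=> Vw; apply: Uw; exists (f h0).
have /negP := Vw; rewrite -leNgt; apply: le_trans.
have := le_bigmax 0 (fun j : 'I_(f h0).+1 =>
    `|\sum_(i < n) (H' j (Z i w) - \int[Q]_z H' j z)|) ord_max.
apply: le_trans; rewrite le_eqVlt; apply/orP; left; apply/eqP.
congr `|_|; apply: eq_bigr => i _; rewrite /= /H' enf //; congr (_ - _).
  by rewrite indicE mem_set ?mulr1 //; exact: GOin.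
apply: (ae_eq_Rint _ _ mG QG0).
- by have [] := mHs _ (H0s _ H0h0).
- by apply: measurable_funM; [have [] := mHs _ (H0s _ H0h0)|exact: measurable_indic].
by move=> z Gz; rewrite indicE Gz mulr1.
Qed.

End sample.

(** * Integrals against kernels *)

Section mixture.
Context {R : realType} d1 d2 d3 (Y : measurableType d1) (Z : measurableType d2)
  (V : measurableType d3).
Variables (k : Y -> {measure set Z -> \bar R}) (e : Y -> Z -> V).
Hypothesis k1 : forall y, k y setT = 1%E.
Hypothesis me : forall y, measurable_fun setT (e y).
Hypothesis mk : forall A, measurable A ->
  measurable_fun setT (fun y => k y (e y @^-1` A)).

Let meA y A : measurable A -> measurable (e y @^-1` A).
Proof. by move=> mA; rewrite -[X in measurable X]setTI; exact: me. Qed.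

Let kA_ge0 y A : 0 <= fine (k y (e y @^-1` A)).
Proof. exact: fine_ge0. Qed.

Let kA_le1 y A : measurable A -> (k y (e y @^-1` A) <= 1)%E.
Proof.
by move=> mA; rewrite -(k1 y) le_measure ?inE //; exact: meA.
Qed.

Let kA_fin y A : measurable A -> k y (e y @^-1` A) \is a fin_num.
Proof.
move=> mA; rewrite ge0_fin_numE //; apply: le_lt_trans (kA_le1 y mA) _.
exact: ltry.
Qed.

Let bmeas_kA A : measurable A -> bmeas (fun y => fine (k y (e y @^-1` A))).
Proof.
move=> mA; apply: (bmeas_bound (B := 1)).
  by apply: measurableT_comp => //; exact: mk.
by move=> y; rewrite ger0_norm // -lee_fin fineK ?kA_le1 ?kA_fin.
Qed.

Let rounded (f : V -> R) (del : R) : bmeas f -> 0 < del ->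
  exists (C : finType) (phi : V -> C) (g : C -> R),
    (forall c, measurable (phi @^-1` [set c])) /\
    forall v, `|f v - g (phi v)| <= del.
Proof.
move=> [mf [B fB]] del0.
have B1 : 0 < `|B| + 1 by rewrite ltr_wpDl.
have fB1 v : `|f v| <= `|B| + 1.
  by apply: le_trans (fB v) _; apply: le_trans (ler_norm B) _; rewrite lerDl.
have [C [phi [g [mphi _ fg]]]] := rounding (J := unit) (H := fun=> f) B1 del0
  (fun=> mf) (fun=> fB1).
by exists C, phi, (g tt); split => // v; exact: fg tt v.
Qed.

Let bfe (f : V -> R) y : bmeas f -> bmeas (fun z => f (e y z)).
Proof. exact: bmeas_comp. Qed.

Let approx (f : V -> R) (del : R) : bmeas f -> 0 < del ->
  exists (C : finType) (phi : V -> C) (g : C -> R),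
    [/\ forall c, measurable (phi @^-1` [set c]),
        forall v, `|f v - g (phi v)| <= del &
        forall y, `|\int[k y]_z f (e y z) -
          \sum_c g c * fine (k y (e y @^-1` (phi @^-1` [set c])))| <= del].
Proof.
move=> bf del0; have [C [phi [g [mphi fg]]]] := rounded bf del0.
exists C, phi, g; split => // y.
have [bg gE] := Rint_finite (k1 y) (psi := phi \o e y) g (fun c => meA y (mphi c)).
under eq_bigr => c _ do rewrite mulrC.
rewrite -[X in _ - X]gE -(RintB (k1 y)) //; last exact: bfe.
by apply: (le_norm_Rint (k1 y)) => //; exact: (bmeasB (bfe y bf) bg).1.
Qed.

(** A limit of finite combinations of the functions in [mk], obtained by rounding f to finitely many
    values. *)
Lemma bmeas_Rint_kernel (f : V -> R) : bmeas f -> bmeas (fun y => \int[k y]_z f (e y z)).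
Proof.
move=> bf; have [mf [B fB]] := bf; apply: (bmeas_bound (B := B)); last first.
  by move=> y; apply: (le_norm_Rint (k1 y)) => //; exact: (bfe y bf).1.
have ex m : exists a : Y -> R, measurable_fun setT a /\
    forall y, `|\int[k y]_z f (e y z) - a y| <= m.+1%:R^-1.
  have m0 : 0 < m.+1%:R^-1 :> R by rewrite invr_gt0 ltr0n.
  have [C [phi [g [mphi _ fa]]]] := approx bf m0.
  eexists; split; last exact: fa.
  have : bmeas (fun y => \sum_c g c * fine (k y (e y @^-1` (phi @^-1` [set c])))).
    by apply: bmeas_sum => c; apply: bmeasZ; exact: bmeas_kA.
  by case.
have [a aP] := choice ex.
apply: (measurable_fun_cvg (h := a)) => [m|y _]; first by have [] := aP m.
apply/cvgrPdist_le => eps eps0; near=> m.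
apply: le_trans ((aP m).2 y) _; apply: ltW; near: m.
exact: near_infty_natSinv_lt (PosNum eps0).
Unshelve. all: by end_near. Qed.

Variables (l : {measure set Y -> \bar R}) (m : {measure set V -> \bar R}).
Hypothesis l1 : l setT = 1%E.
Hypothesis mE : forall A, measurable A -> m A = (\int[l]_y k y (e y @^-1` A))%E.

(** One Fubini theorem for products of kernels (e is pairing) and compositions (e forgets y). For f
    with finitely many values it is [mE]; a bounded f is a uniform limit of such functions. *)
Lemma Rint_mixture (f : V -> R) : bmeas f ->
  \int[m]_v f v = \int[l]_y \int[k y]_z f (e y z).
Proof.
move=> bf.
have m1 : m setT = 1%E.
  rewrite mE // -l1 -[RHS]mul1e -integral_cst //; apply: eq_integral => y _.
  by rewrite preimage_setT k1.
suff close (eps : R) : 0 < eps ->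
    `|\int[m]_v f v - \int[l]_y \int[k y]_z f (e y z)| <= eps.
  apply/eqP; rewrite -subr_eq0 -normr_le0; apply/ler_addgt0Pr => eps eps0.
  by rewrite add0r close.
move=> eps0; have eps2 : 0 < eps / 2 by rewrite divr_gt0.
have [C [phi [g [mphi fg ka]]]] := approx bf eps2.
have [bg gE] := Rint_finite m1 g mphi.
have bkA c : bmeas (fun y => g c * fine (k y (e y @^-1` (phi @^-1` [set c])))).
  by apply: bmeasZ; exact: bmeas_kA.
have gE' : \int[m]_v g (phi v) =
    \int[l]_y \sum_c g c * fine (k y (e y @^-1` (phi @^-1` [set c]))).
  rewrite gE (Rint_sum l1) //; apply: eq_bigr => c _.
  rewrite (RintZ l1 (g c) (bmeas_kA (mphi c))) [LHS]mulrC; congr (_ * _).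
  rewrite (mE (mphi c)) /Rintegral; congr fine.
  by apply: eq_integral => y _; rewrite fineK //; exact: kA_fin.
have -> (x y : R) : x - y = (x - \int[m]_v g (phi v)) - (y - \int[m]_v g (phi v)) by ring.
apply: le_trans (ler_normB _ _) _; rewrite [leRHS]splitr; apply: lerD.
  rewrite -(RintB m1) //.
  by apply: (le_norm_Rint m1) => //; exact: (bmeasB bf bg).1.
have bI := bmeas_Rint_kernel bf.
have bS : bmeas (fun y => \sum_c g c * fine (k y (e y @^-1` (phi @^-1` [set c])))).
  exact: bmeas_sum.
rewrite gE' -(RintB l1) //.
by apply: (le_norm_Rint l1) => //; exact: (bmeasB bI bS).1.
Qed.

End mixture.

Section product_kernels.
Context {R : realType} d0 d1 d2 (T0 : measurableType d0) (T1 : measurableType d1)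
  (T2 : measurableType d2).

Lemma measurable_kernel_section (k : R.-pker T1 ~> T2) (A : set (T1 * T2)) :
  measurable A -> measurable_fun setT (fun y => k y (pair y @^-1` A)).
Proof.
move=> mA.
have -> : (fun y => k y (pair y @^-1` A)) = kfcomp k (EFin \o \1_A).
  by rewrite kfcompkindic //; apply/funext => y; rewrite xsectionE.
apply: measurable_kfcomp => [|t]; last by rewrite /= lee_fin.
by apply/measurable_EFinP; exact: measurable_indic.
Qed.

(** The parameter x of the second factor is frozen in a kernel k2 of its own; in the uses k2 is a
    kernel of the model or a constant precomposition of one. *)
Lemma Rint_mkproduct (k1 : R.-pker T0 ~> T1) (k2 : R.-pker T1 ~> T2)
    (k2' : R.-pker (T0 * T1) ~> T2) x (f : T1 * T2 -> R) :
  (forall y, k2' (x, y) = k2 y) -> bmeas f ->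
  \int[mkproduct k1 k2' x]_v f v = \int[k1 x]_y \int[k2 y]_z f (y, z).
Proof.
move=> k2E bf; apply: (Rint_mixture (k := k2) (e := fun y z => (y, z))) => //.
- by move=> y; exact: prob_kernel.
- by move=> y; exact: measurable_pair1.
- by move=> A mA; exact: measurable_kernel_section.
- exact: prob_kernel.
move=> A mA; apply: eq_integral => y _.
transitivity (k2' (x, y) (xsection A y)); first exact: kernel.intker_indicE.
by rewrite k2E xsectionE.
Qed.

Lemma bmeas_Rint_pair (k : R.-pker T1 ~> T2) (f : T1 * T2 -> R) :
  bmeas f -> bmeas (fun y => \int[k y]_z f (y, z)).
Proof.
move=> bf; apply: (bmeas_Rint_kernel (e := fun y z => (y, z))) => //.
- by move=> y; exact: prob_kernel.
- by move=> y; exact: measurable_pair1.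
- by move=> A mA; exact: measurable_kernel_section.
Qed.

Lemma bmeas_Rint (k : R.-pker T1 ~> T2) (f : T2 -> R) :
  bmeas f -> bmeas (fun y => \int[k y]_z f z).
Proof.
move=> bf; apply: (bmeas_Rint_kernel (e := fun y z => z)) => //.
- by move=> y; exact: prob_kernel.
- by move=> A mA; exact: measurable_kernel.
Qed.

Lemma Rint_mkcomp_noparam (k1 : R.-pker T0 ~> T1) (k2 : R.-pker T1 ~> T2) x
    (f : T2 -> R) : bmeas f ->
  \int[mkcomp_noparam k1 k2 x]_v f v = \int[k1 x]_y \int[k2 y]_z f z.
Proof.
move=> bf; apply: (Rint_mixture (k := k2) (e := fun y z => z)) => //.
- by move=> y; exact: prob_kernel.
- by move=> A mA; exact: measurable_kernel.
- exact: prob_kernel.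
Qed.

Lemma Rint_kcomp (k1 : R.-pker T0 ~> T1) (k2 : R.-pker (T0 * T1) ~> T2) x
    (f : T2 -> R) : bmeas f ->
  \int[(k1 \; k2)%E x]_v f v = \int[k1 x]_y \int[k2 (x, y)]_z f z.
Proof.
move=> bf; apply: (Rint_mixture (k := fun y => k2 (x, y)) (e := fun y z => z)) => //.
- by move=> y; exact: prob_kernel.
- move=> A mA; apply: (measurableT_comp (measurable_kernel k2 A mA)).
  exact: measurable_pair1.
- exact: prob_kernel.
Qed.

End product_kernels.

Lemma geometric_sumM {R : pzRingType} (z : R) (N : nat) :
  (1 - z) * \sum_(h < N) z ^+ h = 1 - z ^+ N.
Proof.
elim: N => [|N IH]; first by rewrite big_ord0 mulr0 expr0 subrr.
by rewrite big_ord_recr /= mulrDr IH mulrBl mul1r -exprS addrA subrK.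
Qed.

Lemma exprn_small {R : realType} (z c eps : R) :
  0 <= z < 1 -> 0 < eps -> exists2 N, (0 < N)%N & c * z ^+ N <= eps.
Proof.
move=> /andP[z0 z1] eps0.
have [c0|c0] := leP c 0.
  exists 1%N => //; apply: le_trans (ltW eps0).
  by rewrite mulr_le0_ge0 // exprn_ge0.
have /cvgrPdist_le/(_ (eps / c) (divr_gt0 eps0 c0))[N _ NE] :
    (z ^+ n : R) @[n --> \oo] --> (0 : R).
  by apply: cvg_expr; rewrite ger0_norm.
exists N.+1 => //; have := NE N.+1 (leqnSn N).
rewrite /= sub0r normrN ger0_norm ?exprn_ge0 // ler_pdivlMr // mulrC //.
Qed.

Lemma null_setC {R : realType} d (T : measurableType d)
    (m : {measure set T -> \bar R}) G :
  m setT = 1%E -> measurable G -> m G = 1%E -> m (~` G) = 0%E.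
Proof.
move=> m1 mG G1.
have : m (G `|` ~` G) = (m G + m (~` G))%E.
  by apply: measureU => //; [exact: measurableC|rewrite setICr].
rewrite setUv m1 G1; case: (m (~` G)) => [r||] //.
by rewrite -EFinD => -[r1]; congr EFin; apply: (addrI 1); rewrite addr0 -r1.
Qed.

(** * Markov decision processes *)

(** A bounded function equal to the identity at almost every reward, so that reward integrals fall
    under the lemmas on [bmeas]. *)
Definition clip01 {R : realType} (t : R) : R := Num.max 0 (Num.min t 1).

Lemma bmeas_clip01 {R : realType} : bmeas (@clip01 R).
Proof.
apply: (bmeas_bound (B := 1)) => [|t].
  by apply: measurable_maxr => //; exact: measurable_minr.
by rewrite ger0_norm /clip01 ?le_max ?lexx // ge_max ler01 ge_min lexx orbT.
Qed.

Lemma clip01_id {R : realType} (t : R) : 0 <= t <= 1 -> clip01 t = t.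
Proof. by move=> /andP[t0 t1]; rewrite /clip01 (min_idPl t1) (max_idPr t0). Qed.

Section value_function.
Context (R : realType) d d' (S : measurableType d) (A : measurableType d').
Local Notation SA := (S * A)%type.
Variables (M : mdp R S A) (pi : R.-pker S ~> A).
Local Notation gamma := (discount M).
Local Notation T := (bellman M pi).

Let gamma0 : 0 <= gamma := discount_ge0 M.
Let gamma1 : gamma < 1 := discount_lt1 M.
Let gamma01 : 0 <= gamma < 1. Proof. by rewrite gamma0 gamma1. Qed.
Let g1 : 0 < 1 - gamma. Proof. by rewrite subr_gt0. Qed.

Let bclip : bmeas (@clip01 R) := bmeas_clip01.

Let mean_rewardE x : mean_reward M x = \int[reward M x]_t clip01 t.
Proof.
have m01 : measurable (`[0, 1]%classic : set R) by exact: measurable_itv.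
apply: (ae_eq_Rint _ _ m01) => //; first by have [] := bclip.
  by apply: null_setC => //; [exact: prob_kernel|exact: reward01].
by move=> t; rewrite inE /= in_itv /= => t01; rewrite clip01_id.
Qed.

Lemma bmeas_mean_reward : bmeas (mean_reward M).
Proof.
rewrite (_ : mean_reward M = fun x => \int[reward M x]_t clip01 t).
  exact: bmeas_Rint.
by apply/funext => x; exact: mean_rewardE.
Qed.

Lemma mean_reward01 x : 0 <= mean_reward M x <= 1.
Proof.
have r1 : reward M x setT = 1%E by exact: prob_kernel.
rewrite mean_rewardE; apply/andP; split.
  by apply: Rintegral_ge0 => t _; rewrite /clip01 le_max lexx.
rewrite -[leRHS](Rint_cst r1); apply: (le_Rint r1) => //; first exact: bmeas_cst.
by move=> t; rewrite /clip01 ge_max ler01 ge_min lexx orbT.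
Qed.

Lemma bmeas_policy_mean f : bmeas f -> bmeas (policy_mean pi f).
Proof. exact: bmeas_Rint_pair. Qed.

Lemma policy_mean_norm f (B : R) s : bmeas f -> (forall x, `|f x| <= B) ->
  `|policy_mean pi f s| <= B.
Proof.
move=> bf fB; apply: (le_norm_Rint (prob_kernel s)) => //.
by have [] := bmeas_comp (measurable_pair1 s) bf.
Qed.

Definition next_mean (f : SA -> R) (x : SA) : R :=
  \int[transition M x]_s policy_mean pi f s.

Lemma bmeas_next_mean f : bmeas f -> bmeas (next_mean f).
Proof. by move=> bf; apply: bmeas_Rint; exact: bmeas_policy_mean. Qed.

Lemma Rint_sa_step f x : bmeas f -> \int[sa_step M pi x]_y f y = next_mean f x.
Proof. by move=> bf; apply: Rint_mkproduct. Qed.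

Definition law_mean (h : nat) (f : SA -> R) (x : SA) : R :=
  \int[sa_law M pi h x]_y f y.

Lemma bmeas_law_mean h f : bmeas f -> bmeas (law_mean h f).
Proof. exact: bmeas_Rint. Qed.

Lemma law_mean0 f x : bmeas f -> law_mean 0 f x = f x.
Proof.
move=> bf; rewrite /law_mean /Rintegral /= /kdirac integral_dirac //.
  by rewrite diracT mul1e.
by apply/measurable_EFinP; case: bf.
Qed.

Lemma law_meanS h f x : bmeas f -> law_mean h.+1 f x = law_mean h (next_mean f) x.
Proof.
move=> bf; rewrite /law_mean /= Rint_mkcomp_noparam //.
by apply: eq_Rintegral => y _; exact: Rint_sa_step.
Qed.

(** [sa_law] appends steps at the end, whereas the Bellman operator takes one at the start; the two
    orders agree. *)
Lemma next_law_mean h f x : bmeas f ->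
  next_mean (law_mean h f) x = law_mean h.+1 f x.
Proof.
elim: h f x => [|h IH] f x bf.
  have -> : law_mean 0 f = f by apply/funext => y; exact: law_mean0.
  by rewrite (law_meanS 0 x bf) law_mean0 //; exact: bmeas_next_mean.
have -> : law_mean h.+1 f = law_mean h (next_mean f).
  by apply/funext => y; exact: law_meanS.
by rewrite (law_meanS h.+1 x bf) IH //; exact: bmeas_next_mean.
Qed.

Lemma law_prob h x : sa_law M pi h x setT = 1%E.
Proof. exact: prob_kernel. Qed.

Lemma law_meanD h f g x : bmeas f -> bmeas g ->
  law_mean h (fun y => f y + g y) x = law_mean h f x + law_mean h g x.
Proof. by move=> bf bg; apply: (RintD (law_prob h x)). Qed.

Lemma law_meanB h f g x : bmeas f -> bmeas g ->
  law_mean h (fun y => f y - g y) x = law_mean h f x - law_mean h g x.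
Proof. by move=> bf bg; apply: (RintB (law_prob h x)). Qed.

Lemma law_meanZ h c f x : bmeas f ->
  law_mean h (fun y => c * f y) x = c * law_mean h f x.
Proof. by move=> bf; apply: (RintZ (law_prob h x)). Qed.

Lemma law_mean_norm h f (B : R) x : bmeas f -> (forall y, `|f y| <= B) ->
  `|law_mean h f x| <= B.
Proof.
by move=> bf fB; apply: (le_norm_Rint (law_prob h x)) => //; case: bf.
Qed.

Lemma bmeas_bellman f : bmeas f -> bmeas (T f).
Proof.
move=> bf; apply: bmeasD; first exact: bmeas_mean_reward.
by apply: bmeasZ; exact: bmeas_next_mean.
Qed.

Definition partial_value (N : nat) (x : SA) : R :=
  \sum_(h < N) gamma ^+ h * law_mean h (mean_reward M) x.

(** The term gamma * [next_mean] f of T f at time h is the discounted mean of f at time h + 1 and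
    cancels against it. The finite horizon avoids exchanging limits and integrals. *)
Lemma value_telescope f N x : bmeas f ->
  \sum_(h < N) gamma ^+ h * law_mean h (fun y => T f y - f y) x =
  partial_value N x + gamma ^+ N * law_mean N f x - f x.
Proof.
move=> bf; rewrite /partial_value; elim: N => [|N IH].
  by rewrite !big_ord0 add0r expr0 mul1r law_mean0 // subrr.
rewrite !big_ord_recr /= IH law_meanB //; last exact: bmeas_bellman.
rewrite law_meanD; last 2 first.
- exact: bmeas_mean_reward.
- by apply: bmeasZ; exact: bmeas_next_mean.
rewrite law_meanZ; last exact: bmeas_next_mean.
by rewrite -[in RHS]/(next_mean f) (law_meanS N x bf) exprS; ring.
Qed.

Lemma partial_value_tail N N' x : (N <= N')%N ->
  0 <= partial_value N' x - partial_value N x <= gamma ^+ N / (1 - gamma).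
Proof.
move=> NN'; rewrite /partial_value.
have term h : 0 <= law_mean h (mean_reward M) x <= 1.
  apply/andP; split.
    by apply: Rintegral_ge0 => y _; have /andP[] := mean_reward01 y.
  rewrite -[leRHS](Rint_cst (law_prob h x)); apply: (le_Rint (law_prob h x)).
  - exact: bmeas_mean_reward.
  - exact: bmeas_cst.
  - by move=> y; have /andP[] := mean_reward01 y.
rewrite -!(big_mkord xpredT (fun h => gamma ^+ h * law_mean h (mean_reward M) x)).
rewrite (big_cat_nat (n := N)) //= addrAC subrr add0r.
apply/andP; split.
  apply: sumr_ge0 => h _; have /andP[t0 _] := term h.
  by rewrite mulr_ge0 // exprn_ge0.
rewrite ler_pdivlMr // mulrC.
apply: (@le_trans _ _ ((1 - gamma) * \sum_(N <= h < N') gamma ^+ h)).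
  rewrite ler_wpM2l ?(ltW g1) //; apply: ler_sum => h _; have /andP[_ t1] := term h.
  by rewrite ler_piMr // exprn_ge0.
have -> : \sum_(N <= h < N') gamma ^+ h =
    \sum_(h < N') gamma ^+ h - \sum_(h < N) gamma ^+ h.
  rewrite -!(big_mkord xpredT (fun h => gamma ^+ h)).
  by rewrite [in RHS](big_cat_nat (n := N)) //= addrAC subrr add0r.
rewrite mulrBr !geometric_sumM.
have := exprn_ge0 N' gamma0; lra.
Qed.

(** Rewards are nonnegative, so the partial sums increase, with a geometric tail; this also yields
    convergence of the series. *)
Lemma qvalue_partial N x : (0 < N)%N ->
  `|qvalue M pi x - partial_value N x| <= gamma ^+ N / (1 - gamma).
Proof.
move=> N0; pose u N := \sum_(1 <= h < N) gamma ^+ h *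
  \int[sa_law M pi h x]_y mean_reward M y.
have uE k : (0 < k)%N -> mean_reward M x + u k = partial_value k x.
  move=> k0; rewrite /partial_value -(big_mkord xpredT
    (fun h => gamma ^+ h * law_mean h (mean_reward M) x)) big_ltn //.
  rewrite expr0 mul1r law_mean0 //; exact: bmeas_mean_reward.
(* The series in [qvalue] starts at h = 1, so both sums are empty; [uE] holds only from k = 1 on. *)
have u0 : u 0%N = u 1%N by rewrite /u !big_geq.
have nd : nondecreasing_seq u.
  have nd1 k k' : (0 < k)%N -> (k <= k')%N -> u k <= u k'.
    move=> k0 kk'; rewrite -(lerD2l (mean_reward M x)) !uE ?(leq_trans k0) //.
    by rewrite -subr_ge0; have /andP[] := partial_value_tail x kk'.
  move=> [|k] [|k'] //; last exact: nd1.
  by move=> _; rewrite u0; exact: nd1.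
have ub k : (N <= k)%N -> u k <= u N + gamma ^+ N / (1 - gamma).
  move=> Nk; rewrite -(lerD2l (mean_reward M x)) addrA !uE ?(leq_trans N0) //.
  by rewrite addrC -lerBlDr; have /andP[] := partial_value_tail x Nk.
have cu : cvgn u.
  apply: nondecreasing_is_cvgn => //; exists (u N + gamma ^+ N / (1 - gamma)).
  move=> _ [k _ <-]; have [Nk|kN] := leqP N k; first exact: ub.
  by apply: le_trans (ub N (leqnn N)); apply: nd; exact: ltnW.
have -> : qvalue M pi x - partial_value N x = limn u - u N.
  by rewrite -uE // /qvalue -/u opprD addrA [_ + limn u]addrC addrK.
rewrite ger0_norm; first last.
  by rewrite subr_ge0; exact: nondecreasing_cvgn_le.
rewrite lerBlDl; apply: limr_le => //; near=> k; apply: ub; near: k.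
exact: nbhs_infty_ge.
Unshelve. all: by end_near. Qed.

End value_function.

(** * Fixed point equation and prediction error *)

Section bellman_error.
Context (R : realType) d d' (S : measurableType d) (A : measurableType d').
Local Notation SA := (S * A)%type.
Variables (M : mdp R S A) (pi : R.-pker S ~> A).
Local Notation gamma := (discount M).
Local Notation T := (bellman M pi).

Let gamma0 : 0 <= gamma := discount_ge0 M.
Let gamma1 : gamma < 1 := discount_lt1 M.
Let gamma01 : 0 <= gamma < 1. Proof. by rewrite gamma0 gamma1. Qed.
Let g1 : 0 < 1 - gamma. Proof. by rewrite subr_gt0. Qed.

Lemma next_mean_norm f (B : R) x : bmeas f -> (forall y, `|f y| <= B) ->
  `|next_mean M pi f x| <= B.
Proof.
move=> bf fB; apply: (le_norm_Rint (prob_kernel x)).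
  by have [] := bmeas_policy_mean pi bf.
by move=> s; exact: policy_mean_norm.
Qed.

Lemma bmeas_partial_value N : bmeas (partial_value M pi N).
Proof.
apply: bmeas_sum => h; apply: bmeasZ; apply: bmeas_law_mean.
exact: bmeas_mean_reward.
Qed.

Let step1 x : sa_step M pi x setT = 1%E. Proof. exact: prob_kernel. Qed.

Lemma next_meanB f g x : bmeas f -> bmeas g ->
  next_mean M pi (fun y => f y - g y) x = next_mean M pi f x - next_mean M pi g x.
Proof.
move=> bf bg; rewrite -!Rint_sa_step //; last exact: bmeasB.
exact: (RintB (step1 x)).
Qed.

Lemma bellman_partial_value N x :
  T (partial_value M pi N) x = partial_value M pi N.+1 x.
Proof.
have br := bmeas_mean_reward M.
rewrite /bellman -/(next_mean M pi (partial_value M pi N) x).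
rewrite -(Rint_sa_step M pi x (bmeas_partial_value N)).
rewrite (Rint_sum (step1 x)); last first.
  by move=> h; apply: bmeasZ; exact: bmeas_law_mean.
rewrite [RHS]/partial_value big_ord_recl expr0 mul1r law_mean0 //.
congr (_ + _); rewrite mulr_sumr; apply: eq_bigr => h _.
rewrite (RintZ (step1 x)); last exact: bmeas_law_mean.
rewrite Rint_sa_step; last exact: bmeas_law_mean.
by rewrite next_law_mean // mulrA -exprS.
Qed.

(** T sends the N-th partial value to the next one, and both are uniformly close to the value
    function. Its measurability comes from realizability in the applications. *)
Lemma bellman_qvalue x : bmeas (qvalue M pi) -> T (qvalue M pi) x = qvalue M pi x.
Proof.
move=> bq; set q := qvalue M pi in bq *.
apply/eqP; rewrite -subr_eq0 -normr_le0; apply/ler_addgt0Pr => eps eps0.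
rewrite add0r; have [N N0 Neps] := exprn_small (2 / (1 - gamma)) gamma01 eps0.
apply: le_trans Neps.
have -> : T q x - q x = gamma * next_mean M pi (fun y => q y - partial_value M pi N y) x
    - (q x - partial_value M pi N.+1 x).
  rewrite -bellman_partial_value /bellman -/(next_mean M pi q x).
  rewrite -/(next_mean M pi (partial_value M pi N) x).
  by rewrite next_meanB //; [ring|exact: bmeas_partial_value].
apply: le_trans (ler_normB _ _) _.
have h1 : `|next_mean M pi (fun y => q y - partial_value M pi N y) x|
    <= gamma ^+ N / (1 - gamma).
  apply: next_mean_norm; last by move=> y; exact: qvalue_partial.
  by apply: bmeasB => //; exact: bmeas_partial_value.
have h2 : `|q x - partial_value M pi N.+1 x| <= gamma ^+ N / (1 - gamma).
  apply: le_trans (qvalue_partial M pi x (ltn0Sn N)) _.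
  rewrite ler_pM2r ?invr_gt0 // exprS ler_piMl ?exprn_ge0 //; exact: ltW.
rewrite normrM (ger0_norm gamma0).
have h3 : 0 <= gamma ^+ N / (1 - gamma) by rewrite divr_ge0 ?exprn_ge0 // ltW.
have -> : 2 / (1 - gamma) * gamma ^+ N =
  gamma ^+ N / (1 - gamma) + gamma ^+ N / (1 - gamma) by ring.
apply: lerD => //; apply: le_trans h1.
by rewrite ler_piMl // ltW.
Qed.

Variable s0 : S.
Local Notation occ := (occupancy M pi s0).
Let mlaw h : {measure set SA -> \bar R} := (pi \; sa_law M pi h)%E s0.

Lemma mlaw_mean h f : bmeas f ->
  \int[mlaw h]_x f x = \int[pi s0]_a law_mean M pi h f (s0, a).
Proof. by move=> bf; apply: Rint_kcomp. Qed.

Lemma mlaw1 h : mlaw h setT = 1%E.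
Proof.
rewrite /mlaw /= /kcomp -[RHS](prob_kernel (s := pi) s0) -[RHS]mul1e.
rewrite -integral_cst //; apply: eq_integral => a _.
exact: prob_kernel.
Qed.

Lemma occupancy1 : occ setT = 1%E.
Proof.
rewrite /occupancy /mseries.
transitivity (\sum_(0 <= h <oo) ((1 - gamma) * gamma ^+ h)%:E)%E.
  apply: eq_eseriesr => h _.
  transitivity (((1 - gamma) * gamma ^+ h)%:E * mlaw h setT)%E; first by [].
  by rewrite mlaw1 mule1.
apply/cvg_lim => //.
rewrite (_ : (fun n => _) = EFin \o (fun n => 1 - gamma ^+ n)); last first.
  apply/funext => n; rewrite sumEFin big_mkord -mulr_sumr /= geometric_sumM //.
apply: cvg_EFin; first by near=> n.
rewrite -[X in _ --> X](subr0 1); apply: cvgB; first exact: cvg_cst.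
by apply: cvg_expr; rewrite ger0_norm.
Unshelve. all: by end_near. Qed.

Lemma le_occupancy N f : bmeas f -> (forall x, 0 <= f x) ->
  (1 - gamma) * \sum_(h < N) gamma ^+ h * \int[mlaw h]_x f x <= \int[occ]_x f x.
Proof.
move=> bf f0; have mf : measurable_fun setT (EFin \o f).
  by apply/measurable_EFinP; case: bf.
rewrite -lee_fin (EFin_Rint occupancy1 bf) ge0_integral_measure_series //; last first.
  by move=> x _; rewrite lee_fin.
apply: le_trans (nneseries_lim_ge N _); last first.
  by move=> h _ _; apply: integral_ge0 => x _; rewrite lee_fin.
rewrite big_mkord mulr_sumr -sumEFin le_eqVlt; apply/orP; left; apply/eqP.
apply: eq_bigr => h _; rewrite ge0_integral_mscale //=; last first.
  by move=> x _; rewrite lee_fin.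
by rewrite mulrA EFinM (EFin_Rint (mlaw1 h) bf).
Qed.

(** By telescoping, q - f at the initial pair is the discounted sum of the means of T f - f, hence
    at most the occupancy mean c of |T f - f| divided by 1 - gamma; Jensen's inequality bounds
    c^2. *)
Lemma prediction_error_le f : bmeas f -> bmeas (qvalue M pi) ->
  `|prediction_error M pi s0 f| ^+ 2 <=
  (1 - gamma) ^- 2 * sqnorm occ (f \- T f).
Proof.
move=> bf bq; set q := qvalue M pi in bq *.
pose u x := T f x - f x.
have bu : bmeas u by apply: bmeasB => //; exact: bmeas_bellman.
have bau : bmeas (fun x => `|u x|) by exact: bmeas_norm.
have pi1 : pi s0 setT = 1%E by exact: prob_kernel.
have b_s0 (g : SA -> R) : bmeas g -> bmeas (fun a => g (s0, a)).
  by move=> bg; apply: (bmeas_comp (phi := pair s0)) => //; exact: measurable_pair1.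
pose c := \int[occ]_x `|u x|.
have PE : `|prediction_error M pi s0 f| <= (1 - gamma)^-1 * c.
  apply/ler_addgt0Pr => eps eps0.
  have [_ [B fB]] := bf.
  have B0 : 0 <= B by apply: le_trans (fB (s0, point)); exact: normr_ge0.
  have [N N0 Neps] := exprn_small ((1 - gamma)^-1 + B) gamma01 eps0.
  have bsum : bmeas (fun x => \sum_(h < N) gamma ^+ h * law_mean M pi h (fun y => `|u y|) x).
    by apply: bmeas_sum => h; apply: bmeasZ; exact: bmeas_law_mean.
  (* The first term truncates the value function, the second bounds the boundary term of the
     telescope. *)
  pose rem := gamma ^+ N / (1 - gamma) + gamma ^+ N * B.
  have qf x : `|q x - f x| <=
      \sum_(h < N) gamma ^+ h * law_mean M pi h (fun y => `|u y|) x + rem.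
    have := value_telescope M pi N x bf; rewrite -/u => tele.
    have -> : q x - f x = \sum_(h < N) gamma ^+ h * law_mean M pi h u x +
        ((q x - partial_value M pi N x) - gamma ^+ N * law_mean M pi N f x).
      by rewrite tele; ring.
    apply: le_trans (ler_normD _ _) _; apply: lerD.
      apply: le_trans (ler_norm_sum _ _ _) _; apply: ler_sum => h _.
      rewrite normrM ger0_norm ?exprn_ge0 // ler_wpM2l ?exprn_ge0 //.
      apply: le_normr_Rintegral => //; apply: bmeas_integrable => //.
      exact: law_prob.
    apply: le_trans (ler_normB _ _) _; apply: lerD; first exact: qvalue_partial.
    rewrite normrM ger0_norm ?exprn_ge0 // ler_wpM2l ?exprn_ge0 //.
    exact: law_mean_norm.
  rewrite /prediction_error /policy_mean -(RintB pi1 (b_s0 _ bq) (b_s0 _ bf)).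
  apply: (@le_trans _ _ (\int[pi s0]_a `|q (s0, a) - f (s0, a)|)).
    apply: le_normr_Rintegral => //; apply: (bmeas_integrable pi1).
    by apply: bmeasB; exact: b_s0.
  apply: (@le_trans _ _ (\int[pi s0]_a (\sum_(h < N) gamma ^+ h *
      law_mean M pi h (fun y => `|u y|) (s0, a) + rem))).
    apply: (le_Rint pi1) => //.
    - by apply: bmeas_norm; apply: bmeasB; exact: b_s0.
    - apply: bmeasD; last exact: bmeas_cst.
      exact: (b_s0 _ bsum).
  rewrite (RintD pi1); [|exact: (b_s0 _ bsum)|exact: bmeas_cst].
  rewrite (Rint_cst pi1); apply: lerD; last first.
    by apply: le_trans Neps; rewrite /rem; lra.
  rewrite ler_pdivlMl //.
  apply: le_trans (le_occupancy N bau (fun=> normr_ge0 _)).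
  rewrite ler_wpM2l ?(ltW g1) // (Rint_sum pi1); last first.
    by move=> h; apply: bmeasZ; exact/(b_s0 _)/bmeas_law_mean.
  apply: ler_sum => h _; rewrite (RintZ pi1); last exact/(b_s0 _)/bmeas_law_mean.
  by rewrite mlaw_mean.
(* Jensen's inequality, read off from the nonnegative variance of |u|. *)
have c2 : c ^+ 2 <= sqnorm occ (f \- T f).
  have -> : sqnorm occ (f \- T f) = \int[occ]_x `|u x| ^+ 2.
    apply: eq_Rintegral => x _; rewrite real_normK ?num_real //= -sqrrN.
    by congr (_ ^+ 2); rewrite /u; ring.
  have : 0 <= \int[occ]_x (`|u x| - c) ^+ 2.
    by apply: Rintegral_ge0 => x _; exact: sqr_ge0.
  rewrite (eq_Rintegral _ (g := fun x => (`|u x| ^+ 2 - 2 * c * `|u x|) + c ^+ 2)); last first.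
    by move=> x _; ring.
  have b2 : bmeas (fun x => `|u x| ^+ 2) by exact: bmeasX.
  have bc : bmeas (fun x => 2 * c * `|u x|) by exact: bmeasZ.
  rewrite (RintD occupancy1 (bmeasB b2 bc) (bmeas_cst _ _)) (RintB occupancy1 b2 bc).
  by rewrite (RintZ occupancy1 _ bau) (Rint_cst occupancy1) -/c; lra.
apply: le_trans (_ : ((1 - gamma)^-1 * c) ^+ 2 <= _).
  by rewrite ler_sqr // ?nnegrE //; apply: le_trans PE.
by rewrite exprMn exprVn ler_wpM2l // invr_ge0 sqr_ge0.
Qed.

End bellman_error.

(** * Loss differences under the data law *)

Section data.
Context (R : realType) d d' (S : measurableType d) (A : measurableType d').
Local Notation SA := (S * A)%type.
Local Notation obs := (SA * (R * S))%type.
Variables (M : mdp R S A) (pi : R.-pker S ~> A) (mu : probability SA R).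
Local Notation gamma := (discount M).
Local Notation T := (bellman M pi).

Lemma Rint_outcome x (f : R * S -> R) : bmeas f ->
  \int[outcome M x]_y f y = \int[reward M x]_r \int[transition M x]_s f (r, s).
Proof.
move=> bf.
exact: (@Rint_mkproduct R _ _ _ _ _ _ (reward M)
  (kprecomp (transition M) (measurable_cst x))).
Qed.

Lemma Rint_data (f : obs -> R) : bmeas f ->
  \int[data_law M mu]_z f z = \int[mu]_x \int[outcome M x]_y f (x, y).
Proof.
move=> bf.
exact: (@Rint_mkproduct R _ _ _ _ _ _ (kprobability _) (outcome M)).
Qed.

(* Rewards lie in [0, 1] only almost surely: losses are bounded on this event
   only. *)
Definition rewarded : set obs := [set z | 0 <= z.2.1 <= 1].

Lemma measurable_rewarded : measurable rewarded.
Proof.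
rewrite -[X in measurable X]setTI.
have mr : measurable_fun setT (fun z : obs => z.2.1).
  exact: (measurableT_comp measurable_fst measurable_snd).
rewrite (_ : rewarded = (fun z : obs => z.2.1) @^-1` `[0, 1]%classic).
  exact: mr.
by apply/seteqP; split => z /=; rewrite in_itv.
Qed.

Let data1 : data_law M mu setT = 1%E. Proof. exact: probability_setT. Qed.
Let mu1 : mu setT = 1%E. Proof. exact: probability_setT. Qed.
Let outcome1 x : outcome M x setT = 1%E. Proof. exact: prob_kernel. Qed.
Let reward1 x : reward M x setT = 1%E. Proof. exact: prob_kernel. Qed.
Let trans1 x : transition M x setT = 1%E. Proof. exact: prob_kernel. Qed.

Lemma data_rewarded : data_law M mu rewarded = 1%E.
Proof.
have bi : bmeas (\1_rewarded : obs -> R).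
  by apply: bmeas_indic; exact: measurable_rewarded.
rewrite -[LHS]fineK; last by rewrite fin_num_measure //; exact: measurable_rewarded.
congr EFin; rewrite -Rint_indic; last exact: measurable_rewarded.
rewrite Rint_data // -[RHS](Rint_cst mu1); apply: eq_Rintegral => x _.
rewrite Rint_outcome; last first.
  exact: (bmeas_comp (phi := pair x) (measurable_pair1 x) bi).
have m01 : measurable (`[0, 1]%classic : set R) by exact: measurable_itv.
transitivity (\int[reward M x]_r (\1_(`[0, 1]%classic) r : R)).
  apply: eq_Rintegral => r _; rewrite -[RHS](Rint_cst (trans1 x)).
  apply: eq_Rintegral => s _; rewrite !indicE.
  have [r01|r01] := pselect (0 <= r <= 1); first by rewrite !mem_set //= in_itv.
  by rewrite !memNset //= in_itv.
by rewrite Rint_indic // reward01.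
Qed.

Lemma Rint_data_sa (f : SA -> R) : bmeas f ->
  \int[data_law M mu]_z f z.1 = \int[mu]_x f x.
Proof.
move=> bf; rewrite (Rint_data (bmeas_comp measurable_fst bf)).
by apply: eq_Rintegral => x _ /=; exact: (Rint_cst (outcome1 x)).
Qed.

Let bclip : bmeas (@clip01 R) := bmeas_clip01.

Lemma loss_gapE (g f q : SA -> R) z : loss M pi f q z - loss M pi g q z =
  (f z.1 - g z.1) * (f z.1 + g z.1 - 2 * (z.2.1 + gamma * policy_mean pi q z.2.2)).
Proof. by rewrite /loss; ring. Qed.

Lemma measurable_loss_gap (g f : SA -> R) : bmeas f -> bmeas g ->
  measurable_fun setT (loss_gap M pi g f).
Proof.
move=> bf bg.
rewrite (_ : loss_gap M pi g f = fun z =>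
  (f z.1 - g z.1) * (f z.1 + g z.1 - 2 * (z.2.1 + gamma * policy_mean pi f z.2.2))).
  have mf1 (u : SA -> R) : bmeas u -> measurable_fun setT (fun z : obs => u z.1).
    by case=> mu' _; apply: measurableT_comp.
  apply: measurable_funM; first by apply: measurable_funB; exact: mf1.
  apply: measurable_funB; first by apply: measurable_funD; exact: mf1.
  apply: measurable_funM; first exact: measurable_cst.
  apply: measurable_funD.
    exact: (measurableT_comp measurable_fst measurable_snd).
  apply: measurable_funM; first exact: measurable_cst.
  have [mp _] := bmeas_policy_mean pi bf.
  apply: measurableT_comp => //.
  exact: (measurableT_comp measurable_snd measurable_snd).
by apply/funext => z; exact: loss_gapE.
Qed.

(** Both losses contain the same conditional variance of r + gamma f(s+, pi), which cancels: the
    factored difference is affine in this target, so only its conditional mean T f remains. *)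
Lemma gap_mean (g f : SA -> R) : bmeas f -> bmeas g ->
  \int[data_law M mu]_z loss_gap M pi g f z =
  sqnorm mu (f \- T f) - sqnorm mu (g \- T f).
Proof.
move=> bf bg.
have bp := bmeas_policy_mean pi bf.
pose u x := f x - g x; pose v x := f x + g x.
have bu : bmeas u by exact: bmeasB.
have bv : bmeas v by exact: bmeasD.
pose w (y : R * S) := 2 * (clip01 y.1 + gamma * policy_mean pi f y.2).
have bw : bmeas w.
  apply: bmeasZ; apply: bmeasD; first exact: (bmeas_comp measurable_fst).
  by apply: bmeasZ; exact: (bmeas_comp measurable_snd).
pose h (z : obs) := u z.1 * (v z.1 - w z.2).
have bh : bmeas h.
  apply: bmeasM; first exact: (bmeas_comp measurable_fst).
  by apply: bmeasB; [exact: (bmeas_comp measurable_fst)|exact: (bmeas_comp measurable_snd)].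
have bT := bmeas_bellman M pi bf.
transitivity (\int[data_law M mu]_z h z).
  apply: (ae_eq_Rint _ _ measurable_rewarded).
  - exact: measurable_loss_gap.
  - by have [] := bh.
  - exact: (null_setC data1 measurable_rewarded data_rewarded).
  - by move=> z; rewrite inE => Gz; rewrite [LHS]loss_gapE /h /w clip01_id.
rewrite Rint_data //.
transitivity (\int[mu]_x (u x * (v x - 2 * T f x))).
  apply: eq_Rintegral => x _.
  have bvw : bmeas (fun y => v x - w y) by apply: bmeasB => //; exact: bmeas_cst.
  transitivity (\int[outcome M x]_y (u x * (v x - w y))); first by [].
  rewrite (RintZ (outcome1 x) _ bvw) (RintB (outcome1 x) (bmeas_cst _ _) bw).
  rewrite (Rint_cst (outcome1 x)) (Rint_outcome x bw); congr (_ * (_ - _)).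
  transitivity (\int[reward M x]_r (2 * clip01 r + 2 * (gamma * next_mean M pi f x))).
    apply: eq_Rintegral => r _; rewrite /w /=.
    rewrite (RintZ (trans1 x)); last first.
      by apply: bmeasD; [exact: bmeas_cst|exact: bmeasZ].
    rewrite (RintD (trans1 x)); [|exact: bmeas_cst|exact: bmeasZ].
    by rewrite (Rint_cst (trans1 x)) (RintZ (trans1 x)) // mulrDr.
  rewrite (RintD (reward1 x)); [|exact: bmeasZ|exact: bmeas_cst].
  rewrite (Rint_cst (reward1 x)) (RintZ (reward1 x)) // -mulrDr; congr (_ * (_ + _)).
  have m01 : measurable (`[0, 1]%classic : set R) by exact: measurable_itv.
  apply: (ae_eq_Rint _ _ m01) => //.
  - by have [] := bclip.
  - by apply: null_setC => //; exact: reward01.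
  - by move=> r; rewrite inE /= in_itv /= => r01; exact: clip01_id.
rewrite /sqnorm -(RintB mu1); last 2 first.
- by apply: bmeasX; exact: bmeasB.
- by apply: bmeasX; exact: bmeasB.
by apply: eq_Rintegral => x _ /=; rewrite /u /v; ring.
Qed.

End data.

Lemma bigmax_attained {R : realType} (J : finType) (j0 : J) (F : J -> R) :
  (forall j, 0 <= F j) -> exists j, \big[Num.max/0]_j F j <= F j.
Proof.
move=> F0; exists (jmax j0 F); apply: bigmax_le => // j _; exact: le_jmax.
Qed.

(** * Deviation events for truncated classes *)

Section class_events.
Context {R : realType} d dO (T : measurableType d) (Omega : measurableType dO).
Variables (Q : probability T R) (P : probability Omega R) (n : nat).
Variable (Z : 'I_n -> {RV P >-> T}).
Hypothesis iid : iid_sample Q Z.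
Hypothesis n_gt0 : (0 < n)%N.
Variable G : set T.
Hypothesis mG : measurable G.
Hypothesis QG : Q G = 1%E.
Let P1 : P setT = 1%E := probability_setT P.

(** A class bounded on the full-measure set G becomes bounded everywhere, with the same means and
    almost surely the same sample values. *)
Definition restr (h : T -> R) (z : T) : R := h z * \1_G z.

Lemma restrE h z : G z -> restr h z = h z.
Proof. by move=> Gz; rewrite /restr indicE mem_set // mulr1. Qed.

Lemma measurable_restr h : measurable_fun setT h -> measurable_fun setT (restr h).
Proof. by move=> mh; apply: measurable_funM => //; exact: measurable_indic. Qed.

Lemma restr_norm h b z : 0 <= b -> (forall z, G z -> `|h z| <= b) -> `|restr h z| <= b.
Proof.
move=> b0 hb; have [Gz|nGz] := pselect (G z); first by rewrite restrE ?hb.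
by rewrite /restr indicE memNset // mulr0 normr0.
Qed.

(** The failure probability is either Markov's bound or the exponential one with free parameter l:
    the first serves at one fixed radius, the second on the shells. *)
Lemma class_events (Hs : set (T -> R)) (b s2 rho : R) :
  separable_process Q Z Hs -> 0 < b -> 0 <= rho ->
  (forall h, Hs h -> measurable_fun setT h /\ forall z, G z -> `|h z| <= b) ->
  (forall h, Hs h -> \int[Q]_z (restr h z) ^+ 2 <= s2) ->
  (forall k (H : 'I_k.+1 -> T -> R), (forall j, Hs (H j)) ->
     \sum_e \int[P]_w radn Z (fun j => restr (H j)) e w <= 2 ^+ n * (n%:R * rho)) ->
  forall (t B : R), 0 < t ->
    (B = 2 * rho / t \/ exists l, [/\ 0 < l, l <= 4^-1 &
      B = expR (n%:R * (l / b * (2 * rho - t / 2) + l ^+ 2 / (2 * b ^+ 2) * s2))]) ->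
  exists2 E : set Omega, measurable E /\ ((1 - B)%:E <= P E)%E &
    forall w, E w -> forall h, Hs h ->
      `|n%:R^-1 * \sum_(i < n) h (Z i w) - \int[Q]_z h z| <= t.
Proof.
move=> sep b0 rho0 Hsb Hs2 Hrad t B t0 HB.
have n0 : 0 < n%:R :> R by rewrite ltr0n.
have nt0 : 0 < n%:R * t by rewrite mulr_gt0.
have B0 : 0 <= B.
  case: HB => [->|[l [_ _ ->]]]; last exact: expR_ge0.
  by rewrite !mulr_ge0 // invr_ge0 ltW.
have fin k (H : 'I_k.+1 -> T -> R) : (forall j, Hs (H j)) ->
    (P [set w | (n%:R * t < devn Q Z (fun j => restr (H j)) w)%R] <= B%:E)%E.
  move=> HH; set H' := fun j => restr (H j).
  have mH' j : measurable_fun setT (H' j) by apply: measurable_restr; have [] := Hsb _ (HH j).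
  have H'b j z : `|H' j z| <= b.
    by apply: restr_norm; [exact: ltW|have [] := Hsb _ (HH j)].
  have H's2 j : \int[Q]_z (H' j z) ^+ 2 <= s2 by exact: Hs2.
  have Edev : \int[P]_w devn Q Z H' w <= n%:R * (2 * rho).
    have two0 : 0 < 2 ^+ n :> R by rewrite exprn_gt0.
    rewrite -(ler_pM2l two0).
    (* The expected deviation is counted once for each of the 2^n sign vectors, each with its own
       symmetrization bound. *)
    apply: (@le_trans _ _ (\sum_(e : {ffun 'I_n -> bool}) \int[P]_w devn Q Z H' w)).
      rewrite sumr_const card_ffun card_bool card_ord -[in leRHS]mulr_natl natrX.
      by [].
    apply: (@le_trans _ _ (\sum_e 2 * \int[P]_w radn Z H' e w)).
      by apply: ler_sum => e _; exact: (symmetrization_RV iid b0 mH' H'b H's2).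
    rewrite -mulr_sumr; have := Hrad k H HH; rewrite -/H'; lra.
  have bdev : bmeas (devn Q Z H') by exact: (bmeas_devn Q Z mH' H'b).
  case: HB => [->|[l [l0 l4 ->]]].
    have mA := bmeas_gt (n%:R * t) bdev.
    rewrite -[leLHS]fineK ?fin_num_measure // lee_fin -Rint_indic //.
    rewrite -(ler_pM2l nt0) -(RintZ P1); last exact: bmeas_indic.
    have -> : n%:R * t * (2 * rho / t) = n%:R * (2 * rho).
      by field; rewrite gt_eqF.
    apply: le_trans Edev; apply: (le_Rint P1) => //.
      by apply: bmeasZ; exact: bmeas_indic.
    move=> w; rewrite indicE; case: (boolP (w \in _)) => [|_].
      by rewrite inE /= mulr1 => /ltW.
    by rewrite mulr0; exact: bigmax_ge_id.
  have := deviation_tail_RV iid b0 mH' H'b H's2 l0 l4 nt0 Edev.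
  congr (_ <= (expR _)%:E)%E; ring.
have [E mE EH] := class_deviation (Q := Q) iid sep mG QG (ltW b0) (ltW nt0) B0 Hsb fin.
exists E => // w Ew h Hh; have := EH w Ew h Hh.
have -> : \sum_(i < n) (h (Z i w) - \int[Q]_z h z) =
    \sum_(i < n) h (Z i w) - n%:R * \int[Q]_z h z.
  by rewrite sumrB sumr_const card_ord mulr_natl.
move=> Ht.
rewrite -(ler_pM2l n0) -[X in X * `|_|](gtr0_norm n0) -normrM.
by rewrite mulrBr mulVKf ?gt_eqF.
Qed.

Let inGO := sample_in iid mG QG.

Let restrict_Rint (Y : Omega -> R) (GO : set Omega) :
  bmeas Y -> measurable GO -> P (~` GO) = 0%E ->
  \int[P]_w Y w = \int[P]_w (Y w * \1_GO w).
Proof.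
move=> bY mGO GO0; apply: (ae_eq_Rint _ _ mGO GO0).
- by case: bY.
- by have [] := bmeasM bY (bmeas_indic (R := R) mGO).
by move=> w Gw; rewrite indicE Gw mulr1.
Qed.

Lemma radn_le_rademacher (Hs : set (T -> R)) (b rho : R) : 0 <= b ->
  (forall h, Hs h -> measurable_fun setT h /\ forall z, G z -> `|h z| <= b) ->
  (rademacher Z Hs <= rho%:E)%E ->
  forall k (H : 'I_k.+1 -> T -> R), (forall j, Hs (H j)) ->
    \sum_e \int[P]_w radn Z (fun j => restr (H j)) e w <= 2 ^+ n * (n%:R * rho).
Proof.
move=> b0 Hsb Hrho k H HH; have [GO [mGO GO0] GOin] := inGO.
have brad e : bmeas (radn Z (fun j => restr (H j)) e).
  have mH j : measurable_fun setT (restr (H j)).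
    by apply: measurable_restr; have [] := Hsb _ (HH j).
  have Hb j z : `|restr (H j) z| <= b.
    by apply: restr_norm => //; have [] := Hsb _ (HH j).
  exact: (bmeas_radn Z mH Hb e).
under eq_bigr => e _ do rewrite (restrict_Rint (brad e) mGO GO0).
apply: (le_rademacher n_gt0 Hrho).
- by move=> e; apply: bmeasM => //; exact: bmeas_indic.
- by move=> e w; rewrite mulr_ge0 // bigmax_ge_id.
move=> e w; have [Gw|nGw] := pselect (GO w); last first.
  by exists (H ord0) => //; rewrite indicE memNset // mulr0.
have [j Hj] := bigmax_attained ord0 (fun j => normr_ge0
  (\sum_(i < n) (-1) ^+ e i * restr (H j) (Z i w))).
exists (H j) => //; rewrite indicE mem_set // mulr1; apply: le_trans Hj _.
rewrite le_eqVlt; apply/orP; left; apply/eqP; congr `|_|.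
by apply: eq_bigr => i _; rewrite restrE //; exact: GOin.
Qed.

(** Contraction is applied for each outcome in GO, where all tuples lie in G and the Lipschitz bound
    holds; elsewhere the integrand is 0. *)
Lemma radn_contraction (I : Type) (D : set I) (h u : I -> T -> R) (f0 : I)
    (V : set (T -> R))    (b L rho : R) : 0 <= b -> 0 <= L -> D f0 ->
  (forall z, h f0 z = 0) -> (forall z, u f0 z = 0) ->
  (forall f, D f -> measurable_fun setT (h f) /\ forall z, G z -> `|h f z| <= b) ->
  (forall f, D f -> bmeas (u f)) -> (forall f, D f -> V (u f)) ->
  (forall f f' z, D f -> D f' -> G z ->
     `|h f z - h f' z| <= L * `|u f z - u f' z|) ->
  (rademacher Z V <= rho%:E)%E ->
  forall k (H : 'I_k.+1 -> T -> R), (forall j, [set h f | f in D] (H j)) ->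
    \sum_e \int[P]_w radn Z (fun j => restr (H j)) e w <=
    2 ^+ n * (n%:R * (2 * L * rho)).
Proof.
move=> b0 L0 Df0 h0 u0 hb bu uV hu Hrho k H HH.
have [GO [mGO GO0] GOin] := inGO.
have Hb j : measurable_fun setT (H j) /\ forall z, G z -> `|H j z| <= b.
  by have [f Df <-] := HH j; exact: hb.
have brad e : bmeas (radn Z (fun j => restr (H j)) e).
  have mH j : measurable_fun setT (restr (H j)).
    by apply: measurable_restr; have [] := Hb j.
  have Hrb j z : `|restr (H j) z| <= b.
    by apply: restr_norm => //; have [] := Hb j.
  exact: (bmeas_radn Z mH Hrb e).
under eq_bigr => e _ do rewrite (restrict_Rint (brad e) mGO GO0).
have ex j : exists f, D f /\ h f = H j by have [f Df <-] := HH j; exists f.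
have [ff ffP] := choice ex.
(* [None] adjoins f0, the zero element that [contraction_abs] needs among the indices. *)
pose f' (j : option 'I_k.+1) := if j is Some j' then ff j' else f0.
have Df' j : D (f' j) by case: j => //= j; have [] := ffP j.
pose Y (e : {ffun 'I_n -> bool}) w : R := \big[Num.max/0]_(j : option 'I_k.+1)
  `|\sum_(i < n) (-1) ^+ e i * u (f' j) (Z i w)|.
have bY e : bmeas (Y e).
  apply: bmeas_bigmax => j; apply: bmeas_norm; apply: bmeas_sum => i.
  apply: bmeasZ; apply: bmeas_comp; last exact: bu.
  exact: measurable_funPT.
have YR : \sum_e \int[P]_w Y e w <= 2 ^+ n * (n%:R * rho).
  apply: (le_rademacher n_gt0 Hrho) => //.
    by move=> e w; exact: bigmax_ge_id.
  move=> e w; have [j Hj] := bigmax_attained None (fun j => normr_ge0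
    (\sum_(i < n) (-1) ^+ e i * u (f' j) (Z i w))).
  by exists (u (f' j)) => //; exact: uV.
apply: (@le_trans _ _ (2 * L * \sum_e \int[P]_w Y e w)); last first.
  have L2 : 0 <= 2 * L by rewrite mulr_ge0.
  apply: le_trans (ler_wpM2l L2 YR) _.
  by rewrite le_eqVlt; apply/orP; left; apply/eqP; ring.
rewrite -!(Rint_sum P1) //; last by move=> e; apply: bmeasM => //; exact: bmeas_indic.
rewrite -(RintZ P1); last exact: bmeas_sum.
apply: (le_Rint P1).
- by apply: bmeas_sum => e; apply: bmeasM => //; exact: bmeas_indic.
- by apply: bmeasZ; exact: bmeas_sum.
move=> w; have [Gw|nGw] := pselect (GO w); last first.
  rewrite big1; last by move=> e _; rewrite indicE memNset // mulr0.
  by rewrite !mulr_ge0 // sumr_ge0 // => e _; exact: bigmax_ge_id.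
pose v i (j : option 'I_k.+1) := h (f' j) (Z i w).
pose uu i (j : option 'I_k.+1) := u (f' j) (Z i w).
have := @contraction_abs R n (option 'I_k.+1) None v uu L L0
  (fun i => h0 _) (fun i => u0 _).
move=> /(_ (fun i j j' => hu _ _ _ (Df' j) (Df' j') (GOin w i Gw))).
apply: le_trans; apply: ler_sum => e _; rewrite indicE mem_set // mulr1.
apply: bigmax_le => [|j _]; first exact: bigmax_ge_id.
apply: le_trans (le_bigmax 0 (fun j => `|signed_sum v e j|) (Some j)).
rewrite le_eqVlt; apply/orP; left; apply/eqP; congr `|_|.
apply: eq_bigr => i _; rewrite restrE; last exact: GOin.
by rewrite /v /=; have [_ ->] := ffP j.
Qed.

End class_events.

(** * Excess risk of the minimax estimator *)

Section geometry.
Context (R : realType) d d' (S : measurableType d) (A : measurableType d').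
Local Notation SA := (S * A)%type.
Variables (M : mdp R S A) (pi : R.-pker S ~> A) (mu : probability SA R).
Variables (F : set (SA -> R)) (proj : (SA -> R) -> SA -> R).
Local Notation gamma := (discount M).
Local Notation T := (bellman M pi).
Local Notation q := (qvalue M pi).
Local Notation beta := (fine (incompleteness M pi mu F)).
Local Notation K := (radius_factor M pi mu F).
Hypothesis HF : forall f, F f -> measurable_fun setT f /\ forall x, -1 <= f x <= 1.
Hypothesis Fq : F q.
Hypothesis beta_lt1 : (incompleteness M pi mu F < 1)%E.
Hypothesis projP : forall f, F f -> argmin F (fun g => sqnorm mu (g \- T f)) (proj f).

Let mu1 : mu setT = 1%E := probability_setT mu.

Lemma class_norm f x : F f -> `|f x| <= 1.
Proof. by move=> /HF[_ fx]; rewrite ler_norml fx. Qed.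

Lemma class_bmeas f : F f -> bmeas f.
Proof.
move=> Ff; apply: (bmeas_bound (B := 1)); first by have [] := HF Ff.
by move=> x; exact: class_norm.
Qed.

Lemma proj_in f : F f -> F (proj f).
Proof. by move=> /projP[]. Qed.

Lemma bellman_norm f x : F f -> `|T f x| <= 2.
Proof.
move=> Ff; rewrite /bellman -/(next_mean M pi f x).
have /andP[r0 r1] := mean_reward01 M x.
have nf : `|next_mean M pi f x| <= 1.
  apply: next_mean_norm; first exact: class_bmeas.
  by move=> y; exact: class_norm.
have g0 := discount_ge0 M; have g1 := discount_lt1 M.
apply: le_trans (ler_normD _ _) _.
rewrite (ger0_norm r0) normrM (ger0_norm g0).
have : gamma * `|next_mean M pi f x| <= 1.
  by rewrite mulr_ile1 // ltW.
by lra.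
Qed.

Definition excess (f : SA -> R) : R :=
  sqnorm mu (f \- T f) - sqnorm mu (proj f \- T f).

Let bT f : F f -> bmeas (T f).
Proof. by move=> Ff; apply: bmeas_bellman; exact: class_bmeas. Qed.

Let bres f g : F f -> F g -> bmeas (g \- T f).
Proof. by move=> Ff Fg; apply: bmeasB; [exact: class_bmeas|exact: bT]. Qed.

Lemma sqnorm_ge0 (m : {measure set SA -> \bar R}) f : 0 <= sqnorm m f.
Proof. by apply: Rintegral_ge0 => x _; exact: sqr_ge0. Qed.

Lemma excess_le9 f : F f -> excess f <= 9.
Proof.
move=> Ff; rewrite /excess lerBlDr; apply: (@le_trans _ _ 9); last first.
  by rewrite lerDl sqnorm_ge0.
rewrite -[leRHS](Rint_cst mu1); apply: (le_Rint mu1).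
- by apply: bmeasX; exact: bres.
- exact: bmeas_cst.
move=> x /=; have := bellman_norm x Ff; have := class_norm x Ff.
rewrite !ler_norml => /andP[? ?] /andP[? ?]; nra.
Qed.

Lemma proj_le f : F f -> sqnorm mu (proj f \- T f) <= sqnorm mu (f \- T f).
Proof. by move=> Ff; have [_] := projP Ff; apply. Qed.

Let eratio_ge0 (a b : R) : 0 <= a -> 0 <= b -> (0 <= eratio a b)%E.
Proof.
move=> a0 b0; rewrite /eratio; case: ifP => _; first by case: ifP.
by rewrite lee_fin divr_ge0.
Qed.

Lemma incompleteness_ge0 : (0 <= incompleteness M pi mu F)%E.
Proof.
apply: le_ereal_sup_tmp; exists (ereal_inf [set eratio (norm2 mu (g \- T q))
    (norm2 mu (q \- T q)) | g in F]); first by exists q.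
apply: le_ereal_inf_tmp => _ [g Fg <-].
by apply: eratio_ge0; exact: sqrtr_ge0.
Qed.

Let betaE : incompleteness M pi mu F = beta%:E.
Proof.
by rewrite fineK // ge0_fin_numE ?incompleteness_ge0 // (lt_trans beta_lt1) // ltry.
Qed.

Lemma beta_ge0 : 0 <= beta.
Proof. by rewrite fine_ge0 // incompleteness_ge0. Qed.

Lemma beta_lt1R : beta < 1.
Proof. by rewrite -lte_fin -betaE. Qed.

(** The projected backup minimizes the numerator, so its ratio is a lower bound for the infimum in
    [incompleteness]. *)
Lemma proj_contract f : F f ->
  sqnorm mu (proj f \- T f) <= beta ^+ 2 * sqnorm mu (f \- T f).
Proof.
move=> Ff; have D0 := sqnorm_ge0 mu (f \- T f).
have N0 := sqnorm_ge0 mu (proj f \- T f).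
(* If the residual of f vanishes, [eratio] is no quotient and minimality of the backup is used
   directly. *)
have [Dz|Dp] := eqVneq (sqnorm mu (f \- T f)) 0.
  by rewrite Dz mulr0 -Dz proj_le.
have Dgt0 : 0 < sqnorm mu (f \- T f) by rewrite lt_neqAle eq_sym Dp.
have sD : 0 < norm2 mu (f \- T f) by rewrite sqrtr_gt0.
have h : ((norm2 mu (proj f \- T f) / norm2 mu (f \- T f))%R%:E <= beta%:E)%E.
  rewrite -betaE; apply: le_ereal_sup_tmp.
  exists (ereal_inf [set eratio (norm2 mu (g \- T f)) (norm2 mu (f \- T f)) | g in F]).
    by exists f.
  apply: le_ereal_inf_tmp => _ [g Fg <-].
  rewrite /eratio gt_eqF // lee_fin ler_pM2r ?invr_gt0 // ler_wsqrtr //.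
  by have [_] := projP Ff; apply.
move: h; rewrite lee_fin ler_pdivrMr // => h.
rewrite -(sqr_sqrtr N0) -(sqr_sqrtr D0) -exprMn ler_sqr ?nnegrE ?sqrtr_ge0 //.
by rewrite mulr_ge0 ?sqrtr_ge0 // beta_ge0.
Qed.

Lemma residual_le f : F f -> (1 - beta) * sqnorm mu (f \- T f) <= excess f.
Proof.
move=> Ff; have := proj_contract Ff; rewrite /excess.
have D0 := sqnorm_ge0 mu (f \- T f); have b0 := beta_ge0; have b1 := beta_lt1R.
move: D0 b0 b1; set D := sqnorm _ (f \- _); set N := sqnorm _ _; set b := beta.
move=> D0 b0 b1; have : b ^+ 2 * D <= b * D by rewrite ler_wpM2r // expr2 ler_piMl // ltW.
by lra.
Qed.

Lemma radius_factor_ge1 : 1 <= K.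
Proof.
rewrite /radius_factor; case: ifP => // _; rewrite invf_ge1 ?subr_gt0 ?beta_lt1R //.
by rewrite gerBl beta_ge0.
Qed.

Let sqnormB f g : F f -> F g -> sqnorm mu (f \- g) =
  sqnorm mu (f \- T f) + sqnorm mu (g \- T f) -
  2 * \int[mu]_x ((f x - T f x) * (g x - T f x)).
Proof.
move=> Ff Fg; have bf := class_bmeas Ff; have bg := class_bmeas Fg.
have b1 := bres Ff Ff; have b2 := bres Ff Fg.
have b12 : bmeas (fun x => (f x - T f x) * (g x - T f x)) by exact: bmeasM.
rewrite /sqnorm -(RintZ mu1 _ b12) -(RintD mu1 (bmeasX 2 b1) (bmeasX 2 b2)).
rewrite -(RintB mu1 (bmeasD (bmeasX 2 b1) (bmeasX 2 b2)) (bmeasZ 2 b12)).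
by apply: eq_Rintegral => x _ /=; ring.
Qed.

(* If F is convex, |f - g_f|^2 <= excess f by the obtuse angle at the projection;
   otherwise |f - g_f|^2 <= 2 |f - T f|^2 + 2 |g_f - T f|^2. *)
Lemma proj_dist f : F f -> sqnorm mu (f \- proj f) <= 2 * K * excess f.
Proof.
move=> Ff; have Fg := proj_in Ff.
have bf := class_bmeas Ff; have bg := class_bmeas Fg.
have b1 := bres Ff Ff; have b2 := bres Ff Fg.
have b12 : bmeas (fun x => (f x - T f x) * (proj f x - T f x)) by exact: bmeasM.
rewrite (sqnormB Ff Fg) /excess; set I := Rintegral _ _ _.
have comb (a c : R) : \int[mu]_x (a * (f x - T f x) + c * (proj f x - T f x)) ^+ 2 =
    a ^+ 2 * sqnorm mu (f \- T f) + c ^+ 2 * sqnorm mu (proj f \- T f) + 2 * a * c * I.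
  rewrite /sqnorm -(RintZ mu1 _ (bmeasX 2 b1)) -(RintZ mu1 _ (bmeasX 2 b2)).
  rewrite -(RintZ mu1 _ b12).
  rewrite -(RintD mu1 (bmeasZ _ (bmeasX 2 b1)) (bmeasZ _ (bmeasX 2 b2))).
  rewrite -(RintD mu1 (bmeasD (bmeasZ _ (bmeasX 2 b1)) (bmeasZ _ (bmeasX 2 b2)))
    (bmeasZ _ b12)).
  by apply: eq_Rintegral => x _ /=; ring.
have NbD := proj_contract Ff; have ND := proj_le Ff.
have D0 := sqnorm_ge0 mu (f \- T f); have N0 := sqnorm_ge0 mu (proj f \- T f).
move: comb NbD ND D0 N0; rewrite /radius_factor.
set D := sqnorm mu (f \- _); set N := sqnorm mu (proj f \- _).
move=> comb NbD ND D0 N0; case: ifPn => [/asboolP cF|_]; last first.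
  have b0 := beta_ge0; have b1' := beta_lt1R.
  have g1 : 0 < 1 - beta by rewrite subr_gt0.
  rewrite mulrAC ler_pdivlMr //.
  have : 0 <= 1 ^+ 2 * D + 1 ^+ 2 * N + 2 * 1 * 1 * I.
    by rewrite -comb; apply: Rintegral_ge0 => x _; exact: sqr_ge0.
  move: NbD b0 b1' g1; set b := beta => NbD b0 b1' g1 cr.
  (* Equivalent to (D + N) (1 - b) <= D - N, which is what the bound 2 D + 2 N on the distance
     requires; it follows from N <= b^2 D and b (2 - b) <= 1. *)
  have h1 : N * (2 - b) <= b * D.
    apply: (@le_trans _ _ (b ^+ 2 * D * (2 - b))); first by rewrite ler_wpM2r //; lra.
    have -> : b ^+ 2 * D * (2 - b) = b * D - b * D * (1 - b) ^+ 2 by ring.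
    by rewrite gerBl (mulr_ge0 (mulr_ge0 b0 D0) (sqr_ge0 _)).
  by nra.
suff NI : N <= I by lra.
apply/ler_addgt0Pr => eps eps0.
(* First-order optimality on the segment from the backup to f: minimality at parameter t gives 2 (N
   - I) <= t (D + N - 2 I), and a small t makes the right side at most eps. *)
pose t := Num.min 1 (eps / (`|D + N - 2 * I| + 1)).
have c0 : 0 < `|D + N - 2 * I| + 1 by rewrite ltr_wpDl.
have t0 : 0 < t by rewrite lt_min ltr01 divr_gt0.
have t1 : t <= 1 by rewrite ge_min lexx.
have teps : t * (`|D + N - 2 * I| + 1) <= eps.
  by rewrite -ler_pdivlMr // ge_min lexx orbT.
have Fh : F (fun x => t * f x + (1 - t) * proj f x).
  have := cF f (proj f) (Itv01 (ltW t0) t1).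
  by rewrite !inE => /(_ Ff Fg).
have [_ /(_ _ Fh)] := projP Ff.
have -> : sqnorm mu ((fun x => t * f x + (1 - t) * proj f x) \- T f) =
    t ^+ 2 * D + (1 - t) ^+ 2 * N + 2 * t * (1 - t) * I.
  by rewrite -comb; apply: eq_Rintegral => x _ /=; congr (_ ^+ 2); ring.
rewrite -/N => hN.
have : 0 <= t * (t * (D + N - 2 * I) - 2 * (N - I)) by lra.
rewrite pmulr_rge0 // => h2.
have := ler_norm (D + N - 2 * I); rewrite -(ler_pM2l t0) => h3.
by move: teps; rewrite mulrDr mulr1; lra.
Qed.

End geometry.

Lemma events_cap {R : realType} d (Omega : measurableType d)
    (P : probability Omega R) (E1 E2 : set Omega) (a b : R) :
  measurable E1 -> measurable E2 ->
  ((1 - a)%:E <= P E1)%E -> ((1 - b)%:E <= P E2)%E ->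
  ((1 - (a + b))%:E <= P (E1 `&` E2))%E.
Proof.
move=> m1 m2 h1 h2.
have cE E : measurable E -> P (~` E) = (1 - fine (P E))%:E.
  by move=> mE; rewrite probability_setC // EFinB fineK // fin_num_measure.
have mI : measurable (E1 `&` E2) by exact: measurableI.
have fE E : measurable E -> P E = (fine (P E))%:E.
  by move=> mE; rewrite fineK // fin_num_measure.
have : (P (~` (E1 `&` E2)) <= P (~` E1) + P (~` E2))%E.
  by rewrite setCI; apply: measureU2; exact: measurableC.
rewrite !cE // (fE _ mI) -EFinD !lee_fin.
move: h1 h2; rewrite (fE _ m1) (fE _ m2) !lee_fin; lra.
Qed.

Lemma events_forall {R : realType} d (Omega : measurableType d)
    (P : probability Omega R) (N : nat) (p : nat -> R)
    (good : nat -> Omega -> Prop) :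
  (forall k, (k < N)%N -> exists2 E : set Omega,
     measurable E /\ ((1 - p k)%:E <= P E)%E & forall w, E w -> good k w) ->
  exists2 E : set Omega,
    measurable E /\ ((1 - \sum_(k < N) p k)%:E <= P E)%E &
    forall w, E w -> forall k, (k < N)%N -> good k w.
Proof.
elim: N => [|N IH] H.
  exists setT; last by [].
  by split; [exact: measurableT|rewrite big_ord0 subr0 probability_setT].
have [k kN|E [mE PE] EH] := IH; first by apply: H; exact: ltnW.
have [E' [mE' PE'] EH'] := H N (ltnSn N).
exists (E `&` E').
  by split; [exact: measurableI|rewrite big_ord_recr /=; exact: events_cap].
move=> w [Ew E'w] k; rewrite ltnS leq_eqVlt => /predU1P[->|]; first exact: EH'.
exact: EH.
Qed.

(** * Deviation events at a single radius *)

Section events.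
Context (R : realType) dS dA (S : measurableType dS) (A : measurableType dA).
Local Notation SA := (S * A)%type.
Local Notation obs := (SA * (R * S))%type.
Variables (M : mdp R S A) (pi : R.-pker S ~> A) (mu : probability SA R).
Variables (F : set (SA -> R)) (proj : (SA -> R) -> SA -> R).
Context (n : nat) dO (Omega : measurableType dO) (P : probability Omega R).
Variable Z : 'I_n -> {RV P >-> obs}.
Local Notation gamma := (discount M).
Local Notation T := (bellman M pi).
Local Notation q := (qvalue M pi).
Local Notation beta := (fine (incompleteness M pi mu F)).
Local Notation K := (radius_factor M pi mu F).
Local Notation Q := (data_law M mu).
Local Notation excess := (excess M pi mu proj).
Hypothesis n_gt0 : (0 < n)%N.
Hypothesis HF : forall f, F f -> measurable_fun setT f /\ forall x, -1 <= f x <= 1.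
Hypothesis Fq : F q.
Hypothesis beta_lt1 : (incompleteness M pi mu F < 1)%E.
Hypothesis projP : forall f, F f -> argmin F (fun g => sqnorm mu (g \- T f)) (proj f).
Hypothesis iid : iid_sample Q Z.
Hypothesis sep : forall t, 0 < t ->
  [/\ separable_process Q Z (gap_class M pi mu F proj t),
      separable_process Q Z (centered_class M pi mu F t) &
      separable_process Q Z (regression_class M pi mu F t)].

Let mu1 : mu setT = 1%E := probability_setT mu.
Let Q1 : Q setT = 1%E := probability_setT Q.
Local Notation G := (@rewarded R _ _ S A).

Let bF f : F f -> bmeas f := @class_bmeas _ _ _ _ _ _ HF f.

(** The second factor in [loss_gapE] is at most 1 + 1 + 2 (1 + 1) = 6. With |f - g| <= 2 this yields
    the uniform bound 12 below, and its square yields the 36 in the variance bounds. *)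
Let lip (f g h : SA -> R) z : F f -> F g -> F h -> G z ->
  `|loss M pi f h z - loss M pi g h z| <= 6 * `|f z.1 - g z.1|.
Proof.
move=> Ff Fg Fh /andP[r0 r1]; rewrite loss_gapE normrM mulrC ler_wpM2r //.
have pm : `|policy_mean pi h z.2.2| <= 1.
  by apply: policy_mean_norm; [exact: bF|move=> x; exact: (class_norm HF)].
have gpm : `|gamma * policy_mean pi h z.2.2| <= 1.
  rewrite normrM (ger0_norm (discount_ge0 M)) mulr_ile1 ?discount_ge0 //.
  exact/ltW/discount_lt1.
have := class_norm HF z.1 Ff; have := class_norm HF z.1 Fg; move: gpm.
rewrite !ler_norml => /andP[? ?] /andP[? ?] /andP[? ?].
by apply/andP; split; lra.
Qed.

Let lip12 (f g h : SA -> R) z : F f -> F g -> F h -> G z ->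
  `|loss M pi f h z - loss M pi g h z| <= 12.
Proof.
move=> Ff Fg Fh Gz; apply: le_trans (lip Ff Fg Fh Gz) _.
have := ler_normB (f z.1) (g z.1).
have := class_norm HF z.1 Ff; have := class_norm HF z.1 Fg; lra.
Qed.

Let gap_var (f g h : SA -> R) (u : obs -> R) : F f -> F g -> F h ->
  measurable_fun setT u ->
  (forall z, u z = loss M pi f h z - loss M pi g h z) ->
  \int[Q]_z (restr G u z) ^+ 2 <= 36 * sqnorm mu (f \- g).
Proof.
move=> Ff Fg Fh mu_ uE.
have bfg : bmeas (fun x => (f x - g x) ^+ 2).
  by apply: bmeasX; apply: bmeasB; exact: bF.
rewrite /sqnorm -(Rint_data_sa M mu bfg) -(RintZ Q1); last first.
  exact: (bmeas_comp measurable_fst bfg).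
have u12 z : G z -> `|u z| <= 12 by move=> Gz; rewrite uE; exact: lip12.
apply: (le_Rint Q1).
- apply: bmeasX; apply: (bmeas_bound (B := 12)).
    exact: (measurable_restr (@measurable_rewarded _ _ _ _ _)).
  by move=> z; exact: restr_norm.
- by apply: bmeasZ; exact: (bmeas_comp measurable_fst bfg).
move=> z; have [Gz|nGz] := pselect (G z); last first.
  by rewrite /restr indicE memNset // mulr0 expr0n mulr_ge0 // sqr_ge0.
rewrite restrE // uE -real_normK ?num_real //.
have -> : 36 * (f z.1 - g z.1) ^+ 2 = (6 * `|f z.1 - g z.1|) ^+ 2.
  by rewrite exprMn real_normK ?num_real //; ring.
by rewrite ler_sqr ?nnegrE ?mulr_ge0 //; exact: lip.
Qed.

(** The variance 144 K r^2 is 36 times the bound 2 K (2 r^2) on |f - g_f|^2 from [proj_dist]: this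
    is where K enters. *)
Lemma gap_event (r rho : R) : 0 < r -> 0 <= rho ->
  (rademacher Z (gap_class M pi mu F proj (2 * r ^+ 2)) <= rho%:E)%E ->
  forall t B, 0 < t ->
    (B = 2 * rho / t \/ exists l, [/\ 0 < l, l <= 4^-1 &
      B = expR (n%:R * (l / 12 * (2 * rho - t / 2) +
            l ^+ 2 / (2 * 12 ^+ 2) * (144 * K * r ^+ 2)))]) ->
  exists2 E : set Omega, measurable E /\ ((1 - B)%:E <= P E)%E &
    forall w, E w -> forall f, F f -> excess f <= 2 * r ^+ 2 ->
      `|n%:R^-1 * \sum_(i < n) loss_gap M pi (proj f) f (Z i w) - excess f| <= t.
Proof.
move=> r0 rho0 Hrho t B t0 HB.
have r2 : 0 < 2 * r ^+ 2 by rewrite mulr_gt0 // exprn_gt0.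
have [sepg _ _] := sep r2.
have exE f : F f -> \int[Q]_z loss_gap M pi (proj f) f z = excess f.
  by move=> Ff; rewrite gap_mean //; apply: bF => //; exact: (proj_in projP).
have bnd h : gap_class M pi mu F proj (2 * r ^+ 2) h ->
    measurable_fun setT h /\ forall z, G z -> `|h z| <= 12.
  move=> [f [Ff _] <-]; have Fg := proj_in projP Ff; split.
    by apply: measurable_loss_gap; exact: bF.
  by move=> z Gz; exact: lip12.
have [|||E mE EH] := class_events iid n_gt0 (@measurable_rewarded _ _ _ _ _)
  (data_rewarded M mu) sepg (b := 12) (s2 := 144 * K * r ^+ 2) _ rho0 bnd _ _ t0 HB.
- by [].
- move=> h [f [Ff ef] <-]; have Fg := proj_in projP Ff.
  apply: le_trans (gap_var (f := f) (g := proj f) (h := f) _ _ _ _ _) _ => //.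
    by apply: measurable_loss_gap; exact: bF.
  have := proj_dist HF Fq beta_lt1 projP Ff.
  have K1 := radius_factor_ge1 Fq beta_lt1.
  rewrite exE // in ef.
  have : 2 * K * excess f <= 2 * K * (2 * r ^+ 2) by rewrite ler_wpM2l //; lra.
  by lra.
- exact: (radn_le_rademacher iid n_gt0 (@measurable_rewarded _ _ _ _ _) (data_rewarded M mu) (b := 12)).
exists E => // w Ew f Ff ef; rewrite -exE //; apply: EH => //.
by exists f => //; split => //; rewrite exE.
Qed.

Let bq : bmeas q. Proof. exact: bF. Qed.
Let Tq x : T q x = q x. Proof. exact: bellman_qvalue. Qed.

Lemma regression_mean f : F f ->
  \int[Q]_z loss_gap M pi f q z = - sqnorm mu (f \- q).
Proof.
move=> Ff; rewrite gap_mean //; last exact: bF.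
have -> : T q = q by apply/funext.
have -> : sqnorm mu (q \- q) = 0; last by rewrite sub0r.
rewrite -[RHS](Rint_cst mu1); apply: eq_Rintegral => x _ /=.
by rewrite subrr expr0n.
Qed.

Lemma regression_event (r rho : R) : 0 < r -> 0 <= rho ->
  (rademacher Z (centered_class M pi mu F (K * r)) <= rho%:E)%E ->
  forall t B, 0 < t ->
    (B = 2 * (12 * rho) / t \/ exists l, [/\ 0 < l, l <= 4^-1 &
      B = expR (n%:R * (l / 12 * (2 * (12 * rho) - t / 2) +
            l ^+ 2 / (2 * 12 ^+ 2) * (36 * r ^+ 2)))]) ->
  exists2 E : set Omega, measurable E /\ ((1 - B)%:E <= P E)%E &
    forall w, E w -> forall f, F f -> sqnorm mu (f \- q) <= r ^+ 2 ->
      `|n%:R^-1 * \sum_(i < n) loss_gap M pi f q (Z i w) + sqnorm mu (f \- q)| <= t.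
Proof.
move=> r0 rho0 Hrho t B t0 HB.
have [_ _ sepr] := sep r0.
have norm_sq f : (norm2 mu (f \- q) <= r) = (sqnorm mu (f \- q) <= r ^+ 2).
  rewrite /norm2 -[r in LHS](ger0_norm (ltW r0)) -sqrtr_sqr ler_sqrt //.
  by rewrite sqr_ge0.
pose D := [set f | F f /\ norm2 mu (f \- q) <= r].
have K1 := radius_factor_ge1 Fq beta_lt1.
have bnd h : regression_class M pi mu F r h ->
    measurable_fun setT h /\ forall z, G z -> `|h z| <= 12.
  move=> [f [Ff _] <-]; split; first by apply: measurable_loss_gap => //; exact: bF.
  by move=> z Gz; exact: lip12.
have Dq : D q.
  split => //; rewrite norm_sq.
  have -> : sqnorm mu (q \- q) = 0; last exact: sqr_ge0.
  rewrite -[RHS](Rint_cst mu1); apply: eq_Rintegral => x _ /=.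
  by rewrite subrr expr0n.
have [||||E mE EH] := class_events iid n_gt0 (@measurable_rewarded _ _ _ _ _)
  (data_rewarded M mu) sepr (b := 12) (s2 := 36 * r ^+ 2) (rho := 12 * rho)
  _ _ bnd _ _ t0 HB.
- by [].
- by rewrite mulr_ge0.
- move=> h [f [Ff ef] <-].
  apply: le_trans (gap_var (f := q) (g := f) (h := q) _ _ _ _ _) _ => //.
    by apply: measurable_loss_gap => //; exact: bF.
  rewrite ler_wpM2l //; move: ef; rewrite norm_sq; apply: le_trans.
  rewrite le_eqVlt; apply/orP; left; apply/eqP; apply: eq_Rintegral => x _ /=.
  by ring.
(* The factor 2 of contraction times the Lipschitz constant 6 of the loss. *)
- have -> : 12 * rho = 2 * 6 * rho by ring.
  apply: (@radn_contraction R _ _ _ _ _ _ _ _ iid n_gt0 _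
    (@measurable_rewarded _ _ _ _ _) (data_rewarded M mu) _ D
    (fun f => loss_gap M pi f q) (fun f (z : obs) => f z.1 - q z.1) q _ 12) Hrho => //.
  + by move=> z; rewrite /loss_gap subrr.
  + by move=> z; rewrite subrr.
  + by move=> f [Ff fr]; apply: bnd; exists f.
  + move=> f [Ff _]; apply: (bmeas_comp (phi := fst) measurable_fst (f := fun x => f x - q x)).
    by apply: bmeasB => //; exact: bF.
  (* As K >= 1, the class centered at q with radius r lies in the one with radius K r. *)
  + move=> f [Ff fr]; exists f => //; split => //; apply: le_trans fr _.
    by rewrite ler_peMl // ltW.
  + move=> f f' z [Ff _] [Ff' _] Gz; rewrite /loss_gap.
    have -> : loss M pi q q z - loss M pi f q z - (loss M pi q q z - loss M pi f' q z)
      = loss M pi f' q z - loss M pi f q z by ring.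
    have -> : f z.1 - q z.1 - (f' z.1 - q z.1) = f z.1 - f' z.1 by ring.
    by rewrite distrC; exact: lip.
exists E => // w Ew f Ff fr; rewrite -[X in _ + X]opprK -regression_mean //.
by apply: EH => //; exists f => //; split => //; rewrite norm_sq.
Qed.

Let K1 : 1 <= K := radius_factor_ge1 Fq beta_lt1.

Let weaken (B B' : R) (good : Omega -> Prop) : B <= B' ->
  (exists2 E : set Omega, measurable E /\ ((1 - B)%:E <= P E)%E &
     forall w, E w -> good w) ->
  exists2 E : set Omega, measurable E /\ ((1 - B')%:E <= P E)%E &
     forall w, E w -> good w.
Proof.
move=> BB' [E [mE PE] EH]; exists E => //; split => //.
by apply: le_trans PE; rewrite lee_fin lerD2l lerN2.
Qed.

(** A failure probability common to both events; 9 * 2^11 = 2 * 96^2 = 8 * 48^2 comes from the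
    choices l = 1 / (96 K) and l = 1 / 48. *)
Definition shell_bound (r : R) : R := expR (- (n%:R * r ^+ 2 / (9 * 2 ^+ 11 * K))).

Lemma gap_event_exp (r : R) : 0 < r ->
  (rademacher Z (gap_class M pi mu F proj (2 * r ^+ 2)) <= ((2 ^+ 11)^-1 * r ^+ 2)%:E)%E ->
  exists2 E : set Omega, measurable E /\ ((1 - shell_bound r)%:E <= P E)%E &
    forall w, E w -> forall f, F f -> excess f <= 2 * r ^+ 2 ->
      `|n%:R^-1 * \sum_(i < n) loss_gap M pi (proj f) f (Z i w) - excess f|
        <= r ^+ 2 / 2.
Proof.
move=> r0 Hr; have r20 : 0 < r ^+ 2 by rewrite exprn_gt0.
have K0 : 0 < K by exact: lt_le_trans K1.
have rho0 : 0 <= (2 ^+ 11)^-1 * r ^+ 2.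
  by rewrite mulr_ge0 ?invr_ge0 ?exprn_ge0 // ltW.
have t0 : 0 < r ^+ 2 / 2 by rewrite divr_gt0.
(* [l = (96 * K)^-1] balances the two terms of the exponent. *)
have l0 : 0 < (96 * K)^-1 by rewrite invr_gt0 mulr_gt0.
have l4 : (96 * K)^-1 <= 4^-1.
  by rewrite lef_pV2 ?posrE ?mulr_gt0 //; move: K1; lra.
have ev := gap_event r0 rho0 Hr t0 (or_intror (ex_intro _ _ (And3 l0 l4 erefl))).
apply: weaken ev; rewrite /shell_bound ler_expR.
have -> : - (n%:R * r ^+ 2 / (9 * 2 ^+ 11 * K)) = n%:R * (- (r ^+ 2 / (9 * 2 ^+ 11 * K))) by ring.
rewrite ler_wpM2l //.
have -> : (96 * K)^-1 / 12 * (2 * ((2 ^+ 11)^-1 * r ^+ 2) - r ^+ 2 / 2 / 2) +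
    (96 * K)^-1 ^+ 2 / (2 * 12 ^+ 2) * (144 * K * r ^+ 2) =
    (r ^+ 2 / K) * (1 / (96 * 12) * (1 / 2 ^+ 10 - 1 / 4) + 1 / (9 * 2 ^+ 11)).
  by field; rewrite gt_eqF.
have -> : - (r ^+ 2 / (9 * 2 ^+ 11 * K)) = (r ^+ 2 / K) * - (1 / (9 * 2 ^+ 11)).
  by field; rewrite gt_eqF.
by rewrite ler_wpM2l ?divr_ge0 ?(ltW r20) ?(ltW K0) //; lra.
Qed.

Lemma regression_event_exp (r : R) : 0 < r ->
  (rademacher Z (centered_class M pi mu F (K * r)) <= ((2 ^+ 16)^-1 * r ^+ 2)%:E)%E ->
  exists2 E : set Omega, measurable E /\ ((1 - shell_bound r)%:E <= P E)%E &
    forall w, E w -> forall f, F f -> sqnorm mu (f \- q) <= r ^+ 2 ->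
      `|n%:R^-1 * \sum_(i < n) loss_gap M pi f q (Z i w) + sqnorm mu (f \- q)|
        <= r ^+ 2 / 4.
Proof.
move=> r0 Hr; have r20 : 0 < r ^+ 2 by rewrite exprn_gt0.
have K0 : 0 < K by exact: lt_le_trans K1.
have rho0 : 0 <= (2 ^+ 16)^-1 * r ^+ 2.
  by rewrite mulr_ge0 ?invr_ge0 ?exprn_ge0 // ltW.
have t0 : 0 < r ^+ 2 / 4 by rewrite divr_gt0.
(* With l = 1 / 48 the quadratic term of the exponent is r^2 / (9 * 2^11), a quarter of the negative
   linear term, and the Rademacher term is far smaller. *)
have l0 : 0 < 48^-1 :> R by rewrite invr_gt0.
have l4 : 48^-1 <= 4^-1 :> R by rewrite lef_pV2 ?posrE //; lra.
have ev := regression_event r0 rho0 Hr t0 (or_intror (ex_intro _ _ (And3 l0 l4 erefl))).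
apply: weaken ev; rewrite /shell_bound ler_expR.
have -> : - (n%:R * r ^+ 2 / (9 * 2 ^+ 11 * K)) = n%:R * (- (r ^+ 2 / (9 * 2 ^+ 11 * K))) by ring.
rewrite ler_wpM2l //.
have -> : 48^-1 / 12 * (2 * (12 * ((2 ^+ 16)^-1 * r ^+ 2)) - r ^+ 2 / 4 / 2) +
    48^-1 ^+ 2 / (2 * 12 ^+ 2) * (36 * r ^+ 2) =
    r ^+ 2 * (1 / (48 * 12) * (24 / 2 ^+ 16 - 1 / 8) + 1 / (9 * 2 ^+ 11)) by field.
apply: (@le_trans _ _ (r ^+ 2 * - (1 / (9 * 2 ^+ 11)))).
  by rewrite ler_wpM2l ?(ltW r20) //; lra.
(* The variance of the regression class has no factor K; since K >= 1, the bound weakens to the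
   common form. *)
have -> : - (r ^+ 2 / (9 * 2 ^+ 11 * K)) = r ^+ 2 * - (1 / (9 * 2 ^+ 11) / K).
  by field; rewrite gt_eqF.
rewrite ler_wpM2l ?(ltW r20) // lerN2 ler_pdivrMr //.
by rewrite ler_peMr // divr_ge0.
Qed.

Definition good_sample (rc : R) (w : Omega) : Prop :=
  (forall f, F f -> rc ^+ 2 < excess f ->
     rc ^+ 2 / 2 <= n%:R^-1 * \sum_(i < n) loss_gap M pi (proj f) f (Z i w)) /\
  (forall f, F f ->
     n%:R^-1 * \sum_(i < n) loss_gap M pi f q (Z i w) <= rc ^+ 2 / 4).

(** The empirical gap of fh is at most its objective value, since the inner minimum also runs over
    its backup. By minimality this value is at most the one at q, hence at most rc^2 / 4, below the
    rc^2 / 2 that a large excess would force. *)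
Lemma good_sample_excess (rc : R) w fh : 0 < rc -> good_sample rc w ->
  (forall f, F f -> argmin F (emp_loss M pi (fun i => Z i w) ^~ f) !=set0) ->
  argmin F (emp_minimax M pi F (fun i => Z i w)) fh ->
  excess fh <= rc ^+ 2.
Proof.
move=> rc0 [good1 good2] emin [Ffh fhmin].
have r20 : 0 < rc ^+ 2 by rewrite exprn_gt0.
rewrite leNgt; apply/negP => big.
have gapE g f : n%:R^-1 * \sum_(i < n) loss_gap M pi g f (Z i w) =
    emp_loss M pi (fun i => Z i w) f f - emp_loss M pi (fun i => Z i w) g f.
  by rewrite /emp_loss -mulrBr -sumrB.
have loss0 g f : 0 <= emp_loss M pi (fun i => Z i w) g f.
  by rewrite mulr_ge0 ?invr_ge0 // sumr_ge0 // => i _; exact: sqr_ge0.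
have h1 := good1 fh Ffh big; rewrite gapE in h1.
have [g0 [Fg0 g0min]] := emin q Fq.
have h2 := good2 g0 Fg0; rewrite gapE in h2.
have h3 := fhmin q Fq; rewrite /emp_minimax in h3.
have i1 : inf [set emp_loss M pi (fun i => Z i w) g fh | g in F] <=
    emp_loss M pi (fun i => Z i w) (proj fh) fh.
  apply: ge_inf; first by exists 0 => _ [g _ <-].
  by exists (proj fh) => //; exact: (proj_in projP).
have i2 : emp_loss M pi (fun i => Z i w) g0 q <=
    inf [set emp_loss M pi (fun i => Z i w) g q | g in F].
  apply: lb_le_inf; first by exists (emp_loss M pi (fun i => Z i w) g0 q), g0.
  by move=> _ [g Fg <-]; exact: g0min.
lra.
Qed.

End events.

Lemma dyadic_shell {R : realType} (N : nat) (a e : R) :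
  a < e -> e <= 2 ^+ N * a ->
  exists2 k, (k < N)%N & 2 ^+ k * a < e /\ e <= 2 ^+ k.+1 * a.
Proof.
move=> ae; elim: N => [|N IH]; first by rewrite expr0 mul1r leNgt ae.
move=> eN; have [le|lt] := leP e (2 ^+ N * a); last by exists N.
by have [k kN ke] := IH le; exists k => //; exact: leq_trans kN _.
Qed.

(** * Union over the shells *)

Section good_event.
Context (R : realType) dS dA (S : measurableType dS) (A : measurableType dA).
Local Notation SA := (S * A)%type.
Local Notation obs := (SA * (R * S))%type.
Variables (M : mdp R S A) (pi : R.-pker S ~> A) (mu : probability SA R).
Variables (F : set (SA -> R)) (proj : (SA -> R) -> SA -> R).
Context (n : nat) dO (Omega : measurableType dO) (P : probability Omega R).
Variable Z : 'I_n -> {RV P >-> obs}.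
Local Notation T := (bellman M pi).
Local Notation q := (qvalue M pi).
Local Notation K := (radius_factor M pi mu F).
Local Notation Q := (data_law M mu).
Local Notation excess := (excess M pi mu proj).
Local Notation shell_bound := (shell_bound M pi mu F n).
Local Notation good_sample := (good_sample M pi mu F proj Z).
Hypothesis n_gt0 : (0 < n)%N.
Hypothesis HF : forall f, F f -> measurable_fun setT f /\ forall x, -1 <= f x <= 1.
Hypothesis Fq : F q.
Hypothesis beta_lt1 : (incompleteness M pi mu F < 1)%E.
Hypothesis projP : forall f, F f -> argmin F (fun g => sqnorm mu (g \- T f)) (proj f).
Hypothesis iid : iid_sample Q Z.
Hypothesis sep : forall t, 0 < t ->
  [/\ separable_process Q Z (gap_class M pi mu F proj t),
      separable_process Q Z (centered_class M pi mu F t) &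
      separable_process Q Z (regression_class M pi mu F t)].
Variables (delta rc : R).
Hypothesis delta01 : 0 < delta < 1.
Hypothesis rc_gt0 : 0 < rc.
Hypothesis critical : forall r, rc <= r ->
  [/\ (rademacher Z (gap_class M pi mu F proj (2 * r ^+ 2))
         <= ((2 ^+ 11)^-1 * r ^+ 2)%:E)%E,
      (rademacher Z (centered_class M pi mu F (K * r))
         <= ((2 ^+ 16)^-1 * r ^+ 2)%:E)%E &
      (K + 1) * (ln (delta * r)^-1 / n%:R) <= (5 * (9 * 2 ^+ 11))^-1 * r ^+ 2].

Let K1 : 1 <= K := radius_factor_ge1 Fq beta_lt1.
Let K0 : 0 < K. Proof. exact: lt_le_trans K1. Qed.
Let n0 : 0 < n%:R :> R. Proof. by rewrite ltr0n. Qed.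
Let rc2 : 0 < rc ^+ 2. Proof. by rewrite exprn_gt0. Qed.
Let ex9 f : F f -> excess f <= 9. Proof. exact: excess_le9. Qed.

Let dist9 f : F f -> sqnorm mu (f \- q) <= 9.
Proof.
move=> Ff; have mu1 : mu setT = 1%E by exact: probability_setT.
have bf := class_bmeas HF Ff; have bq := class_bmeas HF Fq.
rewrite -[leRHS](Rint_cst mu1); apply: (le_Rint mu1).
- by apply: bmeasX; exact: bmeasB.
- exact: bmeas_cst.
move=> x /=; have := class_norm HF x Fq; have := class_norm HF x Ff.
rewrite !ler_norml => /andP[? ?] /andP[? ?]; nra.
Qed.

Let rad (k : nat) : R := Num.sqrt (2 ^+ k) * rc.
Let rad2 k : rad k ^+ 2 = 2 ^+ k * rc ^+ 2.
Proof. by rewrite /rad exprMn sqr_sqrtr ?exprn_ge0. Qed.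
Let rad_ge k : rc <= rad k.
Proof.
rewrite /rad ler_peMl ?(ltW rc_gt0) // -[leLHS]sqrtr1 ler_sqrt ?exprn_ge0 //.
by rewrite exprn_ege1 // ler1n.
Qed.
Let rad_gt0 k : 0 < rad k. Proof. exact: lt_le_trans (rad_ge k). Qed.

Let theta := expR (- (n%:R * rc ^+ 2 / (9 * 2 ^+ 11 * K))).

Let shell_le k : shell_bound (rad k) <= theta ^+ k.+1.
Proof.
rewrite /theta -expRM_natl ler_expR rad2 mulrN lerN2.
have -> : n%:R * (2 ^+ k * rc ^+ 2) / (9 * 2 ^+ 11 * K) =
  2 ^+ k * (n%:R * rc ^+ 2 / (9 * 2 ^+ 11 * K)) by ring.
rewrite ler_wpM2r //.
  by rewrite divr_ge0 ?mulr_ge0 ?sqr_ge0 ?exprn_ge0 // ltW.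
by rewrite -natrX ler_nat ltn_expl.
Qed.

(** The factor 5 in the third constant becomes the exponent here. The logarithm is nonnegative
    because delta rc < 1/2, so K + 1 may be lowered to K. *)
Let theta_le : delta * rc < 2^-1 -> theta <= (delta * rc) ^+ 5.
Proof.
move=> dr; have d0 : 0 < delta by have /andP[] := delta01.
have dr0 : 0 < delta * rc by rewrite mulr_gt0.
have [_ _] := critical (lexx rc); rewrite lnV ?posrE // => h.
rewrite -[leRHS]lnK ?posrE ?exprn_gt0 // lnXn // ler_expR lerNl -mulNrn.
have L0 : 0 <= - ln (delta * rc).
  by rewrite oppr_ge0; apply: ln_le0; apply: ltW; lra.
move: h L0; set L := - ln _ => h L0.
have h2 : K * L <= (5 * (9 * 2 ^+ 11))^-1 * (n%:R * rc ^+ 2).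
  apply: (@le_trans _ _ ((K + 1) * (L / n%:R) * n%:R)).
    rewrite mulrA divfK ?gt_eqF // mulrDl mul1r lerDl //.
  by rewrite [X in _ <= _ * X]mulrC [leRHS]mulrA ler_pM2r.
have p0 : 0 < 9 * 2 ^+ 11 * K by rewrite !mulr_gt0 // exprn_gt0.
have c0 : 0 < 5 * (9 * 2 ^+ 11) :> R by rewrite !mulr_gt0 // exprn_gt0.
rewrite ler_pdivlMr //.
move: h2; rewrite [leRHS]mulrC ler_pdivlMr //.
by rewrite -[L *+ 5]mulr_natr; lra.
Qed.

Let ndist_bound (x s c : R) : `|x + s| <= c -> x <= c - s.
Proof. by move=> /ler_normlP[_]; lra. Qed.

(* On the shell of radius [rad k], with square 2 ^ k * rc ^ 2, the bounds fail with
   probability at most 2 * theta ^ (2 ^ k) <= 2 * theta ^ k.+1, which sums up to at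
   most 4 * theta <= 4 * (delta * rc) ^ 5. *)
Lemma good_event_peeling : delta * rc < 2^-1 -> rc < 3 ->
  exists2 E : set Omega, measurable E /\ ((1 - delta)%:E <= P E)%E &
    forall w, E w -> good_sample rc w.
Proof.
move=> dr rc3; have /andP[d0 d1] := delta01.
have [N N9] : exists N : nat, 9 <= 2 ^+ N * rc ^+ 2.
  exists (Num.truncn (9 / rc ^+ 2)).+1.
  rewrite -ler_pdivrMr //; apply: le_trans (ltW (truncnS_gt _)) _.
  by rewrite -natrX ler_nat ltnW // ltn_expl.
pose good k w :=
  (forall f, F f -> excess f <= 2 * rad k ^+ 2 ->
     `|n%:R^-1 * \sum_(i < n) loss_gap M pi (proj f) f (Z i w) - excess f|
       <= rad k ^+ 2 / 2) /\
  (forall f, F f -> sqnorm mu (f \- q) <= rad k ^+ 2 ->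
     `|n%:R^-1 * \sum_(i < n) loss_gap M pi f q (Z i w) + sqnorm mu (f \- q)|
       <= rad k ^+ 2 / 4).
(* The N shells reach the a priori bound 9; one more radius is needed because the regression bound
   uses the outer radius of a shell. *)
have ev k : (k < N.+1)%N -> exists2 E : set Omega,
    measurable E /\ ((1 - (shell_bound (rad k) + shell_bound (rad k)))%:E <= P E)%E &
    forall w, E w -> good k w.
  move=> _; have [h1 h2 _] := critical (rad_ge k).
  have [E1 [mE1 PE1] EH1] := gap_event_exp n_gt0 HF Fq beta_lt1 projP iid sep (rad_gt0 k) h1.
  have [E2 [mE2 PE2] EH2] := regression_event_exp n_gt0 HF Fq beta_lt1 iid sep (rad_gt0 k) h2.
  exists (E1 `&` E2).
    by split; [exact: measurableI|exact: events_cap].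
  by move=> w [E1w E2w]; split; [exact: EH1|exact: EH2].
have [E [mE PE] EH] := events_forall ev.
exists E.
  split => //; apply: le_trans PE; rewrite lee_fin lerD2l lerN2.
  have th0 : 0 < theta by exact: expR_gt0.
  have dr0 : 0 < delta * rc by rewrite mulr_gt0.
  have th5 := theta_le dr.
  have p4 : (delta * rc) ^+ 4 <= (2^-1) ^+ 4 by rewrite lerXn2r ?nnegrE ?(ltW dr0) // ltW.
  (* 4 (delta rc)^5 <= 4 (3 delta) / 16, from rc < 3 for one factor and delta rc < 1/2 for the other
     four. *)
  have th4 : 4 * theta <= delta.
    have h5 : (delta * rc) ^+ 5 <= delta * rc * (2^-1) ^+ 4.
      by rewrite exprS ler_wpM2l // ltW.
    have h3 : delta * rc <= delta * 3 by rewrite ler_wpM2l ?ltW.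
    have -> : delta = 4 * (delta * 3 * (2^-1) ^+ 4) + delta / 4 by field.
    have := le_trans th5 h5; move: h3; have -> : (2^-1 : R) ^+ 4 = 1 / 16 by field.
    by lra.
  have th2 : theta <= 2^-1 by lra.
  have S2 : \sum_(k < N.+1) theta ^+ k <= 2.
    have := geometric_sumM theta N.+1; have := exprn_ge0 N.+1 (ltW th0).
    have : 0 <= \sum_(k < N.+1) theta ^+ k.
      by apply: sumr_ge0 => k _; rewrite exprn_ge0 // ltW.
    set s := \sum_(k < _) _; nra.
  apply: (@le_trans _ _ (\sum_(k < N.+1) 2 * theta * theta ^+ k)).
    apply: ler_sum => k _; have := shell_le k; rewrite exprS; lra.
  rewrite -mulr_sumr; apply: le_trans th4.
  have := ler_wpM2l (ltW th0) S2; lra.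
move=> w Ew; have gw := EH w Ew; split => f Ff.
  move=> big; have e9 : excess f <= 2 ^+ N * rc ^+ 2 by exact: le_trans (ex9 Ff) N9.
  have [k kN [k1 k2]] := dyadic_shell big e9.
  (* The gap class at radius r admits excesses up to 2 r^2, so [rad k] covers the whole shell, and
     half of its lower end survives the deviation. *)
  have [gk _] := gw k (leqW kN).
  have := gk f Ff; rewrite rad2 mulrA -exprS => /(_ k2) /ler_normlP[h1 _].
  have : rc ^+ 2 <= 2 ^+ k * rc ^+ 2.
    by rewrite ler_peMl ?(ltW rc2) // exprn_ege1 // ler1n.
  by lra.
have [small|big] := leP (sqnorm mu (f \- q)) (rc ^+ 2).
  have [_ gk] := gw 0%N (ltn0Sn N).
  have := gk f Ff; rewrite rad2 expr0 mul1r => /(_ small) /ndist_bound h1.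
  by apply: le_trans h1 _; rewrite gerBl sqnorm_ge0.
have e9 : sqnorm mu (f \- q) <= 2 ^+ N * rc ^+ 2 by exact: le_trans (dist9 Ff) N9.
have [k kN [k1 k2]] := dyadic_shell big e9.
(* The regression class stops at r^2, hence the next radius. Its deviation 2^(k+1) rc^2 / 4 stays
   below the lower end 2^k rc^2 of the shell, so the empirical value is even negative. *)
have [_ gk] := gw k.+1 kN.
have := gk f Ff; rewrite rad2 => /(_ k2) /ndist_bound h1.
apply: le_trans h1 _; rewrite exprS.
have p0 : 0 <= 2 ^+ k * rc ^+ 2 by rewrite mulr_ge0 ?exprn_ge0 // ltW.
by have := rc2; lra.
Qed.

(* The condition on ln (delta * r)^-1 may be void here, but delta > 1 / 6 and
   Markov's inequality at radius 3, where localization is void, suffices. *)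
Lemma good_event_markov : 2^-1 <= delta * rc -> rc < 3 ->
  exists2 E : set Omega, measurable E /\ ((1 - delta)%:E <= P E)%E &
    forall w, E w -> good_sample rc w.
Proof.
move=> dr rc3; have /andP[d0 d1] := delta01.
have [h1 h2 _] := critical (ltW rc3).
have r30 : 0 < 3 :> R by [].
have p11 : 0 <= (2 ^+ 11)^-1 * 3 ^+ 2 :> R.
  by rewrite mulr_ge0 ?invr_ge0 ?exprn_ge0.
have p16 : 0 <= (2 ^+ 16)^-1 * 3 ^+ 2 :> R.
  by rewrite mulr_ge0 ?invr_ge0 ?exprn_ge0.
have t2 : 0 < rc ^+ 2 / 2 by rewrite divr_gt0.
have t4 : 0 < rc ^+ 2 / 4 by rewrite divr_gt0.
have [E1 [mE1 PE1] EH1] := gap_event n_gt0 HF Fq beta_lt1 projP iid sep r30 p11 h1 t2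
  (or_introl erefl).
have [E2 [mE2 PE2] EH2] := regression_event n_gt0 HF Fq beta_lt1 iid sep r30 p16 h2 t4
  (or_introl erefl).
exists (E1 `&` E2).
  split; first exact: measurableI.
  apply: le_trans (events_cap mE1 mE2 PE1 PE2).
  rewrite lee_fin lerD2l lerN2.
  have rch : 2^-1 <= rc by apply: le_trans dr _; rewrite ler_piMl ?ltW.
  have r4 : 4^-1 <= rc ^+ 2.
    have -> : 4^-1 = 2^-1 ^+ 2 :> R by field.
    by rewrite ler_sqr ?nnegrE // ltW.
  have d6 : 6^-1 <= delta.
    have : delta * rc <= delta * 3 by rewrite ler_wpM2l ?ltW.
    by lra.
  apply: le_trans d6.
  (* The sum is about 0.031 / rc^2, which is below 1/6 as rc^2 >= 1/4. *)
  have -> : 2 * ((2 ^+ 11)^-1 * 3 ^+ 2) / (rc ^+ 2 / 2) +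
      2 * (12 * ((2 ^+ 16)^-1 * 3 ^+ 2)) / (rc ^+ 2 / 4) =
      (36 / 2 ^+ 11 + 27 * 32 / 2 ^+ 16) / rc ^+ 2.
    by field; rewrite gt_eqF.
  rewrite ler_pdivrMr //; lra.
move=> w [E1w E2w]; split => f Ff.
  move=> big.
  have e18 : excess f <= 2 * 3 ^+ 2 by apply: le_trans (ex9 Ff) _; lra.
  have /ler_normlP[k1 _] := EH1 w E1w f Ff e18.
  by lra.
have s9 : sqnorm mu (f \- q) <= 3 ^+ 2 by apply: le_trans (dist9 Ff) _; lra.
have /ndist_bound k2 := EH2 w E2w f Ff s9.
by apply: le_trans k2 _; rewrite gerBl sqnorm_ge0.
Qed.

End good_event.

(** * From the excess to the prediction error *)

Section error_bound.
Context (R : realType) d d' (S : measurableType d) (A : measurableType d').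
Local Notation SA := (S * A)%type.
Variables (M : mdp R S A) (pi : R.-pker S ~> A) (s0 : S) (mu : probability SA R).
Variables (F : set (SA -> R)) (proj : (SA -> R) -> SA -> R).
Local Notation T := (bellman M pi).
Local Notation beta := (fine (incompleteness M pi mu F)).
Hypothesis HF : forall f, F f -> measurable_fun setT f /\ forall x, -1 <= f x <= 1.
Hypothesis Fq : F (qvalue M pi).
Hypothesis beta_lt1 : (incompleteness M pi mu F < 1)%E.
Hypothesis projP : forall f, F f -> argmin F (fun g => sqnorm mu (g \- T f)) (proj f).

Lemma error_of_excess (rc : R) f : 0 < rc -> F f -> excess M pi mu proj f <= rc ^+ 2 ->
  (`| prediction_error M pi s0 f |%:E <=
     (rc / (1 - discount M))%:E *
     sqrte (concentrability M pi s0 mu F * ((1 - beta)^-1)%:E))%E.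
Proof.
move=> rc0 Ff ef.
have b1 : 0 < 1 - beta by rewrite subr_gt0 (beta_lt1R Fq).
have g1 : 0 < 1 - discount M by rewrite subr_gt0 discount_lt1.
have rg : 0 < rc / (1 - discount M) by rewrite divr_gt0.
have D0 := sqnorm_ge0 mu (f \- T f).
have O0 := sqnorm_ge0 (occupancy M pi s0) (f \- T f).
have res := residual_le Fq beta_lt1 projP Ff.
have PE2 := prediction_error_le s0 (class_bmeas HF Ff) (class_bmeas HF Fq).
have : (eratio (sqnorm (occupancy M pi s0) (f \- T f)%R) (sqnorm mu (f \- T f)%R)
    <= concentrability M pi s0 mu F)%E.
  by apply: ereal_sup_ubound; exists f.
move: D0 O0 res PE2; set D := sqnorm mu _; set O := sqnorm (occupancy _ _ _) _.
move=> D0 O0 res PE2 Cge.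
have C0 : (0 <= concentrability M pi s0 mu F)%E.
  apply: le_trans Cge; rewrite /eratio; case: ifP => _; first by case: ifP.
  by rewrite lee_fin divr_ge0.
(* For infinite concentrability the right side is +oo, because rc / (1 - gamma) > 0. *)
move: Cge C0; case: concentrability => [c|_ _|//]; last first.
  rewrite mulyr gtr0_sg ?invr_gt0 // mul1e /= mulry gtr0_sg // mul1e.
  by rewrite leey.
move=> Cge; rewrite lee_fin => c0.
have occ_le : O <= c * D.
  (* If the residual vanishes under mu, finiteness of c and the convention of [eratio] make it
     vanish under the occupancy measure. *)
  move: Cge; rewrite /eratio; case: eqVneq => [->|Dn0].
    by case: eqVneq => [->|_] //; rewrite mulr0.
  by rewrite lee_fin ler_pdivrMr // lt_neqAle eq_sym Dn0.
rewrite -EFinM /= lee_fin.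
rewrite -ler_sqr ?nnegrE //; last by rewrite mulr_ge0 ?sqrtr_ge0 // ltW.
apply: (le_trans PE2); rewrite exprMn sqr_sqrtr ?divr_ge0 ?(ltW b1) //.
rewrite expr_div_n [leRHS](_ : _ = (1 - discount M) ^- 2 * (rc ^+ 2 * (c / (1 - beta)))); last by ring.
rewrite ler_wpM2l ?invr_ge0 ?sqr_ge0 //.
apply: (le_trans occ_le); rewrite mulrCA ler_wpM2l // ler_pdivlMr // mulrC.
exact: le_trans res ef.
Qed.

End error_bound.

Theorem theorem2 (R : realType) :
  exists c1 c2 c3 : R, [/\ 0 < c1, 0 < c2, 0 < c3 &
  forall (dS dA : measure_display)
    (S : measurableType dS) (A : measurableType dA)
    (M : mdp R S A) (pi : R.-pker S ~> A) (s0 : S)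
    (mu : probability (S * A)%type R)
    (F : set ((S * A)%type -> R))
    (gproj : ((S * A)%type -> R) -> (S * A)%type -> R)
    (n : nat) (dO : measure_display) (Omega : measurableType dO)
    (P : probability Omega R)
    (Z : 'I_n -> {RV P >-> ((S * A) * (R * S))%type})
    (fhat : Omega -> (S * A)%type -> R) (delta rc : R),
  (0 < n)%N ->
  (forall f, F f -> measurable_fun setT f /\ forall x, -1 <= f x <= 1) ->
  F (qvalue M pi) ->
  (incompleteness M pi mu F < 1)%E ->
  (forall f, F f ->
    argmin F (fun g => sqnorm mu (g \- bellman M pi f)) (gproj f)) ->
  iid_sample (data_law M mu) Z ->
  (forall t, 0 < t ->
    [/\ separable_process (data_law M mu) Z (gap_class M pi mu F gproj t),
        separable_process (data_law M mu) Z (centered_class M pi mu F t) &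
        separable_process (data_law M mu) Z (regression_class M pi mu F t)]) ->
  0 < delta < 1 ->
  0 < rc ->
  (forall r, rc <= r ->
    [/\ (rademacher Z (gap_class M pi mu F gproj (2 * r ^+ 2))
           <= (c1 * r ^+ 2)%:E)%E,
        (rademacher Z
           (centered_class M pi mu F (radius_factor M pi mu F * r))
           <= (c2 * r ^+ 2)%:E)%E &
        (radius_factor M pi mu F + 1) * (ln (delta * r)^-1 / n%:R)
           <= c3 * r ^+ 2]) ->
  (forall w f, F f ->
    argmin F (emp_loss M pi (fun i => Z i w) ^~ f) !=set0) ->
  (forall w, argmin F (emp_minimax M pi F (fun i => Z i w)) (fhat w)) ->
  exists2 E : set Omega, measurable E /\ ((1 - delta)%:E <= P E)%E &
    forall w, E w ->
      (`| prediction_error M pi s0 (fhat w) |%:E <=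
       (rc / (1 - discount M))%:E *
       sqrte (concentrability M pi s0 mu F *
              ((1 - fine (incompleteness M pi mu F))^-1)%:E))%E].
Proof.
(* The first two constants make the Rademacher terms negligible in the exponents and in Markov's
   bound; the third yields theta <= (delta rc)^5. *)
exists (2 ^+ 11)^-1, (2 ^+ 16)^-1, (5 * (9 * 2 ^+ 11))^-1; split.
- by rewrite invr_gt0 exprn_gt0.
- by rewrite invr_gt0 exprn_gt0.
- by rewrite invr_gt0 !mulr_gt0 // exprn_gt0.
move=> dS dA S A M pi s0 mu F gproj n dO Omega P Z fhat delta rc n0 HF Fq blt1
  projP iid sep d01 rc0 crit emin fhatP.
have /andP[d0 d1] := d01.
suff [E [mE PE] EH] : exists2 E : set Omega,
    measurable E /\ ((1 - delta)%:E <= P E)%E &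
    forall w, E w -> excess M pi mu gproj (fhat w) <= rc ^+ 2.
  exists E => // w Ew; have [Ff _] := fhatP w.
  apply: (error_of_excess s0 HF Fq blt1 projP rc0 Ff); exact: EH.
have [rc3|rc3] := leP 3 rc.
  exists setT; first by rewrite probability_setT lee_fin gerBl ltW.
  move=> w _; have [Ff _] := fhatP w.
  apply: le_trans (excess_le9 M pi mu gproj HF Ff) _.
  have -> : 9 = 3 ^+ 2 :> R by ring.
  by rewrite ler_sqr ?nnegrE // ltW.
have good : exists2 E : set Omega, measurable E /\ ((1 - delta)%:E <= P E)%E &
    forall w, E w -> good_sample M pi mu F gproj Z rc w.
  have [dr|dr] := ltP (delta * rc) 2^-1.
    exact: good_event_peeling.
  exact: good_event_markov.
have [E mE EH] := good; exists E => // w Ew.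
exact: (good_sample_excess Fq projP rc0 (EH w Ew) (emin w) (fhatP w)).
Qed.
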